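(* Let $V$ be a (deterministic) $N\times N$ unitary matrix, let $\psi$ be a (possibly random) unit vector of $\mathbb C^N$, and let $(U_t)_{t\ge0}$ be a unitary Brownian motion with $U_0=I$, independent of $\psi$. Put $\psi_t=U_t\psi$ for $t\ge 0$. Then the processes $(V\psi_t)_{t\ge0}$ and $(U_tV\psi)_{t\ge0}$ have the same distribution. In particular, the processes $(V\psi_t)_{t\ge0}$ and $(\psi_t)_{t\ge0}$ have the same distribution if and only if the random vectors $V\psi$ and $\psi$ have the same distribution.
   Context: Hermitian Brownian motion $(H_t)_{t\ge0}$: the continuous centered Gaussian process in the real vector space of $N\times N$ Hermitian matrices, with $H_0=0$, such that $\mathbb E[\langle A,H_s\rangle\langle B,H_t\rangle]=\min(s,t)\langle A,B\rangle$ for all Hermitian $A,B$, where $\langle A,B\rangle=N\,\mathrm{Tr}(AB)$. The unitary Brownian motion started at $I$ is the solution of the It\^o stochastic differential equation $dU_t=i(dH_t)U_t-\frac12U_t\,dt$, $U_0=I$; it takes values in the group of $N\times N$ unitary matrices. The distribution of a process is its law as a stochastic process indexed by $t\ge0$. *)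

(* Defs.v *)
From HB Require Import structures.
From mathcomp Require Import all_boot all_order all_algebra.
From mathcomp Require Import all_classical all_reals all_analysis.
From mathcomp Require Import complex.
Set Implicit Arguments.
Unset Strict Implicit.
Unset Printing Implicit Defensive.
Import Order.TTheory GRing.Theory Num.Theory.
Import numFieldNormedType.Exports.
Local Open Scope classical_set_scope.
Local Open Scope ring_scope.
Local Open Scope complex_scope.

Section ComplexMatrices.
Context {R : realType} {m n : nat}.
Implicit Types A : 'M[R[i]]_(m, n).

(* [R[i]] carries no measurable structure in the library: complex matrices are
   handled through the real and imaginary parts of their entries. *)
Definition mx_coord (k : 'I_m * 'I_n * bool) A : R :=
  if k.2 then complex.Im (A k.1.1 k.1.2) else complex.Re (A k.1.1 k.1.2).

Definition sqnorm A : R :=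
  \sum_i \sum_j (complex.Re (A i j) ^+ 2 + complex.Im (A i j) ^+ 2).

Definition mx_time_integral (t : R) (x : R -> 'M[R[i]]_(m, n)) :
    'M[R[i]]_(m, n) :=
  \matrix_(i, j)
    ((\int[lebesgue_measure]_(s in `[0, t]) complex.Re (x s i j)) +i*
     (\int[lebesgue_measure]_(s in `[0, t]) complex.Im (x s i j))).

End ComplexMatrices.

Section SigmaAlgebras.
Context {R : realType}.

Definition sigma_generated {E I : Type} (D : set I) (f : I -> E -> R) :
    set (set E) :=
  <<s \bigcup_(k in D)
        preimage_set_system setT (f k) (measurable : set (set R)) >>.

Definition mx_borel {m n : nat} : set (set 'M[R[i]]_(m, n)) :=
  sigma_generated setT mx_coord.

(* Processes are written [R -> T -> E], but only times t >= 0 matter: the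
   cylinder sigma-algebra is generated by the evaluations at times t >= 0. *)
Definition path_cylinder {m n : nat} : set (set (R -> 'M[R[i]]_(m, n))) :=
  sigma_generated [set k : R * ('I_m * 'I_n * bool) | 0 <= k.1]
    (fun k x => mx_coord k.2 (x k.1)).

End SigmaAlgebras.

Section RandomMatrices.
Context {R : realType} {d : measure_display} {T : measurableType d}.
Variable P : probability T R.

Definition mx_measurable_wrt {m n : nat} (G : set (set T))
    (X : T -> 'M[R[i]]_(m, n)) : Prop :=
  forall B, mx_borel B -> G (X @^-1` B).

Definition random_mx {m n : nat} (X : T -> 'M[R[i]]_(m, n)) : Prop :=
  mx_measurable_wrt (measurable : set (set T)) X.

Definition same_distribution {m n : nat} (X Y : T -> 'M[R[i]]_(m, n)) : Prop :=
  forall B, mx_borel B -> P (X @^-1` B) = P (Y @^-1` B).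

Definition same_process_law {m n : nat} (X Y : R -> T -> 'M[R[i]]_(m, n)) :
    Prop :=
  forall B, path_cylinder B ->
    P [set w | B (X ^~ w)] = P [set w | B (Y ^~ w)].

Definition process_indep_mx {m n p q : nat} (X : R -> T -> 'M[R[i]]_(m, n))
    (Y : T -> 'M[R[i]]_(p, q)) : Prop :=
  forall B C, path_cylinder B -> mx_borel C ->
    P ([set w | B (X ^~ w)] `&` Y @^-1` C) =
    (P [set w | B (X ^~ w)] * P (Y @^-1` C))%E.

Definition mx_continuous_paths {m n : nat} (X : R -> T -> 'M[R[i]]_(m, n)) :
    Prop :=
  forall w k, {within `[0, +oo[, continuous (fun t => mx_coord k (X t w))}.

(* Constants are Gaussian, whereas [normal_prob 0 0] is not the Dirac mass at
   0: the degenerate case has to be singled out. *)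
Definition centered_gaussian (X : T -> R) : Prop :=
  measurable_fun setT X /\
  exists sigma : R, forall B : set R, measurable B ->
    P (X @^-1` B) = if sigma == 0 then \d_(0 : R) B else normal_prob 0 sigma B.

End RandomMatrices.

Section HermitianBrownianMotion.
Context {R : realType} {N : nat} {d : measure_display} {T : measurableType d}.
Variable P : probability T R.
Implicit Types (A B : 'M[R[i]]_N) (H : R -> T -> 'M[R[i]]_N).

(* The trace of a product of two Hermitian matrices is real. *)
Definition herm_inner A B : R := N%:R * complex.Re (\tr (A *m B)).

Record hermitian_brownian_motion H : Prop := HermitianBrownianMotion {
  hbm_hermitian : forall (t : R) w, 0 <= t -> H t w \is hermsymmx;
  hbm_start : forall w, H 0 w = 0;
  hbm_continuous : mx_continuous_paths H;
  hbm_gaussian : forall (n : nat) (t : 'I_n -> R) (A : 'I_n -> 'M[R[i]]_N),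
    (forall i, 0 <= t i) -> (forall i, A i \is hermsymmx) ->
    centered_gaussian P (fun w => \sum_i herm_inner (A i) (H (t i) w));
  hbm_covariance : forall A B (s t : R), A \is hermsymmx -> B \is hermsymmx ->
    0 <= s -> 0 <= t ->
    'E_P[fun w => (herm_inner A (H s w) * herm_inner B (H t w))%R]%E =
    (Num.min s t * herm_inner A B)%:E }.

End HermitianBrownianMotion.

Section ItoIntegral.
Context {R : realType} {N : nat} {d : measure_display} {T : measurableType d}.
Variable P : probability T R.
Implicit Types (F : R -> set (set T)) (H X : R -> T -> 'M[R[i]]_N).

Record filtration F : Prop := Filtration {
  filtration_sigma : forall s : R, 0 <= s -> sigma_algebra setT (F s);
  filtration_sub : forall s : R, 0 <= s -> F s `<=` measurable;
  filtration_mono : forall s t : R, 0 <= s -> s <= t -> F s `<=` F t }.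

Definition adapted F X : Prop :=
  forall s : R, 0 <= s -> mx_measurable_wrt (F s) (X s).

Definition increments_indep F H : Prop :=
  forall (s t : R) (E : set T) (B : set 'M[R[i]]_N), 0 <= s -> s <= t ->
    F s E -> mx_borel B ->
    let incr : T -> 'M[R[i]]_N := fun w => H t w - H s w in
    P (E `&` incr @^-1` B) = (P E * P (incr @^-1` B))%E.

(* The process equal to [sp_value j] on the interval ]sp_time j, sp_time j.+1]
   for j < sp_size, and to 0 elsewhere. *)
Record simple_process := SimpleProcess {
  sp_size : nat;
  sp_time : nat -> R;
  sp_value : nat -> T -> 'M[R[i]]_N }.

Definition sp_eval (phi : simple_process) (s : R) (w : T) : 'M[R[i]]_N :=
  \sum_(0 <= j < sp_size phi)
    if sp_time phi j < s <= sp_time phi j.+1 then sp_value phi j w else 0.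

Record admissible F (t : R) (phi : simple_process) : Prop := Admissible {
  adm_start : sp_time phi 0 = 0;
  adm_end : sp_time phi (sp_size phi) = t;
  adm_mono : forall j, (j < sp_size phi)%N ->
    sp_time phi j <= sp_time phi j.+1;
  adm_adapted : forall j, (j < sp_size phi)%N ->
    mx_measurable_wrt (F (sp_time phi j)) (sp_value phi j);
  adm_bounded : exists M : R, forall j w, (j < sp_size phi)%N ->
    sqnorm (sp_value phi j w) <= M }.

Definition sp_integral H (phi : simple_process) (w : T) : 'M[R[i]]_N :=
  \sum_(0 <= j < sp_size phi)
    (H (sp_time phi j.+1) w - H (sp_time phi j) w) *m sp_value phi j w.

Definition cvg_in_probability0 (Z : nat -> T -> \bar R) : Prop :=
  forall eps : R, 0 < eps ->
    P [set w | (eps%:E <= Z k w)%E] @[k --> \oo] --> (0 : \bar R).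

(* [J] is the Ito integral of [(dH_s) X_s] over [0, t]: the limit in
   probability of integrals of bounded adapted simple processes which approach
   [X] in L^2([0, t]), in probability. *)
Definition is_ito_integral F H X (t : R) (J : T -> 'M[R[i]]_N) : Prop :=
  exists phi : nat -> simple_process,
    [/\ forall k, admissible F t (phi k),
        cvg_in_probability0 (fun k w =>
          \int[lebesgue_measure]_(s in `[0%R, t])
            (sqnorm (X s w - sp_eval (phi k) s w))%:E)%E &
        cvg_in_probability0 (fun k w =>
          (sqnorm (sp_integral H (phi k) w - J w))%:E) ].

(* dU = i (dH) U - (1/2) U dt with U_0 = I, in integrated form. *)
Definition unitary_sde F H X : Prop :=
  forall t : R, 0 <= t -> exists J : T -> 'M[R[i]]_N,
    [/\ random_mx J, is_ito_integral F H X t J &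
        {ae P, forall w, X t w =
           1%:M + 'i%C *: J w - 2^-1 *: mx_time_integral t (X ^~ w)} ].

Definition hermitian_brownian_motion_wrt F H : Prop :=
  [/\ filtration F, hermitian_brownian_motion P H, adapted F H &
      increments_indep F H].

(* Any filtration making [H] a Brownian motion and [U] adapted is allowed; the
   natural filtration of [H] is a special case.  That [U] almost surely takes
   unitary values follows from the equation. *)
Definition unitary_brownian_motion (U : R -> T -> 'M[R[i]]_N) : Prop :=
  exists (F : R -> set (set T)) (H : R -> T -> 'M[R[i]]_N),
    [/\ hermitian_brownian_motion_wrt F H, adapted F U,
        mx_continuous_paths U, forall w, U 0 w = 1%:M & unitary_sde F H U].

End ItoIntegral.

(* Main.v *)
(* The Euler scheme of the stochastic differential equation converges to U_t in
   probability, and its value at a fixed step is an explicit function E of the path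
   of H which satisfies E(V H V^* ) = V E(H) V^*.  A Gaussian computation and the
   Cramer-Wold device show that V H V^* has the law of H, so V U V^* has the law
   of U.  By independence of U and psi, the process
   V U_t psi = (V U_t V^* )(V psi) then has the law of U_t (V psi).

   The scheme converges by a discrete Gronwall argument in probability, which only
   uses the independence of the increments of H from the past: the integral
   equation is first compared with Riemann sums of U along a grid by means of the
   simple processes which define the Ito integral, and these Riemann sums are then
   compared with the scheme. *)

(* Two obstacles shape the estimates. The process [U] comes with no moment bound, and its Ito
   integral is only a limit in probability along unspecified simple processes. Mean-square estimates
   therefore apply only to a system whose forcing has been stopped, and every conclusion about [U]
   itself is in probability. The second obstacle is uniformity: Riemann sums approach [U] at each
   fixed time, without a rate, while a comparison on a single grid would need them at a number of
   times that grows with the refinement. Hence two nested grids. The coarse one carries the scheme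
   and is fixed first, so that only finitely many defects have to be small; the fine one serves the
   comparison alone and is refined afterwards, the error to be bounded being independent of it. Laws
   are compared on lower boxes throughout: they form a pi-system, they are what thresholded
   trigonometric polynomials detect, and enlarging them slightly absorbs errors in probability. *)
From HB Require Import structures.
Require Import Defs.
From mathcomp Require Import all_boot all_order all_algebra.
From mathcomp Require Import all_classical all_reals all_analysis.
From mathcomp Require Import measurable_realfun complex.
From mathcomp Require Import ring lra.
Import Order.TTheory GRing.Theory Num.Theory.
Import numFieldNormedType.Exports.
Local Open Scope classical_set_scope.
Local Open Scope ring_scope.
Set Implicit Arguments.
Unset Strict Implicit.
Unset Printing Implicit Defensive.

(** * Laws on generated sigma-algebras *)

(* [g_sigma_algebraType] is only defined on pointed types. *)
HB.instance Definition _ (R : realType) := isPointed.Build R[i] 0%R.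

Section LevelSets.
Context {R : realType} {d : measure_display} {T : measurableType d}.
Implicit Types f : T -> R.

Lemma measurable_level f (c : R) :
  measurable_fun setT f -> measurable [set w | c <= f w].
Proof.
move=> mf; have -> : [set w | c <= f w] = f @^-1` `[c, +oo[.
  by apply/seteqP; split=> w /=; rewrite in_itv /= andbT.
by rewrite -[_ @^-1` _]setTI; exact: mf.
Qed.

Lemma measurable_lower_level f (c : R) :
  measurable_fun setT f -> measurable [set w | f w <= c].
Proof.
move=> mf; have -> : [set w | f w <= c] = f @^-1` `]-oo, c].
  by apply/seteqP; split=> w /=; rewrite in_itv.
by rewrite -[_ @^-1` _]setTI; exact: mf.
Qed.

Lemma measurable_strict_level f (c : R) :
  measurable_fun setT f -> measurable [set w | c < f w].
Proof.
move=> mf; have -> : [set w | c < f w] = f @^-1` `]c, +oo[.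
  by apply/seteqP; split=> w /=; rewrite in_itv /= andbT.
by rewrite -[_ @^-1` _]setTI; exact: mf.
Qed.

End LevelSets.

Section SigmaGenerated.
Context {R : realType}.

Lemma measurable_forall {d} {T : measurableType d} {J : finType}
    (A : J -> set T) :
  (forall i, measurable (A i)) -> measurable [set w | forall i, A i w].
Proof.
move=> mA; rewrite (_ : mkset _ = \bigcap_(i in [set: J]) A i); last first.
  by apply/seteqP; split=> w h i //; exact: h.
by apply: fin_bigcap_measurable => //; exact: finite_finset.
Qed.

Lemma measurable_lower_box {d} {T : measurableType d} {J : finType}
    (f : J -> T -> R) (a : J -> R) :
  (forall i, measurable_fun setT (f i)) ->
  measurable [set w | forall i, f i w <= a i].
Proof.
by move=> mf; apply: measurable_forall => i; exact: measurable_lower_level.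
Qed.

Lemma sigma_generated_preimage {E I : Type} (D : set I) (f : I -> E -> R) k B :
  D k -> measurable B -> sigma_generated D f (f k @^-1` B).
Proof.
move=> Dk mB; apply: sub_sigma_algebra; exists k => //.
by exists B => //; rewrite setTI.
Qed.

Lemma preimage_sigma_generated {d} {T : measurableType d} {E I : Type}
    (D : set I) (f : I -> E -> R) (X : T -> E) :
  (forall k, D k -> measurable_fun setT (f k \o X)) ->
  forall B, sigma_generated D f B -> measurable (X @^-1` B).
Proof.
move=> mX B; pose G := image_set_system setT X (measurable : set (set T)).
suff : sigma_generated D f `<=` G by move=> /(_ B)/[apply]; rewrite /G /image_set_system/= setTI.
apply: smallest_sub.
  exact/sigma_algebra_image/sigma_algebra_measurable.
move=> A [k Dk [C mC <-]]; rewrite /G /image_set_system/= !setTI.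
by rewrite -[_ @^-1` _]setTI; exact: (mX k Dk measurableT).
Qed.

(** A generating pi-system for [sigma_generated D f]. Bounds may be placed on any finite family of
    indices, with repetitions, so that intersecting two boxes is concatenating two families. *)
Definition lower_boxes {E I : Type} (D : set I) (f : I -> E -> R) :
    set (set E) :=
  [set B | exists n (k : 'I_n -> I) (a : 'I_n -> R),
    (forall i, D (k i)) /\ B = [set x | forall i, f (k i) x <= a i]].

Lemma lower_boxes_setI {E I : Type} (D : set I) (f : I -> E -> R) :
  setI_closed (lower_boxes D f).
Proof.
move=> _ _ [n [k [a [Dk ->]]]] [m [l [b [Dl ->]]]].
exists (n + m)%N,
  (fun i => match fintype.split i with inl j => k j | inr j => l j end),
  (fun i => match fintype.split i with inl j => a j | inr j => b j end).
split=> [i|]; first by case: fintype.split.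
apply/seteqP; split=> [x [ha hb] i|x h]; first by case: fintype.split.
split=> i.
  by have := h (unsplit (inl i)); rewrite unsplitK.
by have := h (unsplit (inr i)); rewrite unsplitK.
Qed.

(** The sets of reals whose preimage under [f k] lies in the right-hand side form a sigma-algebra.
    It contains the rays []x, +oo[], whose preimages are complements of boxes with one
    constraint. *)
Lemma sigma_generated_boxes {E I : Type} (D : set I) (f : I -> E -> R) :
  sigma_generated D f `<=` <<s lower_boxes D f >>.
Proof.
apply: smallest_sub; first exact: smallest_sigma_algebra.
move=> A [k Dk [C mC <-]]; rewrite setTI.
pose G := image_set_system setT (f k) <<s lower_boxes D f >>.
suff : (measurable : set (set R)) `<=` G.
  by move=> /(_ C mC); rewrite /G/= /image_set_system/= setTI.
rewrite (RGenOInfty.measurableE R : (measurable : set (set R)) = _).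
apply: smallest_sub.
  exact/sigma_algebra_image/smallest_sigma_algebra.
move=> _ [x ->]; rewrite /G/= /image_set_system/= setTI.
have -> : f k @^-1` `]x, +oo[ = setT `\` [set y | f k y <= x].
  apply/seteqP; split=> y /=; rewrite in_itv/= andbT ltNge.
    by move=> /negP ?; split.
  by move=> [_ /negP].
apply: sigma_algebraCD; apply: sub_sigma_algebra.
exists 1%N, (fun=> k), (fun=> x); split => //.
by apply/seteqP; split=> y //= h; exact: (h ord0).
Qed.

(** Dynkin's pi-lambda argument: the sets given the same probability by both laws form a Dynkin
    system that contains the boxes. *)
Lemma law_determined_by_boxes {d} {T : measurableType d} (P : probability T R)
    {E I : Type} (D : set I) (f : I -> E -> R) (X Y : T -> E) :
  (forall k, D k -> measurable_fun setT (f k \o X)) ->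
  (forall k, D k -> measurable_fun setT (f k \o Y)) ->
  (forall n (k : 'I_n -> I) (a : 'I_n -> R), (forall i, D (k i)) ->
    P [set w | forall i, f (k i) (X w) <= a i] =
    P [set w | forall i, f (k i) (Y w) <= a i]) ->
  forall B, sigma_generated D f B -> P (X @^-1` B) = P (Y @^-1` B).
Proof.
move=> mX mY XY.
(* Measurability of both preimages is carried along, since [E] has no measurable structure of its
   own and complements and unions need it. *)
pose H := [set B | [/\ measurable (X @^-1` B), measurable (Y @^-1` B) &
  P (X @^-1` B) = P (Y @^-1` B)]].
suff : sigma_generated D f `<=` H by move=> h B /h[].
apply: (subset_trans (@sigma_generated_boxes _ _ D f)).
rewrite -setI_closed_g_dynkin_g_sigma_algebra; last exact: lower_boxes_setI.
apply: smallest_sub.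
  split.
  - by split; rewrite !preimage_setT.
  - move=> A [mA mA' e]; split; rewrite -!preimage_setC; try exact: measurableC.
    by rewrite !probability_setC// e.
  - move=> F tF HF; split; rewrite !preimage_bigcup.
    + by apply: bigcup_measurable => i _; have [] := HF i.
    + by apply: bigcup_measurable => i _; have [] := HF i.
    + rewrite !measure_bigcup//; last 4 first.
      * by move=> i _; have [] := HF i.
      * by move=> i j _ _ [w [? ?]]; apply: tF => //; eexists; split; eassumption.
      * by move=> i _; have [] := HF i.
      * by move=> i j _ _ [w [? ?]]; apply: tF => //; eexists; split; eassumption.
      by apply: eq_eseriesr => i _; have [] := HF i.
move=> B hB; split.
- by move: hB => [n [k [a [Dk ->]]]]; apply: measurable_lower_box => i; exact: mX.
- by move: hB => [n [k [a [Dk ->]]]]; apply: measurable_lower_box => i; exact: mY.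
- by move: hB => [n [k [a [Dk ->]]]]; exact: XY.
Qed.

End SigmaGenerated.

(** * The Cramer-Wold device *)

Section LawIntegral.
Context {R : realType} {d : measure_display} {T : measurableType d}.
Variable P : probability T R.

Lemma eq_law_ge0_integral (Z Z' : T -> R) (g : R -> \bar R) :
  measurable_fun setT Z -> measurable_fun setT Z' ->
  (forall B, measurable B -> P (Z @^-1` B) = P (Z' @^-1` B)) ->
  measurable_fun setT g -> (forall x, 0 <= g x)%E ->
  (\int[P]_w g (Z w) = \int[P]_w g (Z' w))%E.
Proof.
move=> mZ mZ' ZZ' mg g0.
have := @ge0_integral_distribution _ _ T _ R P (mfun_Sub (mem_set mZ)) g mg g0.
have := @ge0_integral_distribution _ _ T _ R P (mfun_Sub (mem_set mZ')) g mg g0.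
rewrite /= => <- <-; apply: eq_measure_integral => A mA _; exact: ZZ'.
Qed.

Lemma eq_law_bounded_integral (Z Z' : T -> R) (g : R -> R) (M : R) :
  measurable_fun setT Z -> measurable_fun setT Z' ->
  (forall B, measurable B -> P (Z @^-1` B) = P (Z' @^-1` B)) ->
  measurable_fun setT g -> (forall x, `|g x| <= M) ->
  (\int[P]_w (g (Z w))%:E = \int[P]_w (g (Z' w))%:E)%E.
Proof.
move=> mZ mZ' ZZ' mg gM.
have ig (Z0 : T -> R) : measurable_fun setT Z0 ->
    P.-integrable setT (EFin \o (g \o Z0)).
  move=> mZ0; apply: measurable_bounded_integrable => //.
  - by rewrite (le_lt_trans (probability_le1 _ _)) ?ltry.
  - exact: measurableT_comp.
  - exists M; split; first exact: num_real.
    by move=> x Mx w _ /=; rewrite (le_trans (gM _))// ltW.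
have mgE : measurable_fun setT (EFin \o g) by exact/measurable_EFinP.
have := @integral_distribution _ _ T _ R P (mfun_Sub (mem_set mZ)) _ mgE (ig _ mZ).
have := @integral_distribution _ _ T _ R P (mfun_Sub (mem_set mZ')) _ mgE (ig _ mZ').
rewrite /= => <- <-; apply: eq_measure_integral => A mA _; exact: ZZ'.
Qed.

End LawIntegral.

Section Threshold.
Context {R : realType}.

(* A polynomial in [y] which tends to the indicator of [1 / 2 <= y] on [0, 1]:
   the sequence takes a trigonometric polynomial to an indicator function. *)
Definition threshold (m : nat) (y : R) : R := 1 - (1 - y ^+ m) ^+ (m * 2 ^ m).

Lemma one_add_mul_le_exp (x : R) n : 0 <= x -> 1 + n%:R * x <= (1 + x) ^+ n.
Proof.
move=> x0; elim: n => [|n ih]; first by rewrite mul0r addr0 expr0.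
rewrite exprS; apply: le_trans (ler_wpM2l _ ih); last by lra.
rewrite -natr1; have := ler0n R n; nra.
Qed.

Lemma exp_one_sub_ge (u : R) n : 0 <= u <= 1 -> 1 - n%:R * u <= (1 - u) ^+ n.
Proof.
move=> /andP[u0 u1]; elim: n => [|n ih]; first by rewrite mul0r subr0 expr0.
rewrite exprS; apply: le_trans (ler_wpM2l _ ih); last by lra.
rewrite -natr1; have := ler0n R n; nra.
Qed.

(** By Bernoulli [1 + n u <= (1 + u)^n], and [(1 - u)^n (1 + u)^n = (1 - u^2)^n] is at most 1. *)
Lemma exp_one_sub_le (u : R) n : 0 <= u <= 1 -> (1 - u) ^+ n <= (1 + n%:R * u)^-1.
Proof.
move=> /andP[u0 u1]; have nu0 : 0 <= n%:R * u by rewrite mulr_ge0.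
rewrite -[leRHS]mul1r ler_pdivlMr; last by lra.
apply: (@le_trans _ _ ((1 - u) ^+ n * (1 + u) ^+ n)).
  by rewrite ler_wpM2l ?one_add_mul_le_exp// exprn_ge0//; lra.
rewrite -exprMn; apply: exprn_ile1; nra.
Qed.

Lemma cvg_invS (c : R) : 0 < c -> (fun m : nat => (1 + m%:R * c)^-1) @ \oo --> (0 : R).
Proof.
move=> c0; apply/cvgr0Pnorm_lt => e e0.
near=> m; have mc : 0 <= m%:R * c by rewrite mulr_ge0// ltW.
rewrite ger0_norm ?invr_ge0 ?addr_ge0// invf_plt ?posrE//; last by lra.
suff : e^-1 / c < m%:R by rewrite ltr_pdivrMr//; lra.
by near: m; exact: nbhs_infty_gtr.
Unshelve. all: by end_near. Qed.

Lemma threshold_itv m (y : R) : 0 <= y <= 1 -> 0 <= threshold m y <= 1.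
Proof.
move=> /andP[y0 y1]; rewrite /threshold.
have h : 0 <= 1 - y ^+ m <= 1.
  by have := exprn_ge0 m y0; have := exprn_ile1 m y0 y1; lra.
have := exprn_ge0 (m * 2 ^ m) (proj1 (andP h)).
have := exprn_ile1 (m * 2 ^ m) (proj1 (andP h)) (proj2 (andP h)); lra.
Qed.

(** The exponent [m * 2 ^ m] is tuned to the level 1 / 2: the product [m 2^m y^m = m (2 y)^m] tends
    to 0 below it and is at least [m] from it on. The factor [m] decides the boundary case
    [y = 1 / 2], where [(2 y)^m] stays equal to 1. *)
Lemma cvg_threshold (y : R) : 0 <= y <= 1 ->
  threshold ^~ y @ \oo --> ((1 / 2 <= y)%R%:R : R).
Proof.
move=> /andP[y0 y1].
have ym m : 0 <= y ^+ m <= 1 by rewrite exprn_ge0// exprn_ile1.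
case: (leP (1 / 2) y) => hy /=.
  rewrite -[X in _ --> X]subr0; apply: cvgB; first exact: cvg_cst.
  apply: (@squeeze_cvgr _ _ _ _ (cst 0) (fun m : nat => (1 + m%:R * 1)^-1)).
  - near=> m; rewrite exprn_ge0 /=; last by have := ym m; lra.
    apply: le_trans (exp_one_sub_le _ (ym m)) _.
    have h1 : 1 <= 2 ^+ m * y ^+ m by rewrite -exprMn exprn_ege1//; lra.
    rewrite natrM natrX lef_pV2 ?posrE; last 2 first.
      by have := ler0n R m; nra.
      by have := ler0n R m; lra.
    by have := ler0n R m; nra.
  - exact: cvg_cst.
  - exact: cvg_invS.
have [->|yn0] := eqVneq y 0.
  apply: cvg_near_cst; near=> m.
  rewrite /threshold expr0n (_ : m == 0%N = false) ?subr0 ?expr1n ?subrr//.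
  by apply/negbTE; rewrite -lt0n; near: m; exact: nbhs_infty_gt.
(* Writing [(2 y)^m] as [s^m s^m] leaves one factor [s^m] to tend to 0, while the other absorbs [m]:
   with [s^-1 = 1 + h], Bernoulli gives [m s^m <= h^-1]. The case [y = 0] was set apart because [s]
   is inverted. *)
pose s := Num.sqrt (2 * y).
have s0 : 0 < s by rewrite sqrtr_gt0; lra.
have s2 : s ^+ 2 = 2 * y by rewrite sqr_sqrtr; lra.
have s1 : s < 1 by rewrite ltNge; apply/negP => ?; nra.
pose h := s^-1 - 1; have h0 : 0 < h.
  by rewrite subr_gt0 invf_gt1.
apply: (@squeeze_cvgr _ _ _ _ (cst 0) (fun m : nat => h^-1 * s ^+ m)).
- near=> m; have th : 0 <= threshold m y <= 1 by apply: threshold_itv; rewrite y0.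
  rewrite (proj1 (andP th)) /=.
  rewrite /threshold.
  have := exp_one_sub_ge (m * 2 ^ m) (ym m).
  suff : (m * 2 ^ m)%:R * y ^+ m <= h^-1 * s ^+ m by lra.
  rewrite natrM natrX -mulrA -exprMn -s2 -exprM mulnC exprM expr2 mulrA.
    have sm0 : 0 < s ^+ m by rewrite exprn_gt0.
  rewrite ler_pM2r// -ler_pdivlMr//.
  rewrite (_ : (s ^+ m)^-1 = (1 + h) ^+ m); last by rewrite /h addrC subrK exprVn.
  rewrite ler_pdivlMl// mulrC; have := one_add_mul_le_exp m (ltW h0); lra.
- exact: cvg_cst.
- rewrite -[X in _ --> X](mulr0 h^-1); apply: cvgMr; apply: cvg_expr.
  by rewrite gtr0_norm.
Unshelve. all: by end_near. Qed.

End Threshold.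

Section CramerWold.
Context {R : realType} {d : measure_display} {T : measurableType d}.
Variables (P : probability T R) (n : nat) (X Y : T -> 'I_n -> R).
Hypothesis mX : forall i, measurable_fun setT (fun w => X w i).
Hypothesis mY : forall i, measurable_fun setT (fun w => Y w i).
Hypothesis XY : forall (theta : 'I_n -> R) (B : set R), measurable B ->
  P ((fun w => \sum_i theta i * X w i) @^-1` B) =
  P ((fun w => \sum_i theta i * Y w i) @^-1` B).
Implicit Types f g : ('I_n -> R) -> R.

Definition same_mean f :=
  [/\ measurable_fun setT (f \o X), measurable_fun setT (f \o Y),
    exists M, forall x, `|f x| <= M &
    (\int[P]_w (f (X w))%:E = \int[P]_w (f (Y w))%:E)%E].

(** A free phase [c] gives sines as well as cosines, and product-to-sum formulas make the class an
    algebra. The mean of each generator depends only on the law of one linear combination, which is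
    all that [XY] provides. *)
Inductive trig_poly : (('I_n -> R) -> R) -> Prop :=
| trig_cos c theta : trig_poly (fun x => cos (c + \sum_i theta i * x i))
| trig_add f g : trig_poly f -> trig_poly g -> trig_poly (fun x => f x + g x)
| trig_scale a f : trig_poly f -> trig_poly (fun x => a * f x).

Lemma trig_cst a : trig_poly (cst a).
Proof.
have := trig_scale a (trig_cos 0 (fun=> 0)); congr trig_poly.
apply/funext => x; rewrite big1 ?addr0 ?cos0 ?mulr1// => i _.
by rewrite mul0r.
Qed.

Lemma trig_cos_mul c theta g : trig_poly g ->
  trig_poly (fun x => cos (c + \sum_i theta i * x i) * g x).
Proof.
move=> tg; elim: tg c theta => {g} [c' theta' c theta|f g _ hf _ hg c theta|a f _ hf c theta].
- have := trig_scale (1/2) (trig_add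
    (trig_cos (c + c') (fun i => theta i + theta' i))
    (trig_cos (c - c') (fun i => theta i - theta' i))).
  congr trig_poly; apply/funext => x.
  set u := \sum_i theta i * x i; set v := \sum_i theta' i * x i.
  have -> : \sum_i (theta i + theta' i) * x i = u + v.
    by rewrite -big_split; apply: eq_bigr => i _; rewrite mulrDl.
  have -> : \sum_i (theta i - theta' i) * x i = u - v.
    by rewrite -sumrB; apply: eq_bigr => i _; rewrite mulrBl.
  rewrite addrACA cosD (_ : c - c' + (u - v) = (c + u) - (c' + v)); last by ring.
  by rewrite cosB; field.
- have := trig_add (hf c theta) (hg c theta); congr trig_poly.
  by apply/funext => x; rewrite mulrDr.
- have := trig_scale a (hf c theta); congr trig_poly.
  by apply/funext => x; rewrite mulrCA.
Qed.

Lemma trig_mul f g : trig_poly f -> trig_poly g -> trig_poly (fun x => f x * g x).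
Proof.
move=> tf tg; elim: tf => {f} [c theta|f f' _ hf _ hf'|a f _ hf].
- exact: trig_cos_mul.
- have := trig_add hf hf'; congr trig_poly.
  by apply/funext => x; rewrite mulrDl.
- have := trig_scale a hf; congr trig_poly.
  by apply/funext => x; rewrite mulrA.
Qed.

Lemma trig_exp f k : trig_poly f -> trig_poly (fun x => f x ^+ k).
Proof.
move=> tf; elim: k => [|k ih]; first exact: (trig_cst 1).
rewrite (_ : (fun _ => _) = (fun x => f x * f x ^+ k)); first exact: trig_mul.
by apply/funext => x; rewrite exprS.
Qed.

Lemma trig_prod (F : 'I_n -> ('I_n -> R) -> R) :
  (forall i, trig_poly (F i)) -> trig_poly (fun x => \prod_i F i x).
Proof.
move=> tF; elim: (index_enum _) => [|j s ih].
  rewrite (_ : (fun _ => _) = cst 1); first exact: trig_cst.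
  by apply/funext => x; rewrite big_nil.
rewrite (_ : (fun _ => _) = (fun x => F j x * \prod_(i <- s) F i x)).
  exact: trig_mul.
by apply/funext => x; rewrite big_cons.
Qed.

Let bounded_integrable f (Z : T -> 'I_n -> R) :
  measurable_fun setT (f \o Z) -> (exists M, forall x, `|f x| <= M) ->
  P.-integrable setT (EFin \o (f \o Z)).
Proof.
move=> mf [M fM]; apply: measurable_bounded_integrable => //.
  by rewrite (le_lt_trans (probability_le1 _ _)) ?ltry.
exists M; split; first exact: num_real.
by move=> x Mx w _ /=; rewrite (le_trans (fM _))// ltW.
Qed.

Lemma trig_same_mean f : trig_poly f -> same_mean f.
Proof.
elim => {f} [c theta|f g _ [fX fY [M fM] fE] _ [gX gY [N gN] gE]|a f _ [fX fY [M fM] fE]].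
- have mcos : measurable_fun setT (fun x : R => cos (c + x)).
    apply: (@measurableT_comp _ _ _ _ _ _ cos); last exact: measurable_funD.
    by apply: continuous_measurable_fun; exact: continuous_cos.
  have mS (Z : T -> 'I_n -> R) : (forall i, measurable_fun setT (fun w => Z w i)) ->
      measurable_fun setT (fun w => \sum_i theta i * Z w i).
    by move=> mZ; apply: measurable_sum => i; exact: measurable_funM.
  split.
  + exact: (measurableT_comp mcos (mS _ mX)).
  + exact: (measurableT_comp mcos (mS _ mY)).
  + by exists 1 => x; rewrite ler_norml cos_geN1 cos_le1.
  + apply: (@eq_law_bounded_integral _ _ _ P _ _ (fun x => cos (c + x)) 1).
    * exact: mS.
    * exact: mS.
    * exact: XY.
    * exact: mcos.
    * by move=> x; rewrite ler_norml cos_geN1 cos_le1.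
- split; [exact: measurable_funD|exact: measurable_funD| |].
    exists (M + N) => x; apply: le_trans (ler_normD _ _) _.
    exact: lerD.
  have iX := bounded_integrable fX (ex_intro _ M fM).
  have iY := bounded_integrable fY (ex_intro _ M fM).
  have jX := bounded_integrable gX (ex_intro _ N gN).
  have jY := bounded_integrable gY (ex_intro _ N gN).
  under eq_integral do rewrite EFinD.
  under [RHS]eq_integral do rewrite EFinD.
  by rewrite !integralD// fE gE.
- split; [exact: measurable_funM|exact: measurable_funM| |].
    exists (`|a| * M) => x; rewrite normrM; exact: ler_wpM2l.
  have iX := bounded_integrable fX (ex_intro _ M fM).
  have iY := bounded_integrable fY (ex_intro _ M fM).
  under eq_integral do rewrite EFinM.
  under [RHS]eq_integral do rewrite EFinM.
  by rewrite !integralZl// fE.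
Qed.

(** Dominated convergence with the constant 1. The bounds on [f] are returned along with the
    equality of means so that a second limit can be taken on the result of the first. *)
Lemma same_mean_lim (f_ : nat -> ('I_n -> R) -> R) f :
  (forall m, same_mean (f_ m)) -> (forall m x, 0 <= f_ m x <= 1) ->
  (forall x, f_ ^~ x @ \oo --> f x) -> same_mean f /\ (forall x, 0 <= f x <= 1).
Proof.
move=> sf f01 ff.
have f01' x : 0 <= f x <= 1.
  apply/andP; split.
    rewrite -(cvg_lim _ (ff x))//; apply: limr_ge.
      by apply/cvg_ex; exists (f x); exact: ff.
    by near=> m; have /andP[] := f01 m x.
  rewrite -(cvg_lim _ (ff x))//; apply: limr_le.
    by apply/cvg_ex; exists (f x); exact: ff.
  by near=> m; have /andP[] := f01 m x.
split=> //.
have fX : measurable_fun setT (f \o X).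
  apply: (@measurable_fun_cvg _ _ _ setT (fun m => f_ m \o X)) => [m|w _].
    by have [] := sf m.
  exact: ff.
have fY : measurable_fun setT (f \o Y).
  apply: (@measurable_fun_cvg _ _ _ setT (fun m => f_ m \o Y)) => [m|w _].
    by have [] := sf m.
  exact: ff.
have lim_int (Z : T -> 'I_n -> R) : (forall m, measurable_fun setT (f_ m \o Z)) ->
    (\int[P]_w (f_ m (Z w))%:E)%E @[m --> \oo] --> (\int[P]_w (f (Z w))%:E)%E.
  move=> mZ.
  apply: (@dominated_cvg _ _ _ P setT _ (fun m w => (f_ m (Z w))%:E) _ (EFin \o cst 1)) => //.
  - by move=> m; apply/measurable_EFinP; exact: mZ.
  - by move=> w _; apply: cvg_EFin; [near=> m|exact: ff].
  - exact: finite_measure_integrable_cst.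
  - by move=> m w _ /=; rewrite lee_fin; have /andP[? ?] := f01 m (Z w); rewrite ger0_norm.
split => //.
  by exists 1 => x; have /andP[? ?] := f01' x; rewrite ger0_norm.
have h1 : (\int[P]_w (f_ m (X w))%:E)%E @[m --> \oo] --> _ := lim_int X (fun m => let: And4 h _ _ _ := sf m in h).
have h2 : (\int[P]_w (f_ m (Y w))%:E)%E @[m --> \oo] --> _ := lim_int Y (fun m => let: And4 _ h _ _ := sf m in h).
apply: cvg_unique h1 _ => //.
apply: cvg_trans h2; apply: near_eq_cvg; near=> m.
by have [] := sf m.
Unshelve. all: by end_near. Qed.

Lemma cvg_prod_ord (k : nat) (u : nat -> 'I_k -> R) (l : 'I_k -> R) :
  (forall i, u ^~ i @ \oo --> l i) -> (fun m => \prod_i u m i) @ \oo --> \prod_i l i.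
Proof.
move=> ul; elim: (index_enum _) => [|j s ih].
  rewrite big_nil; apply: cvg_near_cst; near=> m; by rewrite big_nil.
rewrite big_cons; rewrite (_ : (fun _ => _) = (fun m => u m j * \prod_(i <- s) u m i)).
  exact: cvgM.
by apply/funext => m; rewrite big_cons.
Unshelve. all: by end_near. Qed.

Lemma prod_itv01 (k : nat) (u : 'I_k -> R) :
  (forall i, 0 <= u i <= 1) -> 0 <= \prod_i u i <= 1.
Proof.
move=> u01; apply: (big_ind (fun x => 0 <= x <= 1)) => //.
  by rewrite ler01 lexx.
by move=> x y; nra.
Qed.

Lemma sin_le0_small (u : R) : - pi < u < pi -> (sin u <= 0) = (u <= 0).
Proof.
move=> /andP[u1 u2]; have [u0|u0] := ltP 0 u.
  by apply/negbTE; rewrite -ltNge; apply: sin_gt0_pi; rewrite u0.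
have [->|un] := eqVneq u 0; first by rewrite sin0 lexx.
rewrite -oppr_ge0 -sinN ltW//; apply: sin_gt0_pi.
by rewrite oppr_gt0 lt_neqAle un u0 ltrNl.
Qed.

(* Equal one-dimensional laws give equal means of trigonometric polynomials;
   [x i <= a i] is reached by thresholding [y L i], which is at least 1 / 2
   exactly when [x i <= a i] as soon as [L] is large with respect to [x i - a i]. *)
Theorem cramer_wold (a : 'I_n -> R) :
  P [set w | forall i, X w i <= a i] = P [set w | forall i, Y w i <= a i].
Proof.
pose y (L : nat) i (x : 'I_n -> R) : R := (1 - sin ((x i - a i) / L.+1%:R)) / 2.
have ty L i : trig_poly (y L i).
  have := trig_add (trig_cst (1 / 2)) (trig_scale (1 / 2) (trig_cos (pi / 2 - a i / L.+1%:R)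
    (fun j => (j == i)%:R / L.+1%:R))).
  congr trig_poly; apply/funext => x; rewrite /y.
  rewrite (bigD1 i)//= eqxx big1 ?addr0; last first.
    by move=> j /negbTE ->; rewrite !mul0r.
  rewrite (_ : pi / 2 - a i / L.+1%:R + 1%:R / L.+1%:R * x i = (x i - a i) / L.+1%:R + pi / 2); last first.
    have : L.+1%:R != 0 :> R by rewrite pnatr_eq0.
    by move: (L.+1%:R : R) => K K0; field.
  by rewrite cosDpihalf; lra.
have y01 L i x : 0 <= y L i x <= 1.
  have := sin_le1 ((x i - a i) / L.+1%:R).
  have := sin_geN1 ((x i - a i) / L.+1%:R); rewrite /y; lra.
pose F L m x := \prod_i threshold m (y L i x).
have sF L m : same_mean (F L m).
  apply: trig_same_mean; apply: trig_prod => i.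
  have tN f : trig_poly f -> trig_poly (fun x => 1 - f x).
    move=> tf; have := trig_add (trig_cst 1) (trig_scale (- 1) tf); congr trig_poly.
    by apply/funext => x; rewrite mulN1r.
  by rewrite /threshold; apply: (tN _ (trig_exp _ (tN _ (trig_exp _ (ty L i))))).
pose G L x : R := \prod_i (1 / 2 <= y L i x)%R%:R.
(* First limit, in [m] with [L] fixed: thresholding turns the product into the indicator that every
   [y L i] is at least 1 / 2. *)
have [sG G01] : (forall L, same_mean (G L)) /\ (forall L x, 0 <= G L x <= 1).
  have h L := @same_mean_lim (F L) (G L) (sF L).
  split=> L; apply h.
  - by move=> m x; apply: prod_itv01 => i; exact: threshold_itv.
  - by move=> x; apply: cvg_prod_ord => i; exact: cvg_threshold.
  - by move=> m x; apply: prod_itv01 => i; exact: threshold_itv.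
  - by move=> x; apply: cvg_prod_ord => i; exact: cvg_threshold.
pose box x : R := \prod_i (x i <= a i)%R%:R.
have [[_ _ _ +] _] : same_mean box /\ (forall x, 0 <= box x <= 1).
  (* Second limit, in [L]: each factor is eventually constant, as soon as the argument of the sine
     lies between [- pi] and [pi]. *)
  apply: (same_mean_lim sG G01) => x; apply: cvg_prod_ord => i.
  apply: cvg_near_cst; near=> L; congr (nat_of_bool _)%:R.
  have : - pi < (x i - a i) / L.+1%:R < pi.
    rewrite -ltr_norml normrM normfV ltr_pdivrMr ?normr_gt0 ?pnatr_eq0//.
    rewrite [`|L.+1%:R|]ger0_norm// mulrC -ltr_pdivrMr ?pi_gt0// -natr1.
    apply: (@lt_trans _ _ L%:R); last by rewrite ltrDl.
    by near: L; exact: nbhs_infty_gtr.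
  move=> /sin_le0_small; rewrite pmulr_lle0 ?invr_gt0// subr_le0 => <-.
  by rewrite /y; apply/idP/idP; lra.
have boxE (Z : T -> 'I_n -> R) : (forall i, measurable_fun setT (fun w => Z w i)) ->
    (\int[P]_w (box (Z w))%:E)%E = P [set w | forall i, Z w i <= a i].
  move=> mZ; have mB := @measurable_lower_box _ _ _ _ (fun i w => Z w i) a mZ.
  rewrite -[X in P X]setIT -integral_indic//.
  apply: eq_integral => w _; congr EFin.
  rewrite indicE /box; case: (pselect (forall i, Z w i <= a i)) => h.
    by rewrite mem_set// big1// => i _; rewrite h.
  rewrite memNset//; have /existsNP [i /negP /negbTE hi] := h.
  by rewrite (bigD1 i)//= hi mul0r.
by rewrite !boxE.
Unshelve. all: by end_near. Qed.

End CramerWold.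

(** * Centered Gaussian laws *)

Section GaussianLaw.
Context {R : realType} {d : measure_display} {T : measurableType d}.
Variable P : probability T R.
Implicit Types X Y Z : T -> R.

Lemma eq_cdf_law Z Z' : measurable_fun setT Z -> measurable_fun setT Z' ->
  (forall a, P [set w | Z w <= a] = P [set w | Z' w <= a]) ->
  forall B, measurable B -> P (Z @^-1` B) = P (Z' @^-1` B).
Proof.
move=> mZ mZ' h B mB.
pose f (_ : unit) := @id R.
have hB : sigma_generated [set: unit] f B.
  by have := @sigma_generated_preimage _ _ _ [set: unit] f tt B I mB.
apply: (@law_determined_by_boxes _ _ _ P _ _ _ f Z Z' _ _ _ B hB) => //.
move=> [|n] k a _ /=.
  by congr (P _); apply/seteqP; split=> w _ [].
(* All constraints bear on the same variable, so the box is the ray at the smallest bound. *)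
pose j := [arg min_(i < ord0) a i]%O.
have boxE Y : [set w | forall i, f (k i) (Y w) <= a i] = [set w | Y w <= a j].
  apply/seteqP; split=> w /= hw; first exact: hw.
  move=> i; apply: le_trans hw _; rewrite /j; case: arg_minP => // i0 _ hi0.
  exact: hi0.
by rewrite !boxE.
Qed.

(** Change of variable [x -> c x] in the density. Only the squares of [s1] and [s2] enter, so
    deviations of either sign are covered. *)
Lemma normal_prob_scale (c s1 s2 a : R) : 0 < c -> s1 != 0 -> s2 != 0 ->
  c ^+ 2 * s1 ^+ 2 = s2 ^+ 2 ->
  normal_prob 0 s2 `]-oo, c * a] = normal_prob 0 s1 `]-oo, a].
Proof.
move=> c0 s10 s20 cs; rewrite /normal_prob.
have dF : (( *%R c : R -> R)^`())%classic = cst c.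
  apply/funext => x; rewrite derive1E deriveM// derive_cst derive_id.
  by rewrite scaler0 addr0 /GRing.scale/= mulr1.
rewrite increasing_ge0_integration_by_substitutionNy.
- apply: eq_integral => x _; congr EFin; rewrite dF !fctE/=.
  rewrite !normal_pdfE// /normal_fun !subr0.
  rewrite /normal_peak -cs exprMn mulrAC; congr (_ * expR _); last first.
    by field; rewrite s10 gt_eqF.
  rewrite -mulrA -mulrnAr sqrtrM ?sqr_ge0// sqrtr_sqr gtr0_norm//.
  by rewrite invfM mulrAC mulVf ?gt_eqF// mul1r.
- by move=> x y _ _; rewrite ltr_pM2l.
- by rewrite dF => x _; exact: cst_continuous.
- by rewrite dF; exact: is_cvg_cst.
- by rewrite dF; exact: cvg_cst.
- split; first by move=> x _; exact: derivableM.
  by apply: cvg_at_left_filter; apply: cvgMr; exact: cvg_id.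
- by apply/gt0_cvgMrNy => //; exact: cvg_id.
- by apply: continuous_subspaceT; exact: continuous_normal_pdf.
- by move=> x _; exact: normal_pdf_ge0.
Qed.

Lemma integral_sqr_eq0 Z : measurable_fun setT Z ->
  (\int[P]_w (Z w ^+ 2)%:E)%E = 0%E <-> P (Z @^-1` [set 0]) = 1%E.
Proof.
move=> mZ.
have mZ0 : measurable (Z @^-1` [set 0 : R]).
  by rewrite -[_ @^-1` _]setTI; exact: mZ.
have mZ2 : measurable_fun setT (fun w => (Z w ^+ 2)%:E).
  by apply/measurable_EFinP; exact: measurable_funX.
split=> h.
  have : (ae_eq P setT (fun w => (Z w ^+ 2)%:E) (cst 0))%E.
    apply/ae_eq_integral_abs => //.
    rewrite -[RHS]h; apply: eq_integral => w _.
    by rewrite gee0_abs// lee_fin sqr_ge0.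
  move=> [A [mA PA hA]]; apply/eqP; rewrite eq_le probability_le1//=.
  have -> : (1 = P (~` A))%E by rewrite probability_setC// PA sube0.
  apply: le_measure; rewrite ?inE//; first exact: measurableC.
  move=> w Aw; apply: contrapT => Zw; apply: Aw; apply: hA => /= /(_ I) [].
  by move/eqP; rewrite sqrf_eq0 => /eqP.
rewrite (@ae_eq_integral _ _ _ P setT (cst 0%E))//; first by rewrite integral0.
exists (~` (Z @^-1` [set 0])); split; first exact: measurableC.
  by have := probability_setC P mZ0; rewrite h subee.
by move=> w /= hw Zw; apply: hw => _; rewrite Zw expr0n.
Qed.

Lemma centered_gaussian_sqr_eq0 Z (s : R) : measurable_fun setT Z ->
  (forall B, measurable B ->
    P (Z @^-1` B) = if s == 0 then \d_(0 : R) B else normal_prob 0 s B) ->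
  (\int[P]_w (Z w ^+ 2)%:E = 0)%E <-> s = 0.
Proof.
move=> mZ hs; rewrite (integral_sqr_eq0 mZ) hs//; case: eqVneq => [->|s0].
  by rewrite diracE mem_set.
split=> [|s00]; last by rewrite s00 eqxx in s0.
by rewrite /normal_prob integral_set1 => /eqP; rewrite eq_sym onee_eq0.
Qed.

(** The Gaussian second moment is never computed. Rescaling [X] by [c = |sY| / |sX|] gives it the
    law of [Y]; comparing second moments, [c^2 r = r] with [r] finite and nonzero, so [c = 1]. *)
Lemma centered_gaussian_unique X Y :
  centered_gaussian P X -> centered_gaussian P Y ->
  (\int[P]_w (X w ^+ 2)%:E = \int[P]_w (Y w ^+ 2)%:E)%E ->
  (\int[P]_w (X w ^+ 2)%:E < +oo)%E ->
  forall B, measurable B -> P (X @^-1` B) = P (Y @^-1` B).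
Proof.
move=> [mX [sX hX]] [mY [sY hY]] XY Xfin B mB.
have [sX0 _] := centered_gaussian_sqr_eq0 mX hX.
have [_ hX0] := centered_gaussian_sqr_eq0 mX hX.
have [sY0 hY0] := centered_gaussian_sqr_eq0 mY hY.
have [x0|x0] := eqVneq sX 0.
  by rewrite hX// hY// x0 eqxx sY0 ?eqxx// -XY hX0.
have [y0|y0] := eqVneq sY 0.
  by have := sX0; rewrite XY hY0// => /(_ erefl) /eqP; rewrite (negbTE x0).
pose c := `|sY| / `|sX|.
have c0 : 0 < c by rewrite divr_gt0 ?normr_gt0.
have cE : c ^+ 2 * sX ^+ 2 = sY ^+ 2.
  rewrite /c expr_div_n -!normrX !ger0_norm ?sqr_ge0// divfK//.
  by rewrite sqrf_eq0.
have mcX : measurable_fun setT (fun w => c * X w) by exact: measurable_funM.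
have law : forall B, measurable B -> P ((fun w => c * X w) @^-1` B) = P (Y @^-1` B).
  apply: eq_cdf_law => // a.
  have <- : c * (a / c) = a by rewrite mulrC divfK// gt_eqF.
  have -> : [set w | c * X w <= c * (a / c)] = X @^-1` `]-oo, a / c].
    by apply/seteqP; split=> w /=; rewrite in_itv/= ler_pM2l.
  have -> : [set w | Y w <= c * (a / c)] = Y @^-1` `]-oo, c * (a / c)].
    by apply/seteqP; split=> w /=; rewrite in_itv.
  by rewrite hX// hY// (negbTE x0) (negbTE y0) (normal_prob_scale _ c0 x0 y0).
suff c1 : c = 1.
  by rewrite -law//; congr (P _); apply/seteqP; split=> w /=; rewrite c1 mul1r.
have := @eq_law_ge0_integral _ _ _ P _ _ (fun x => (x ^+ 2)%:E) mcX mY law.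
have m2 : measurable_fun setT (fun x : R => (x ^+ 2)%:E).
  by apply/measurable_EFinP; exact: measurable_funX.
move=> /(_ m2 (fun x => sqr_ge0 x)); rewrite -XY.
under eq_integral do rewrite exprMn EFinM.
rewrite ge0_integralZl//; last 3 first.
- exact: (measurableT_comp m2).
- by move=> w _; rewrite lee_fin sqr_ge0.
- by rewrite lee_fin sqr_ge0.
have : (0 <= \int[P]_w (X w ^+ 2)%:E)%E.
  by apply: integral_ge0 => w _; rewrite lee_fin sqr_ge0.
have : (\int[P]_w (X w ^+ 2)%:E)%E != 0%E.
  by apply/eqP => /sX0/eqP; rewrite (negbTE x0).
move: Xfin; case: (integral _ _ _) => [r| |]//= _.
rewrite eqe lee_fin -EFinM => r0 _ [] /eqP.
rewrite -subr_eq0 -{2}[r]mul1r -mulrBl mulf_eq0 (negbTE r0) orbF subr_eq0.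
by rewrite sqrf_eq1 => /orP[/eqP//|/eqP c1]; move: c0; rewrite c1 oppr_gt0 ltr10.
Qed.

End GaussianLaw.

(** * Complex matrices through real coordinates *)

Section ReIm.
Context {R : realType}.
Implicit Types x y : R[i].

Lemma cReD x y : complex.Re (x + y) = complex.Re x + complex.Re y.
Proof. by case: x; case: y. Qed.
Lemma cImD x y : complex.Im (x + y) = complex.Im x + complex.Im y.
Proof. by case: x; case: y. Qed.
Lemma cReN x : complex.Re (- x) = - complex.Re x.
Proof. by case: x. Qed.
Lemma cImN x : complex.Im (- x) = - complex.Im x.
Proof. by case: x. Qed.
Lemma cReM x y : complex.Re (x * y) =
  complex.Re x * complex.Re y - complex.Im x * complex.Im y.
Proof. by case: x; case: y. Qed.
Lemma cImM x y : complex.Im (x * y) =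
  complex.Re x * complex.Im y + complex.Im x * complex.Re y.
Proof. by case: x => a b; case: y => c e /=; rewrite addrC. Qed.
Lemma cRe_sum (I : Type) (s : seq I) (Q : pred I) (F : I -> R[i]) :
  complex.Re (\sum_(i <- s | Q i) F i) = \sum_(i <- s | Q i) complex.Re (F i).
Proof. exact: (big_morph (@complex.Re R) cReD (erefl : complex.Re (0 : R[i]) = 0)). Qed.
Lemma cIm_sum (I : Type) (s : seq I) (Q : pred I) (F : I -> R[i]) :
  complex.Im (\sum_(i <- s | Q i) F i) = \sum_(i <- s | Q i) complex.Im (F i).
Proof. exact: (big_morph (@complex.Im R) cImD (erefl : complex.Im (0 : R[i]) = 0)). Qed.
Lemma cRe_conj x : complex.Re (Num.conj x) = complex.Re x.
Proof. by case: x. Qed.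
Lemma cIm_conj x : complex.Im (Num.conj x) = - complex.Im x.
Proof. by case: x. Qed.
Lemma complex_ext x y :
  complex.Re x = complex.Re y -> complex.Im x = complex.Im y -> x = y.
Proof. by case: x => a b; case: y => c e /= -> ->. Qed.

End ReIm.

Section MxCoord.
Context {R : realType}.

Lemma mx_coord_ext m n (A B : 'M[R[i]]_(m, n)) :
  (forall k, mx_coord k A = mx_coord k B) -> A = B.
Proof.
move=> h; apply/matrixP => i j; apply: complex_ext.
  exact: (h (i, j, false)).
exact: (h (i, j, true)).
Qed.

Lemma mx_coordD m n k (A B : 'M[R[i]]_(m, n)) :
  mx_coord k (A + B) = mx_coord k A + mx_coord k B.
Proof. by rewrite /mx_coord mxE; case: k.2; rewrite ?cReD ?cImD. Qed.

Lemma mx_coordN m n k (A : 'M[R[i]]_(m, n)) : mx_coord k (- A) = - mx_coord k A.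
Proof. by rewrite /mx_coord mxE; case: k.2; rewrite ?cReN ?cImN. Qed.

Lemma mx_coordB m n k (A B : 'M[R[i]]_(m, n)) :
  mx_coord k (A - B) = mx_coord k A - mx_coord k B.
Proof. by rewrite mx_coordD mx_coordN. Qed.

Lemma mx_coord0 m n k : mx_coord k (0 : 'M[R[i]]_(m, n)) = 0.
Proof. by rewrite /mx_coord mxE; case: k.2. Qed.

Lemma mx_coord_sum m n k (I : Type) (s : seq I) (Q : pred I)
    (F : I -> 'M[R[i]]_(m, n)) :
  mx_coord k (\sum_(i <- s | Q i) F i) = \sum_(i <- s | Q i) mx_coord k (F i).
Proof. exact: (big_morph (mx_coord k) (mx_coordD k) (mx_coord0 k)). Qed.

Lemma mx_coordZ m n k (r : R) (A : 'M[R[i]]_(m, n)) :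
  mx_coord k (r%:C%C *: A) = r * mx_coord k A.
Proof.
rewrite /mx_coord mxE; case: k.2; rewrite ?cReM ?cImM /=; first by rewrite mul0r addr0.
by rewrite mul0r subr0.
Qed.

Lemma mx_coord_mul m n p (k : 'I_m * 'I_p * bool) (A : 'M[R[i]]_(m, n))
    (B : 'M[R[i]]_(n, p)) :
  mx_coord k (A *m B) = \sum_c
    (mx_coord (k.1.1, c, false) A * mx_coord (c, k.1.2, k.2) B +
     (if k.2 then 1 else -1) * (mx_coord (k.1.1, c, true) A * mx_coord (c, k.1.2, ~~ k.2) B)).
Proof.
case: k => [[i j] []]; rewrite /mx_coord mxE /= ?cRe_sum ?cIm_sum;
  apply: eq_bigr => c _; rewrite ?cReM ?cImM.
  by rewrite mul1r.
by rewrite mulN1r.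
Qed.

Lemma mx_coordiZ m n (k : 'I_m * 'I_n * bool) (A : 'M[R[i]]_(m, n)) :
  mx_coord k ('i%C *: A) = (if k.2 then 1 else -1) * mx_coord (k.1, ~~ k.2) A.
Proof.
case: k => [[i j] []]; rewrite /mx_coord mxE /= ?cReM ?cImM /=.
  by rewrite mul0r !mul1r add0r.
by rewrite mul0r mul1r mulN1r sub0r.
Qed.

Lemma sqnormE m n (A : 'M[R[i]]_(m, n)) : sqnorm A = \sum_k mx_coord k A ^+ 2.
Proof.
rewrite /sqnorm pair_bigA /=.
rewrite (eq_bigr (fun k : 'I_m * 'I_n * bool =>
  (fun p b => mx_coord (p, b) A ^+ 2) k.1 k.2)); last by case.
rewrite -(pair_bigA _ (fun p b => mx_coord (p, b) A ^+ 2)) /=.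
by apply: eq_bigr => -[i j] _; rewrite big_bool /= addrC.
Qed.

Lemma sqnorm_ge0 m n (A : 'M[R[i]]_(m, n)) : 0 <= sqnorm A.
Proof. by rewrite sqnormE; apply: sumr_ge0 => k _; rewrite sqr_ge0. Qed.

Lemma sqnorm0 m n : sqnorm (0 : 'M[R[i]]_(m, n)) = 0.
Proof. by rewrite sqnormE big1// => k _; rewrite mx_coord0 expr0n. Qed.

Lemma mx_coord_sqr_le m n k (A : 'M[R[i]]_(m, n)) : mx_coord k A ^+ 2 <= sqnorm A.
Proof.
rewrite sqnormE (bigD1 k)//= lerDl; apply: sumr_ge0 => i _; exact: sqr_ge0.
Qed.

Lemma sqnorm_add_le m n (A B : 'M[R[i]]_(m, n)) :
  sqnorm (A + B) <= 2 * sqnorm A + 2 * sqnorm B.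
Proof.
rewrite !sqnormE !mulr_sumr -big_split; apply: ler_sum => k _ /=.
by rewrite mx_coordD; have := sqr_ge0 (mx_coord k A - mx_coord k B); lra.
Qed.

Lemma sqnormN m n (A : 'M[R[i]]_(m, n)) : sqnorm (- A) = sqnorm A.
Proof. by rewrite !sqnormE; apply: eq_bigr => k _; rewrite mx_coordN sqrrN. Qed.

Lemma sqnorm_sub_le m n (A B : 'M[R[i]]_(m, n)) :
  sqnorm (A - B) <= 2 * sqnorm A + 2 * sqnorm B.
Proof. by rewrite -[sqnorm B]sqnormN; exact: sqnorm_add_le. Qed.

Lemma sqnormZ m n (r : R) (A : 'M[R[i]]_(m, n)) :
  sqnorm (r%:C%C *: A) = r ^+ 2 * sqnorm A.
Proof. by rewrite !sqnormE mulr_sumr; apply: eq_bigr => k _; rewrite mx_coordZ exprMn. Qed.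

Lemma sqnormiZ m n (A : 'M[R[i]]_(m, n)) : sqnorm ('i%C *: A) = sqnorm A.
Proof.
rewrite /sqnorm; apply: eq_bigr => i _; apply: eq_bigr => j _.
by rewrite mxE cReM cImM /= !mul0r !mul1r sub0r add0r sqrrN addrC.
Qed.

Lemma sqr_sum_le (n : nat) (x : 'I_n -> R) :
  (\sum_i x i) ^+ 2 <= n%:R * \sum_i x i ^+ 2.
Proof.
have -> : n%:R * \sum_i x i ^+ 2 = \sum_i \sum_j (x i ^+ 2 / 2 + x j ^+ 2 / 2).
  under [RHS]eq_bigr => i _ do rewrite big_split /= sumr_const card_ord.
  rewrite big_split /= sumr_const card_ord sumrMnl -mulrnDl -big_split /=.
  by rewrite mulr_natl; congr (_ *+ _); apply: eq_bigr => i _ /=; field.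
rewrite expr2 mulr_suml; apply: ler_sum => i _.
rewrite mulr_sumr; apply: ler_sum => j _.
by have := sqr_ge0 (x i - x j); lra.
Qed.

(* The crude constant avoids the Cauchy-Schwarz inequality. *)
Definition mul_cst (m n p : nat) : R :=
  \sum_(k : 'I_m * 'I_p * bool) (n%:R * \sum_(c < n) 4).

Lemma mul_cst_ge0 m n p : 0 <= mul_cst m n p.
Proof. by apply: sumr_ge0 => k _; rewrite mulr_ge0// sumr_ge0. Qed.

Lemma sqnorm_mul_le m n p (A : 'M[R[i]]_(m, n)) (B : 'M[R[i]]_(n, p)) :
  sqnorm (A *m B) <= mul_cst m n p * (sqnorm A * sqnorm B).
Proof.
rewrite (sqnormE (_ *m _)) mulr_suml; apply: ler_sum => k _; rewrite mx_coord_mul.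
apply: le_trans (sqr_sum_le _) _.
rewrite -mulrA ler_wpM2l// mulr_suml; apply: ler_sum => c _.
set a := mx_coord _ A; set b := mx_coord _ B.
set a' := mx_coord _ A; set b' := mx_coord _ B.
have ab : (a * b) ^+ 2 <= sqnorm A * sqnorm B.
  by rewrite exprMn ler_pM ?sqr_ge0// mx_coord_sqr_le.
have ab' : (a' * b') ^+ 2 <= sqnorm A * sqnorm B.
  by rewrite exprMn ler_pM ?sqr_ge0// mx_coord_sqr_le.
have : (if k.2 then 1 else -1) = 1 :> R \/ (if k.2 then 1 else -1) = -1 :> R.
  by case: k.2; [left|right].
move=> [->|->]; rewrite ?mul1r ?mulN1r.
  by have := sqr_ge0 (a * b - a' * b'); lra.
by have := sqr_ge0 (a * b + a' * b'); lra.
Qed.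

End MxCoord.

Section MxMeasurable.
Context {R : realType} {d : measure_display} {T : measurableType d}.

Definition mx_mfun {m n} (X : T -> 'M[R[i]]_(m, n)) : Prop :=
  forall k, measurable_fun setT (fun w => mx_coord k (X w)).

Lemma random_mxP m n (X : T -> 'M[R[i]]_(m, n)) : random_mx X <-> mx_mfun X.
Proof.
split=> [h k _ B mB|h B hB].
  rewrite setTI; exact: (h _ (@sigma_generated_preimage _ _ _ setT mx_coord k B I mB)).
by apply: preimage_sigma_generated hB => k _; exact: h.
Qed.

Lemma mx_mfun_cst m n (A : 'M[R[i]]_(m, n)) : mx_mfun (cst A).
Proof. by move=> k; exact: (measurable_cst (mx_coord k A)). Qed.

Lemma mx_mfunD m n (X Y : T -> 'M[R[i]]_(m, n)) :
  mx_mfun X -> mx_mfun Y -> mx_mfun (fun w => X w + Y w).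
Proof.
move=> mX mY k; under eq_fun do rewrite mx_coordD.
exact: measurable_funD.
Qed.

Lemma mx_mfunN m n (X : T -> 'M[R[i]]_(m, n)) :
  mx_mfun X -> mx_mfun (fun w => - X w).
Proof.
move=> mX k; under eq_fun do rewrite mx_coordN.
exact: measurableT_comp.
Qed.

Lemma mx_mfunB m n (X Y : T -> 'M[R[i]]_(m, n)) :
  mx_mfun X -> mx_mfun Y -> mx_mfun (fun w => X w - Y w).
Proof. by move=> mX mY; apply: mx_mfunD => //; exact: mx_mfunN. Qed.

Lemma mx_mfun_sum m n (I : Type) (s : seq I) (F : I -> T -> 'M[R[i]]_(m, n)) :
  (forall i, mx_mfun (F i)) -> mx_mfun (fun w => \sum_(i <- s) F i w).
Proof.
move=> mF k; under eq_fun do rewrite mx_coord_sum.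
by apply: measurable_sum => i; exact: mF.
Qed.

Lemma mx_mfun_sum_nat m n p (f : nat -> T -> 'M[R[i]]_(m, n)) :
  (forall j, (j < p)%N -> mx_mfun (f j)) ->
  mx_mfun (fun w => \sum_(0 <= j < p) f j w).
Proof.
move=> mf; rewrite (_ : (fun w => _) = fun w => \sum_(j < p) f j w).
  by apply: mx_mfun_sum => j; exact: mf.
by apply/funext => w; rewrite big_mkord.
Qed.

Lemma mx_mfunM m n p (X : T -> 'M[R[i]]_(m, n)) (Y : T -> 'M[R[i]]_(n, p)) :
  mx_mfun X -> mx_mfun Y -> mx_mfun (fun w => X w *m Y w).
Proof.
move=> mX mY k; under eq_fun do rewrite mx_coord_mul.
apply: measurable_sum => i; apply: measurable_funD; first exact: measurable_funM.
by apply: measurable_funM => //; exact: measurable_funM.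
Qed.

Lemma mx_mfuniZ m n (X : T -> 'M[R[i]]_(m, n)) :
  mx_mfun X -> mx_mfun (fun w => 'i%C *: X w).
Proof.
move=> mX k; under eq_fun do rewrite mx_coordiZ.
by apply: measurable_funM => //; exact: mX.
Qed.

Lemma mx_mfunZ m n (r : T -> R) (X : T -> 'M[R[i]]_(m, n)) :
  measurable_fun setT r -> mx_mfun X -> mx_mfun (fun w => (r w)%:C%C *: X w).
Proof.
move=> mr mX k; under eq_fun do rewrite mx_coordZ.
by apply: measurable_funM => //; exact: mX.
Qed.

Lemma mx_mfun_sqnorm m n (X : T -> 'M[R[i]]_(m, n)) :
  mx_mfun X -> measurable_fun setT (fun w => sqnorm (X w)).
Proof.
move=> mX; under eq_fun do rewrite sqnormE.
by apply: measurable_sum => k; exact: measurable_funX.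
Qed.

End MxMeasurable.

(** * Square-integrable variables and products of independent variables *)

Section SquareIntegrable.
Context {R : realType} {d : measure_display} {T : measurableType d}.
Variable P : probability T R.
Implicit Types f g : T -> R.

Definition rintegrable f := P.-integrable setT (EFin \o f).

Definition sqint f := measurable_fun setT f /\ rintegrable (fun w => f w ^+ 2).

Lemma rintegrable_mfun f : rintegrable f -> measurable_fun setT f.
Proof. by move=> /measurable_int /measurable_EFinP. Qed.

Lemma le_rintegrable f g : measurable_fun setT f -> rintegrable g ->
  (forall w, `|f w| <= g w) -> rintegrable f.
Proof.
move=> mf ig fg; apply: le_integrable ig => //; first exact/measurable_EFinP.
by move=> w _ /=; rewrite lee_fin (le_trans (fg w))// ler_norm.
Qed.

Lemma rintegrable_cst (r : R) : rintegrable (cst r).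
Proof. exact: finite_measure_integrable_cst. Qed.

Lemma rintegrableD f g : rintegrable f -> rintegrable g ->
  rintegrable (fun w => f w + g w).
Proof. exact: integrableD. Qed.

Lemma rintegrableZ r f : rintegrable f -> rintegrable (fun w => r * f w).
Proof. exact: integrableZl. Qed.

Lemma rintegrableN f : rintegrable f -> rintegrable (fun w => - f w).
Proof.
move=> /(rintegrableZ (-1)); congr rintegrable.
by apply/funext => w; rewrite mulN1r.
Qed.

Lemma rintegrable_sum (I : Type) (s : seq I) (F : I -> T -> R) :
  (forall i, rintegrable (F i)) -> rintegrable (fun w => \sum_(i <- s) F i w).
Proof.
move=> iF; elim: s => [|i s ih].
  by under eq_fun do rewrite big_nil; exact: rintegrable_cst.
by under eq_fun do rewrite big_cons; exact: rintegrableD.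
Qed.

Lemma Rintegral_sum (I : Type) (s : seq I) (F : I -> T -> R) :
  (forall i, rintegrable (F i)) ->
  \int[P]_w (\sum_(i <- s) F i w) = \sum_(i <- s) \int[P]_w F i w.
Proof.
move=> iF; elim: s => [|i s ih].
  by under eq_Rintegral do rewrite big_nil; rewrite big_nil Rintegral_cst// mul0r.
under eq_Rintegral do rewrite big_cons.
by rewrite big_cons RintegralD ?ih//; [exact: iF|exact: (rintegrable_sum s iF)].
Qed.

Lemma sqint_mul f g : sqint f -> sqint g -> rintegrable (fun w => f w * g w).
Proof.
move=> [mf if2] [mg ig2].
apply: (le_rintegrable _ (rintegrableD if2 ig2)); first exact: measurable_funM.
move=> w; rewrite normrM -(real_normK (num_real (f w))) -(real_normK (num_real (g w))).
have := sqr_ge0 (`|f w| - `|g w|); have := sqr_ge0 (`|f w| + `|g w|); nra.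
Qed.

Lemma sqint_bounded f M : measurable_fun setT f -> (forall w, `|f w| <= M) -> sqint f.
Proof.
move=> mf fM; split=> //; apply: (le_rintegrable _ (rintegrable_cst (M ^+ 2))).
  exact: measurable_funX.
by move=> w /=; rewrite normrX lerXn2r ?nnegrE// (le_trans _ (fM w)).
Qed.

Lemma sqint_cst r : sqint (cst r).
Proof. by apply: (@sqint_bounded _ `|r|) => // w. Qed.

Lemma sqint_rintegrable f : sqint f -> rintegrable f.
Proof.
by move=> /sqint_mul /(_ (sqint_cst 1)); under eq_fun do rewrite mulr1.
Qed.

Lemma sqintD f g : sqint f -> sqint g -> sqint (fun w => f w + g w).
Proof.
move=> sf sg; have [mf if2] := sf; have [mg ig2] := sg.
split; first exact: measurable_funD.
have := rintegrableD (rintegrableD if2 (rintegrableZ 2 (sqint_mul sf sg))) ig2.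
by congr rintegrable; apply/funext => w; ring.
Qed.

Lemma sqintZ r f : sqint f -> sqint (fun w => r * f w).
Proof.
move=> [mf if2]; split; first exact: measurable_funM.
have := rintegrableZ (r ^+ 2) if2.
by congr rintegrable; apply/funext => w; rewrite exprMn.
Qed.

Lemma sqintN f : sqint f -> sqint (fun w => - f w).
Proof.
move=> /(sqintZ (-1)); congr sqint.
by apply/funext => w; rewrite mulN1r.
Qed.

Lemma sqint_sum (I : Type) (s : seq I) (F : I -> T -> R) :
  (forall i, sqint (F i)) -> sqint (fun w => \sum_(i <- s) F i w).
Proof.
move=> iF; elim: s => [|i s ih].
  by under eq_fun do rewrite big_nil; exact: sqint_cst.
by under eq_fun do rewrite big_cons; exact: sqintD.
Qed.

Lemma sqint_lty f : measurable_fun setT f ->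
  (\int[P]_w (f w ^+ 2)%:E < +oo)%E -> sqint f.
Proof.
move=> mf h; split=> //; apply/integrableP; split.
  exact/measurable_EFinP/measurable_funX.
rewrite (eq_integral (fun w => (f w ^+ 2)%:E))// => w _ /=.
by rewrite ger0_norm ?sqr_ge0.
Qed.

Lemma EFin_Rintegral f : rintegrable f ->
  (\int[P]_w (f w)%:E)%E = (\int[P]_w f w)%:E.
Proof. by move=> hf; rewrite /Rintegral fineK//; exact: integrable_fin_num. Qed.

Lemma markov_rintegrable f (e : R) : rintegrable f -> (forall w, 0 <= f w) ->
  0 < e -> (P [set w | (e <= f w)%R] <= (e^-1 * \int[P]_w f w)%:E)%E.
Proof.
move=> hf f0 e0; have mf := rintegrable_mfun hf.
set A := [set w | _].
have mA : measurable A.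
  have -> : A = f @^-1` `[e, +oo[.
    by apply/seteqP; split=> w; rewrite /A /= in_itv /= andbT.
  by rewrite -[_ @^-1` _]setTI; exact: mf.
rewrite EFinM -lee_pdivrMl ?invr_gt0// invrK -EFin_Rintegral//.
rewrite -[A]setIT -integral_indic// -ge0_integralZl//; last 2 first.
- exact/measurable_EFinP/measurable_indic.
- by rewrite lee_fin ltW.
apply: ge0_le_integral => //.
- by move=> w _; rewrite -EFinM lee_fin mulr_ge0// ltW.
- by apply/measurable_EFinP; apply: measurable_funM => //; exact: measurable_indic.
- exact/measurable_EFinP.
move=> w _; rewrite -EFinM lee_fin indicE.
by have [/set_mem|_] := boolP (w \in A); rewrite ?mulr1 ?mulr0.
Qed.

Definition independent f g := forall A B, measurable A -> measurable B ->
  P (f @^-1` A `&` g @^-1` B) = (P (f @^-1` A) * P (g @^-1` B))%E.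

Section IndependentProduct.
Variables f g : T -> R.
Hypotheses (mf : measurable_fun setT f) (mg : measurable_fun setT g).
Hypothesis fg : independent f g.

Let Pf := distribution P (mfun_Sub (mem_set mf)).
Let Pg := distribution P (mfun_Sub (mem_set mg)).
Let mfg := measurable_fun_pair mf mg.
Let Pfg := distribution P (mfun_Sub (mem_set mfg)).

(** Independence says that the joint law is the product of the marginals, by uniqueness of the
    product measure on rectangles. Tonelli for the absolute value of the product, then Fubini, give
    the two lemmas that close the section. *)
Let prodE X : measurable X -> (Pf \x Pg)%E X = Pfg X.
Proof.
apply: product_measure_unique => A B mA mB.
by rewrite /Pfg /distribution /pushforward /=; exact: fg.
Qed.

Let mmul : measurable_fun setT (fun z : R * R => (z.1 * z.2)%:E).
Proof. by apply/measurable_EFinP; exact: measurable_funM. Qed.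

Let E := @EFin R.

Let ge0_case (hf : rintegrable f) (hg : rintegrable g) :
  rintegrable (fun w => f w * g w).
Proof.
apply/integrableP; split.
  exact/measurable_EFinP/measurable_funM.
have mabs : measurable_fun setT (fun z : R * R => `|(z.1 * z.2)%:E|)%E.
  exact: measurableT_comp.
have := @ge0_integral_distribution _ _ T _ R P (mfun_Sub (mem_set mfg)) _ mabs (fun z => abse_ge0 _).
rewrite /= => <-.
rewrite -(eq_measure_integral (m1 := (Pf \x Pg)%E) Pfg); last by move=> A mA _; exact: (prodE mA).
rewrite (fubini_tonelli1 _ mabs)//; rewrite /fubini_F /=.
under eq_integral => x _.
  under eq_integral => y _ do rewrite normrM EFinM.
  rewrite ge0_integralZl//; last first.
    by apply/measurable_EFinP; exact: normr_measurable.
  over.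
have Eg : (\int[Pg]_y `|y|%:E < +oo)%E.
  have := @ge0_integral_distribution _ _ T _ R P (mfun_Sub (mem_set mg)) (fun y => `|y|%:E).
  by move=> -> //=; [case/integrableP: hg|apply/measurable_EFinP; exact: normr_measurable].
have Ef : (\int[Pf]_y `|y|%:E < +oo)%E.
  have := @ge0_integral_distribution _ _ T _ R P (mfun_Sub (mem_set mf)) (fun y => `|y|%:E).
  by move=> -> //=; [case/integrableP: hf|apply/measurable_EFinP; exact: normr_measurable].
have Eg0 : (0 <= \int[Pg]_y `|y|%:E)%E by apply: integral_ge0.
rewrite ge0_integralZr//; last by apply/measurable_EFinP; exact: normr_measurable.
by rewrite lte_mul_pinfty// ?integral_ge0// ge0_fin_numE// integral_ge0.
Qed.

Lemma independent_rintegrable : rintegrable f -> rintegrable g ->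
  rintegrable (fun w => f w * g w).
Proof. exact: ge0_case. Qed.

Lemma independent_Rintegral : rintegrable f -> rintegrable g ->
  \int[P]_w (f w * g w) = \int[P]_w f w * \int[P]_w g w.
Proof.
move=> hf hg; have hfg := ge0_case hf hg.
apply: EFin_inj; rewrite EFinM -!EFin_Rintegral//.
have := @integral_distribution _ _ T _ R P (mfun_Sub (mem_set mfg)) _ mmul hfg.
rewrite /= => <-.
rewrite -(eq_measure_integral (m1 := (Pf \x Pg)%E) Pfg); last by move=> A mA _; exact: (prodE mA).
have idm : measurable_fun setT (EFin \o @id R) by exact/measurable_EFinP.
have Eg := @integral_distribution _ _ T _ R P (mfun_Sub (mem_set mg)) _ idm hg.
have Ef := @integral_distribution _ _ T _ R P (mfun_Sub (mem_set mf)) _ idm hf.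
have idint (Z : {RV P >-> R}) : rintegrable Z -> (distribution P Z).-integrable setT (EFin \o id).
  by move=> hZ; apply: integrable_pushforward.
rewrite -integral12_prod_meas1; last first.
  apply/integrableP; split; first exact: mmul.
  rewrite (eq_measure_integral (m1 := (Pf \x Pg)%E) Pfg); last by move=> A mA _; exact: (prodE mA).
  rewrite ge0_integral_distribution//; first by case/integrableP: hfg.
  exact: measurableT_comp.
rewrite /fubini_F /=; under eq_integral => x _.
  under eq_integral => y _ do rewrite EFinM.
  rewrite integralZl//; last exact: (idint (mfun_Sub (mem_set mg))).
  over.
rewrite /= in Eg Ef.
have -> : (\int[P]_w (g w)%:E = (\int[P]_w g w)%:E)%E by exact: EFin_Rintegral.
have -> : (\int[Pg]_y y%:E = (\int[P]_w g w)%:E)%E by rewrite -EFin_Rintegral.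
rewrite integralZr//; last exact: (idint (mfun_Sub (mem_set mf))).
by rewrite Ef.
Qed.

End IndependentProduct.

End SquareIntegrable.

(** * Hermitian Brownian motion *)

Section HermitianCoordinates.
Context {R : realType} {N : nat}.
Implicit Types (A B V X : 'M[R[i]]_N) (k : 'I_N * 'I_N * bool).
Local Notation adj A := (A ^t* )%sesqui.

Lemma hermsymP A : reflect (A = adj A) (A \is hermsymmx).
Proof. by rewrite is_hermitianmxE expr0 scale1r; exact: eqP. Qed.

Lemma adj_mul A B : adj (A *m B) = adj B *m adj A.
Proof. by rewrite trmx_mul map_mxM. Qed.

Lemma hermsym_conj V A : A \is hermsymmx -> V *m A *m adj V \is hermsymmx.
Proof.
by move=> /hermsymP hA; apply/hermsymP; rewrite !adj_mul trmxCK -hA mulmxA.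
Qed.

Lemma hermsymZ (r : R) A : A \is hermsymmx -> r%:C%C *: A \is hermsymmx.
Proof.
move=> /hermsymP hA; apply/hermsymP/matrixP => i j.
rewrite !mxE rmorphM /= {1}hA !mxE; congr (_ * _).
by apply: complex_ext => /=; rewrite ?oppr0.
Qed.

Lemma hermsymN A : A \is hermsymmx -> - A \is hermsymmx.
Proof. by move=> /hermsymP hA; apply/hermsymP; rewrite {1}hA raddfN/= map_mxN. Qed.

Lemma herm_innerZl (r : R) A X : herm_inner (r%:C%C *: A) X = r * herm_inner A X.
Proof.
by rewrite /herm_inner -scalemxAl mxtraceZ cReM /= mul0r subr0 mulrCA.
Qed.

Lemma herm_innerNl A X : herm_inner (- A) X = - herm_inner A X.
Proof. by rewrite /herm_inner mulNmx raddfN cReN mulrN. Qed.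

Lemma herm_inner_conj V A X :
  herm_inner A (V *m X *m adj V) = herm_inner (adj V *m A *m V) X.
Proof.
rewrite /herm_inner; congr (_ * complex.Re _).
by rewrite mulmxA mxtrace_mulC !mulmxA.
Qed.

(** The Hermitian matrix which represents the coordinate [k] for [herm_inner]. With [c = 1] or
    [c = - i], the trace against a Hermitian [X] is twice the real part of [c X_ij], that is twice
    the real or the imaginary part of the entry; the scalar removes this 2 and the [N] of the inner
    product. *)
Definition coord_mx k : 'M[R[i]]_N :=
  let c : R[i] := if k.2 then - 'i%C else 1 in
  let D : 'M[R[i]]_N := delta_mx k.1.2 k.1.1 in
  ((N%:R * 2)^-1)%:C%C *: (c *: D + Num.conj c *: D^T).

Lemma coord_mx_hermsym k : coord_mx k \is hermsymmx.
Proof.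
apply/hermsymP/matrixP => a b; rewrite /coord_mx; set c := if _ then _ else _.
rewrite !mxE rmorphM rmorphD !rmorphM /= conjCK !rmorph_nat.
by rewrite [X in _ * X]addrC; congr (_ * _); apply: complex_ext => /=; rewrite ?oppr0.
Qed.

Lemma mxtrace_delta_mul (i j : 'I_N) X : \tr (delta_mx j i *m X) = X i j.
Proof.
rewrite /mxtrace (bigD1 j)//= mxE (bigD1 i)//= mxE !eqxx mul1r.
rewrite big1 ?addr0; last by move=> b /negbTE bi; rewrite mxE bi andbF mul0r.
rewrite big1 ?addr0// => a /negbTE aj; rewrite mxE big1// => b _.
by rewrite mxE aj mul0r.
Qed.

Lemma herm_inner_coord k X : X \is hermsymmx -> herm_inner (coord_mx k) X = mx_coord k X.
Proof.
case: k => [[i j] b] /hermsymP hX; rewrite /coord_mx herm_innerZl /herm_inner /=.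
rewrite trmx_delta mulmxDl mxtraceD -!scalemxAl !mxtraceZ !mxtrace_delta_mul.
have Xij : X j i = Num.conj (X i j) by rewrite {1}hX !mxE.
have N0 : N%:R != 0 :> R by rewrite pnatr_eq0 -lt0n (leq_trans _ (ltn_ord i)).
rewrite Xij /mx_coord /= cReD !cReM !cRe_conj !cIm_conj; case: b => /=.
  by field.
by field.
Qed.

End HermitianCoordinates.

Section HermitianBM.
Context {R : realType} {N : nat} {d : measure_display} {T : measurableType d}.
Variables (P : probability T R) (H : R -> T -> 'M[R[i]]_N).
Hypothesis hbm : hermitian_brownian_motion P H.
Implicit Types A B : 'M[R[i]]_N.
Local Notation adj A := (A ^t* )%sesqui.

Lemma hbm_mfun (A : 'M[R[i]]_N) t : A \is hermsymmx -> 0 <= t ->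
  measurable_fun setT (fun w => herm_inner A (H t w)).
Proof.
move=> hA t0; have [] := @hbm_gaussian _ _ _ _ _ _ hbm 1 (fun=> t) (fun=> A) => //.
by under eq_fun do rewrite big_ord1.
Qed.

(** The covariance identity with [A = B] equates an extended real second moment with a real number,
    which makes it finite. *)
Lemma hbm_sqint A t : A \is hermsymmx -> 0 <= t ->
  sqint P (fun w => herm_inner A (H t w)).
Proof.
move=> hA t0; apply: sqint_lty; first exact: hbm_mfun.
have := hbm_covariance hbm hA hA t0 t0; rewrite expectation.unlock => h.
under eq_integral do rewrite expr2.
by rewrite h ltry.
Qed.

Lemma hbm_cov A B s t : A \is hermsymmx -> B \is hermsymmx -> 0 <= s -> 0 <= t ->
  \int[P]_w (herm_inner A (H s w) * herm_inner B (H t w)) =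
  Num.min s t * herm_inner A B.
Proof.
move=> hA hB s0 t0; apply: EFin_inj.
rewrite -EFin_Rintegral; last by apply: sqint_mul; exact: hbm_sqint.
by have := hbm_covariance hbm hA hB s0 t0; rewrite expectation.unlock.
Qed.

Lemma hbm_lin_sqint n (t : 'I_n -> R) (A : 'I_n -> 'M[R[i]]_N) :
  (forall i, 0 <= t i) -> (forall i, A i \is hermsymmx) ->
  sqint P (fun w => \sum_i herm_inner (A i) (H (t i) w)).
Proof. by move=> t0 hA; apply: sqint_sum => i; exact: hbm_sqint. Qed.

Lemma hbm_lin_sqr n (t : 'I_n -> R) (A : 'I_n -> 'M[R[i]]_N) :
  (forall i, 0 <= t i) -> (forall i, A i \is hermsymmx) ->
  \int[P]_w ((\sum_i herm_inner (A i) (H (t i) w)) ^+ 2) =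
  \sum_i \sum_j Num.min (t i) (t j) * herm_inner (A i) (A j).
Proof.
move=> t0 hA.
have ij i j : rintegrable P
    (fun w => herm_inner (A i) (H (t i) w) * herm_inner (A j) (H (t j) w)).
  by apply: sqint_mul; exact: hbm_sqint.
under eq_Rintegral do rewrite expr2 mulr_suml.
rewrite Rintegral_sum; last first.
  by move=> i; under eq_fun do rewrite mulr_sumr; exact: rintegrable_sum.
apply: eq_bigr => i _; under eq_Rintegral do rewrite mulr_sumr.
by rewrite Rintegral_sum//; apply: eq_bigr => j _; exact: hbm_cov.
Qed.

(** The mean is obtained by symmetry: [Z] and [- Z] are both centered Gaussian with the same second
    moment, hence equal in law, so the mean equals its opposite. *)
Lemma hbm_lin_mean0 n (t : 'I_n -> R) (A : 'I_n -> 'M[R[i]]_N) :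
  (forall i, 0 <= t i) -> (forall i, A i \is hermsymmx) ->
  \int[P]_w (\sum_i herm_inner (A i) (H (t i) w)) = 0.
Proof.
move=> t0 hA; set Z := fun w => _.
have hNA i : - A i \is hermsymmx.
  exact: hermsymN.
have sZ : sqint P Z := hbm_lin_sqint t0 hA.
have gN := hbm_gaussian hbm t0 hNA.
have NZ : (fun w => \sum_i herm_inner (- A i) (H (t i) w)) = fun w => - Z w.
  by apply/funext => w; rewrite /Z -sumrN; apply: eq_bigr => i _; rewrite herm_innerNl.
rewrite NZ in gN.
have law := centered_gaussian_unique (hbm_gaussian hbm t0 hA) gN.
have ZZ : forall S, measurable S -> P (Z @^-1` S) = P ((fun w => - Z w) @^-1` S).
  apply: law; first by under [RHS]eq_integral do rewrite sqrrN.
  by rewrite EFin_Rintegral ?ltry//; case: sZ.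
have mZ : measurable_fun setT Z by case: sZ.
have iZ := sqint_rintegrable sZ.
suff : \int[P]_w Z w = - (\int[P]_w Z w) by lra.
have zero : measurable_fun setT (fun x : R => x%:E) by exact/measurable_EFinP.
have mNZ : measurable_fun setT (fun w => - Z w) by exact: measurableT_comp.
have h1 := @integral_distribution _ _ T _ R P (mfun_Sub (mem_set mZ)) _ zero iZ.
have h2 := @integral_distribution _ _ T _ R P (mfun_Sub (mem_set mNZ)) _ zero (rintegrableN iZ).
have -> : - (\int[P]_w Z w) = \int[P]_w (- Z w).
  rewrite -mulN1r -RintegralZl//; apply: eq_Rintegral => w _; exact: mulN1r.
rewrite /Rintegral; congr fine.
rewrite /= in h1 h2; rewrite -h1 -h2; apply: eq_measure_integral => S mS _; exact: ZZ.
Qed.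

Lemma hbm_mx_mfun t : 0 <= t -> mx_mfun (H t).
Proof.
move=> t0 k; under eq_fun => w do rewrite -(herm_inner_coord k (hbm_hermitian hbm w t0)).
exact/hbm_mfun/t0/coord_mx_hermsym.
Qed.

(** Cyclicity of the trace moves the conjugation from [H] to the test matrices. Being unitary, [V]
    preserves their inner products, so a linear combination of coordinates keeps its second moment
    and, being Gaussian, its law. *)
Lemma hbm_conj_law V : V \is unitarymx ->
  same_process_law P H (fun t w => V *m H t w *m adj V).
Proof.
move=> uV.
have mVH t : 0 <= t -> mx_mfun (fun w => V *m H t w *m adj V).
  move=> t0; apply: mx_mfunM; last exact: mx_mfun_cst.
  by apply: mx_mfunM; [exact: mx_mfun_cst|exact: hbm_mx_mfun].
have uV' : V *m adj V = 1%:M by exact/unitarymxP.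
apply: law_determined_by_boxes.
- by move=> k k0; exact: (hbm_mx_mfun k0 k.2).
- by move=> k k0; exact: (mVH _ k0 k.2).
move=> n k a k0.
apply: (@cramer_wold _ _ _ P n (fun w i => mx_coord (k i).2 (H (k i).1 w))
  (fun w i => mx_coord (k i).2 (V *m H (k i).1 w *m adj V))).
- by move=> i; exact: (hbm_mx_mfun (k0 i) (k i).2).
- by move=> i; exact: (mVH _ (k0 i) (k i).2).
move=> theta.
pose A i := (theta i)%:C%C *: coord_mx (k i).2 : 'M[R[i]]_N.
pose A' i := adj V *m A i *m V.
have hA i : A i \is hermsymmx by apply: hermsymZ; exact: coord_mx_hermsym.
have hA' i : A' i \is hermsymmx.
  by rewrite /A' -[X in _ *m X]trmxCK; exact: hermsym_conj.
have e1 w : \sum_i theta i * mx_coord (k i).2 (H (k i).1 w) =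
    \sum_i herm_inner (A i) (H (k i).1 w).
  apply: eq_bigr => i _; rewrite herm_innerZl herm_inner_coord//.
  exact: (hbm_hermitian hbm w (k0 i)).
have e2 w : \sum_i theta i * mx_coord (k i).2 (V *m H (k i).1 w *m adj V) =
    \sum_i herm_inner (A' i) (H (k i).1 w).
  apply: eq_bigr => i _; rewrite -herm_inner_conj herm_innerZl herm_inner_coord//.
  apply: hermsym_conj; exact: (hbm_hermitian hbm w (k0 i)).
rewrite (funext e1) (funext e2); apply: centered_gaussian_unique.
- exact: (hbm_gaussian hbm k0 hA).
- exact: (hbm_gaussian hbm k0 hA').
- rewrite !EFin_Rintegral; [|by case: (hbm_lin_sqint k0 hA')|by case: (hbm_lin_sqint k0 hA)].
  rewrite !hbm_lin_sqr//; congr EFin; apply: eq_bigr => i _; apply: eq_bigr => j _.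
  congr (_ * _); rewrite /A' -herm_inner_conj !mulmxA uV' mul1mx.
  by rewrite -mulmxA uV' mulmx1.
- by rewrite EFin_Rintegral ?ltry//; case: (hbm_lin_sqint k0 hA).
Qed.

End HermitianBM.

(** * Variables known at a given time, and increments independent of the past *)

Section SubSigmaAlgebra.
Context {R : realType} {d : measure_display} {T : measurableType d}.
Implicit Types G : set (set T).

Lemma mx_measurable_wrtP G m n (X : T -> 'M[R[i]]_(m, n)) : sigma_algebra setT G ->
  mx_measurable_wrt G X <-> mx_mfun (X : g_sigma_algebraType G -> 'M[R[i]]_(m, n)).
Proof.
move=> sG; rewrite -random_mxP /random_mx.
by rewrite (measurable_g_measurableTypeE sG).
Qed.

Lemma sub_sigma_mfun G G' (f : T -> R) : G `<=` <<s G' >> ->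
  measurable_fun setT (f : g_sigma_algebraType G -> R) ->
  measurable_fun setT (f : g_sigma_algebraType G' -> R).
Proof.
move=> GG' mf _ B mB; have := mf measurableT B mB; apply: smallest_sub => //.
exact: smallest_sigma_algebra.
Qed.

Lemma sub_measurable_mfun G (f : T -> R) : G `<=` measurable ->
  measurable_fun setT (f : g_sigma_algebraType G -> R) -> measurable_fun setT f.
Proof.
move=> GT mf _ B mB; have := mf measurableT B mB; apply: smallest_sub => //.
exact: sigma_algebra_measurable.
Qed.

End SubSigmaAlgebra.

Section MxSquareIntegrable.
Context {R : realType} {d : measure_display} {T : measurableType d}.
Variable P : probability T R.

Lemma sqintE (f : T -> R) : sqint P f -> rintegrable P (fun w => f w ^+ 2).
Proof. by case. Qed.

Lemma sqintB (f g : T -> R) : sqint P f -> sqint P g -> sqint P (fun w => f w - g w).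
Proof. by move=> sf sg; apply: sqintD => //; exact: sqintN. Qed.

Definition mx_sqint {m n} (X : T -> 'M[R[i]]_(m, n)) :=
  forall k, sqint P (fun w => mx_coord k (X w)).

Lemma mx_sqint_rintegrable m n (X : T -> 'M[R[i]]_(m, n)) :
  mx_sqint X -> rintegrable P (fun w => sqnorm (X w)).
Proof.
move=> sX; under eq_fun do rewrite sqnormE.
by apply: rintegrable_sum => k; exact: sqintE.
Qed.

Lemma mx_sqintD m n (X Y : T -> 'M[R[i]]_(m, n)) :
  mx_sqint X -> mx_sqint Y -> mx_sqint (fun w => X w + Y w).
Proof.
move=> sX sY k; under eq_fun do rewrite mx_coordD.
exact: sqintD.
Qed.

Lemma mx_sqintZ m n (r : R) (X : T -> 'M[R[i]]_(m, n)) :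
  mx_sqint X -> mx_sqint (fun w => r%:C%C *: X w).
Proof.
move=> sX k; under eq_fun do rewrite mx_coordZ.
exact: sqintZ.
Qed.

Lemma mx_sqint_bounded m n (X : T -> 'M[R[i]]_(m, n)) (M : R) :
  mx_mfun X -> (forall w, sqnorm (X w) <= M) -> mx_sqint X.
Proof.
move=> mX hM k; apply: (@sqint_bounded _ _ _ _ _ (1 + M)); first exact: mX.
move=> w; have := le_trans (mx_coord_sqr_le k (X w)) (hM w).
rewrite -(real_normK (num_real (mx_coord k (X w)))).
by have := sqr_ge0 (`|mx_coord k (X w)| - 1); nra.
Qed.

Lemma Rintegral_sqnorm m n (X : T -> 'M[R[i]]_(m, n)) : mx_sqint X ->
  \int[P]_w (sqnorm (X w)) = \sum_k \int[P]_w (mx_coord k (X w) ^+ 2).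
Proof.
move=> sX; under eq_Rintegral do rewrite sqnormE.
by rewrite Rintegral_sum// => k; exact: sqintE.
Qed.

Lemma independent_comp (f g : T -> R) (phi : R -> R) :
  measurable_fun setT phi -> independent P f g -> independent P f (phi \o g).
Proof.
move=> mphi fg A B mA mB; rewrite comp_preimage; apply: fg => //.
by rewrite -[_ @^-1` _]setTI; exact: mphi.
Qed.

End MxSquareIntegrable.

Section Increments.
Context {R : realType} {N : nat} {d : measure_display} {T : measurableType d}.
Variables (P : probability T R) (F : R -> set (set T)) (H : R -> T -> 'M[R[i]]_N).
Hypothesis hwrt : hermitian_brownian_motion_wrt P F H.
Let filt : filtration F := let: And4 h _ _ _ := hwrt in h.
Let hbm : hermitian_brownian_motion P H := let: And4 _ h _ _ := hwrt in h.
Let inc : increments_indep P F H := let: And4 _ _ _ h := hwrt in h.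

(** Measurability with respect to [F s] is expressed on the copy of [T] that carries [F s], so that
    the usual closure properties of measurable functions apply as they are. *)
Definition known (s : R) (f : T -> R) :=
  measurable_fun setT (f : g_sigma_algebraType (F s) -> R).

Definition mx_known (s : R) {m n} (X : T -> 'M[R[i]]_(m, n)) :=
  mx_mfun (X : g_sigma_algebraType (F s) -> 'M[R[i]]_(m, n)).

Lemma known_cst s c : known s (cst c).
Proof. exact: (@measurable_cst _ _ (g_sigma_algebraType (F s)) R setT c). Qed.

Lemma known_mfun s f : 0 <= s -> known s f -> measurable_fun setT f.
Proof. by move=> s0; apply: sub_measurable_mfun; exact: (filtration_sub filt s0). Qed.

Lemma known_le s t f : 0 <= s -> s <= t -> known s f -> known t f.
Proof.
move=> s0 st; apply: sub_sigma_mfun.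
apply: subset_trans (filtration_mono filt s0 st) _; exact: sub_sigma_algebra.
Qed.

Lemma mx_known_mfun s m n (X : T -> 'M[R[i]]_(m, n)) :
  0 <= s -> mx_known s X -> mx_mfun X.
Proof. by move=> s0 mX k; exact: (known_mfun s0 (mX k)). Qed.

Lemma mx_known_le s t m n (X : T -> 'M[R[i]]_(m, n)) :
  0 <= s -> s <= t -> mx_known s X -> mx_known t X.
Proof. by move=> s0 st mX k; exact: (known_le s0 st (mX k)). Qed.

Lemma mx_knownP s m n (X : T -> 'M[R[i]]_(m, n)) : 0 <= s ->
  mx_measurable_wrt (F s) X <-> mx_known s X.
Proof. by move=> s0; apply: mx_measurable_wrtP; exact: (filtration_sigma filt s0). Qed.

Lemma hbm_known u : 0 <= u -> mx_known u (H u).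
Proof. by move=> u0; apply/(mx_knownP _ u0); case: hwrt => _ _ + _; apply. Qed.

Lemma independent_incr s t f k : 0 <= s -> s <= t -> known s f ->
  independent P f (fun w => mx_coord k (H t w - H s w)).
Proof.
move=> s0 st kf A B mA mB.
have FA : F s (f @^-1` A).
  have := kf measurableT A mA; rewrite setTI.
  by rewrite (measurable_g_measurableTypeE (filtration_sigma filt s0)).
exact: (inc s0 st FA (@sigma_generated_preimage _ _ _ setT mx_coord k B I mB)).
Qed.

Variables s t : R.
Hypotheses (s0 : 0 <= s) (st : s <= t).
Let t0 : 0 <= t. Proof. exact: le_trans st. Qed.
Let K w := H t w - H s w.

Lemma incr_coordE k w :
  mx_coord k (K w) = herm_inner (coord_mx k) (H t w) - herm_inner (coord_mx k) (H s w).
Proof.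
by rewrite mx_coordB !herm_inner_coord//; exact: (hbm_hermitian hbm).
Qed.

Lemma incr_sqint k : sqint P (fun w => mx_coord k (K w)).
Proof.
rewrite (funext (incr_coordE k)).
by apply: sqintB; apply: (hbm_sqint hbm) => //; exact: coord_mx_hermsym.
Qed.

Lemma incr_mean0 k : \int[P]_w (mx_coord k (K w)) = 0.
Proof.
have hk := @coord_mx_hermsym R N k.
have z u : 0 <= u -> \int[P]_w (herm_inner (coord_mx k) (H u w)) = 0.
  move=> u0; have := @hbm_lin_mean0 _ _ _ _ _ _ hbm 1 (fun=> u) (fun=> coord_mx k).
  by under eq_Rintegral do rewrite big_ord1; apply.
rewrite (eq_Rintegral P (g := fun w => herm_inner (coord_mx k) (H t w) - herm_inner (coord_mx k) (H s w))).
  rewrite RintegralB ?z ?subrr//; apply: (@sqint_rintegrable _ _ _ P); exact: (hbm_sqint hbm).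
by move=> w _; exact: incr_coordE.
Qed.

Lemma incr_sqr k : \int[P]_w (mx_coord k (K w) ^+ 2) =
  (t - s) * herm_inner (coord_mx k) (coord_mx k).
Proof.
have hk := @coord_mx_hermsym R N k.
have i1 u v : 0 <= u -> 0 <= v -> rintegrable P
    (fun w => herm_inner (coord_mx k) (H u w) * herm_inner (coord_mx k) (H v w)).
  by move=> u0 v0; apply: sqint_mul; exact: (hbm_sqint hbm).
set x := fun w => herm_inner (coord_mx k) (H t w).
set y := fun w => herm_inner (coord_mx k) (H s w).
rewrite (eq_Rintegral P (g := fun w => (x w * x w + (- 2) * (x w * y w)) + y w * y w)); last first.
  by move=> w _; rewrite incr_coordE; rewrite /x /y; ring.
rewrite RintegralD//; last 2 first.
- by apply: rintegrableD; [exact: i1|exact: (rintegrableZ (-2) (i1 _ _ t0 s0))].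
- exact: i1.
rewrite RintegralD//; last 2 first.
- exact: i1.
- exact: (rintegrableZ (-2) (i1 _ _ t0 s0)).
rewrite RintegralZl//; last exact: i1.
rewrite !(hbm_cov hbm)// !minxx (min_idPr st); ring.
Qed.

(** A product of two square-integrable variables is in general only integrable; here the two squares
    are independent, so their product is integrable too. *)
Lemma incr_mul_sqint k g : known s g -> sqint P g ->
  sqint P (fun w => mx_coord k (K w) * g w).
Proof.
move=> kg sg; have [mK iK] := incr_sqint k; have [mg ig] := sg.
split; first exact: measurable_funM.
have kg2 : known s (fun w => g w ^+ 2) by exact: measurable_funX.
have msq : measurable_fun setT (fun x : R => x ^+ 2) by exact: measurable_funX.
have := independent_comp msq (independent_incr k s0 st kg2).
move=> /(independent_rintegrable) h.
rewrite (_ : (fun w => _) = (fun w => g w ^+ 2 * (mx_coord k (K w)) ^+ 2)); last first.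
  by apply/funext => w; rewrite exprMn mulrC.
by apply: h => //; exact: measurable_funX.
Qed.

(** The martingale property in a form free of conditional expectations: [f g] is integrable and
    known at time [s], the increment is independent of it and has mean 0. *)
Lemma incr_orth k f g : known s f -> known s g -> sqint P f -> sqint P g ->
  \int[P]_w (f w * (mx_coord k (K w) * g w)) = 0.
Proof.
move=> kf kg sf sg.
have kfg : known s (fun w => f w * g w) by exact: measurable_funM.
rewrite (eq_Rintegral P (g := fun w => (f w * g w) * mx_coord k (K w))); last first.
  by move=> w _; rewrite mulrCA mulrC -mulrA.
rewrite independent_Rintegral//.
- by rewrite incr_mean0 mulr0.
- by apply: measurable_funM; [case: sf|case: sg].
- by have [] := incr_sqint k.
- exact: independent_incr.
- exact: sqint_mul.
- exact/sqint_rintegrable/incr_sqint.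
Qed.

End Increments.

(** * Energy estimates *)

Section EnergyStep.
Context {R : realType} {N : nat} {d : measure_display} {T : measurableType d}.
Variables (P : probability T R) (F : R -> set (set T)) (H : R -> T -> 'M[R[i]]_N).
Hypothesis hwrt : hermitian_brownian_motion_wrt P F H.
Variables s t : R.
Hypotheses (s0 : 0 <= s) (st : s <= t).
Let K w := H t w - H s w.
Implicit Types X Y Z : T -> 'M[R[i]]_N.

Lemma mx_sqint_mul_incr Y : mx_known F s Y -> mx_sqint P Y ->
  mx_sqint P (fun w => K w *m Y w).
Proof.
move=> kY sY k; under eq_fun do rewrite mx_coord_mul.
apply: sqint_sum => c; apply: sqintD; last apply: sqintZ.
  exact: (incr_mul_sqint hwrt s0 st _ (kY _) (sY _)).
exact: (incr_mul_sqint hwrt s0 st _ (kY _) (sY _)).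
Qed.

Lemma mx_sqint_i_mul_incr Y : mx_known F s Y -> mx_sqint P Y ->
  mx_sqint P (fun w => 'i%C *: (K w *m Y w)).
Proof.
move=> kY sY k; under eq_fun do rewrite mx_coordiZ.
by apply: sqintZ; exact: mx_sqint_mul_incr.
Qed.

Lemma incr_mul_orth f Y k : known F s f -> sqint P f ->
  mx_known F s Y -> mx_sqint P Y -> \int[P]_w (f w * mx_coord k (K w *m Y w)) = 0.
Proof.
move=> kf sf kY sY.
have ik q r : rintegrable P (fun w => f w * (mx_coord q (K w) * mx_coord r (Y w))).
  by apply: sqint_mul => //; exact: (incr_mul_sqint hwrt s0 st _ (kY _) (sY _)).
have z q r : \int[P]_w (f w * (mx_coord q (K w) * mx_coord r (Y w))) = 0.
  exact: (incr_orth hwrt s0 st q kf (kY r) sf (sY r)).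
have ik' (a : R) q r : rintegrable P (fun w => a * (f w * (mx_coord q (K w) * mx_coord r (Y w)))).
  exact: (rintegrableZ a (ik q r)).
under eq_Rintegral.
  move=> w _; rewrite mx_coord_mul mulr_sumr.
  under eq_bigr do rewrite mulrDr [X in _ + X]mulrCA.
  over.
rewrite Rintegral_sum; last by move=> c; exact: (rintegrableD (ik _ _) (ik' _ _ _)).
rewrite big1// => c _; rewrite RintegralD//; [|exact: ik|exact: ik'].
rewrite RintegralZl//; last exact: ik.
by rewrite !z mulr0 addr0.
Qed.

Lemma i_incr_mul_orth f Y k : known F s f -> sqint P f ->
  mx_known F s Y -> mx_sqint P Y ->
  \int[P]_w (f w * mx_coord k ('i%C *: (K w *m Y w))) = 0.
Proof.
move=> kf sf kY sY.
under eq_Rintegral do rewrite mx_coordiZ mulrCA.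
rewrite RintegralZl//; last by apply: sqint_mul => //; exact: mx_sqint_mul_incr.
by rewrite (incr_mul_orth _ kf sf kY sY) mulr0.
Qed.

(** Pythagoras in mean square: the noise over [[s, t]] is orthogonal, coordinate by coordinate, to
    everything known at time [s]. *)
Lemma energy_orth Z Y : mx_known F s Z -> mx_sqint P Z ->
  mx_known F s Y -> mx_sqint P Y ->
  \int[P]_w (sqnorm (Z w + 'i%C *: (K w *m Y w))) =
  \int[P]_w (sqnorm (Z w)) + \int[P]_w (sqnorm (K w *m Y w)).
Proof.
move=> kZ sZ kY sY; have sW := mx_sqint_i_mul_incr kY sY.
have -> : \int[P]_w (sqnorm (K w *m Y w)) = \int[P]_w (sqnorm ('i%C *: (K w *m Y w))).
  by apply: eq_Rintegral => w _; rewrite sqnormiZ.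
rewrite !Rintegral_sqnorm//; last exact: mx_sqintD.
rewrite -big_split; apply: eq_bigr => k _ /=.
set z := fun w => mx_coord k (Z w); set u := fun w => mx_coord k ('i%C *: (K w *m Y w)).
rewrite (eq_Rintegral P (g := fun w => (z w ^+ 2 + 2 * (z w * u w)) + u w ^+ 2)); last first.
  by move=> w _; rewrite mx_coordD /z /u; ring.
have izu : rintegrable P (fun w => z w * u w) by exact: (sqint_mul (sZ k) (sW k)).
rewrite RintegralD//; last 2 first.
- by apply: rintegrableD; [exact: (sqintE (sZ k))|exact: (rintegrableZ 2 izu)].
- exact: (sqintE (sW k)).
rewrite RintegralD//; [|exact: (sqintE (sZ k))|exact: (rintegrableZ 2 izu)].
have zu : \int[P]_w (z w * u w) = 0 by exact: (i_incr_mul_orth k (kZ k) (sZ k) kY sY).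
by rewrite RintegralZl// zu mulr0 addr0.
Qed.

(** By [incr_sqr], each [herm_inner (coord_mx k) (coord_mx k)] is the variance of a coordinate of
    [H] per unit of time. The absolute values make the sign evident, and [mul_cst] is the price of
    submultiplicativity. *)
Definition noise_cst : R :=
  mul_cst N N N * \sum_(k : 'I_N * 'I_N * bool) `|herm_inner (coord_mx k) (coord_mx k)|.

Lemma noise_cst_ge0 : 0 <= noise_cst.
Proof. by rewrite mulr_ge0 ?mul_cst_ge0// sumr_ge0. Qed.

(** After submultiplicativity the squared norm of [Y] is independent of each squared coordinate of
    the increment, so the expectation factors and [incr_sqr] supplies [t - s]. *)
Lemma energy_mul_incr Y : mx_known F s Y -> mx_sqint P Y ->
  \int[P]_w (sqnorm (K w *m Y w)) <= noise_cst * (t - s) * \int[P]_w (sqnorm (Y w)).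
Proof.
move=> kY sY.
have kY2 : known F s (fun w => sqnorm (Y w)) by exact: mx_mfun_sqnorm.
have msq : measurable_fun setT (fun x : R => x ^+ 2) by exact: measurable_funX.
have ind k := independent_comp msq (independent_incr hwrt k s0 st kY2).
have iY := mx_sqint_rintegrable sY.
have iK k := sqintE (incr_sqint hwrt s0 st k).
have iKY k : rintegrable P (fun w => sqnorm (Y w) * mx_coord k (K w) ^+ 2).
  exact: (independent_rintegrable (rintegrable_mfun iY) (rintegrable_mfun (iK k)) (ind k) iY (iK k)).
have sKY : rintegrable P (fun w => \sum_k sqnorm (Y w) * mx_coord k (K w) ^+ 2).
  exact: rintegrable_sum.
apply: (@le_trans _ _ (\int[P]_w (mul_cst N N N * \sum_k sqnorm (Y w) * mx_coord k (K w) ^+ 2))).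
  apply: le_Rintegral => //.
  - exact/mx_sqint_rintegrable/mx_sqint_mul_incr.
  - exact: (rintegrableZ (mul_cst N N N) sKY).
  - move=> w _; apply: le_trans (sqnorm_mul_le _ _) _.
    by rewrite -mulr_sumr -sqnormE [sqnorm (Y w) * _]mulrC.
rewrite RintegralZl// Rintegral_sum// /noise_cst -!mulrA ler_wpM2l ?mul_cst_ge0//.
rewrite mulr_suml; apply: ler_sum => k _.
rewrite (independent_Rintegral (rintegrable_mfun iY) (rintegrable_mfun (iK k)) (ind k) iY (iK k)).
rewrite (incr_sqr hwrt)//.
have Y0 : 0 <= \int[P]_w (sqnorm (Y w)) by apply: Rintegral_ge0 => w _; exact: sqnorm_ge0.
rewrite (_ : `|_| * _ = \int[P]_w (sqnorm (Y w)) *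
  ((t - s) * `|herm_inner (coord_mx k) (coord_mx k)|)); last by ring.
by rewrite ler_wpM2l// ler_wpM2l ?subr_ge0// ler_norm.
Qed.

(** The increment of the driving term [i H_t - t / 2] over a step of length [h] in which [H] moves
    by [A]. *)
Definition step_mx (h : R) (A : 'M[R[i]]_N) : 'M[R[i]]_N :=
  'i%C *: A - scalar_mx (h / 2)%:C%C.

Lemma step_mxE h (A B : 'M[R[i]]_N) : step_mx h A *m B = 'i%C *: (A *m B) - (h / 2)%:C%C *: B.
Proof. by rewrite /step_mx mulmxBl -scalemxAl mul_scalar_mx. Qed.

Lemma step_mx0 : step_mx 0 0 = 0.
Proof.
rewrite /step_mx scaler0 mul0r.
by apply/matrixP => a b; rewrite !mxE rmorph0 mul0rn subr0.
Qed.

Lemma step_mxD (h k : R) (A B : 'M[R[i]]_N) :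
  step_mx (h + k) (A + B) = step_mx h A + step_mx k B.
Proof. by rewrite /step_mx mulrDl rmorphD scalerDr /= raddfD opprD addrACA. Qed.

Lemma mx_sqint_step X Y : mx_sqint P X -> mx_known F s Y -> mx_sqint P Y ->
  mx_sqint P (fun w => X w + step_mx (t - s) (K w) *m Y w).
Proof.
move=> sX kY sY; apply: mx_sqintD => //.
rewrite (_ : (fun w => _) = (fun w => 'i%C *: (K w *m Y w) +
    (- ((t - s) / 2))%:C%C *: Y w)); last first.
  by apply/funext => w; rewrite step_mxE rmorphN scaleNr.
by apply: mx_sqintD; [exact: mx_sqint_i_mul_incr|exact: mx_sqintZ].
Qed.

(** The drift [- (h / 2) Y] is joined to [X] in [Z], which is known at time [s]; what remains is
    pure noise, hence orthogonal. Both added terms are of order [h], as a Gronwall argument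
    requires. *)
Lemma energy_step X Y : mx_known F s X -> mx_sqint P X ->
  mx_known F s Y -> mx_sqint P Y ->
  \int[P]_w (sqnorm (X w + step_mx (t - s) (K w) *m Y w)) <=
  (1 + (t - s)) * \int[P]_w (sqnorm (X w)) +
  (t - s) * (noise_cst + (1 + t)) * \int[P]_w (sqnorm (Y w)).
Proof.
move=> kX sX kY sY; set h := t - s.
have h0 : 0 <= h by rewrite subr_ge0.
pose Z w := X w + (- (h / 2))%:C%C *: Y w.
have kZ : mx_known F s Z.
  by apply: mx_mfunD => //; apply: mx_mfunZ => //; exact: measurable_cst.
have sZ : mx_sqint P Z by apply: mx_sqintD => //; exact: mx_sqintZ.
rewrite (eq_Rintegral P (g := fun w => sqnorm (Z w + 'i%C *: (K w *m Y w)))); last first.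
  move=> w _; congr sqnorm; rewrite step_mxE /Z rmorphN scaleNr.
  by rewrite [in RHS]addrAC addrA.
rewrite energy_orth//.
have iX := mx_sqint_rintegrable sX; have iY := mx_sqint_rintegrable sY.
have : \int[P]_w (sqnorm (Z w)) <= \int[P]_w ((1 + h) * sqnorm (X w) +
    h * (1 + h) * sqnorm (Y w)).
  apply: le_Rintegral => //.
  - exact: mx_sqint_rintegrable.
  - exact: (rintegrableD (rintegrableZ (1 + h) iX) (rintegrableZ (h * (1 + h)) iY)).
  - move=> w _; rewrite !sqnormE !mulr_sumr -big_split; apply: ler_sum => k _ /=.
    rewrite mx_coordD mx_coordZ.
    set x := mx_coord k _; set y := mx_coord k _.
    have := mulr_ge0 h0 (sqr_ge0 (x + y / 2)).
    have := mulr_ge0 h0 (sqr_ge0 y); have := mulr_ge0 (sqr_ge0 h) (sqr_ge0 y).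
    nra.
rewrite RintegralD//; [|exact: (rintegrableZ (1 + h) iX)|exact: (rintegrableZ (h * (1 + h)) iY)].
rewrite !RintegralZl//.
have := energy_mul_incr kY sY; rewrite -/h.
have : 0 <= \int[P]_w (sqnorm (Y w)) by apply: Rintegral_ge0 => w _; exact: sqnorm_ge0.
have ht : h <= t by rewrite /h gerDl oppr_le0.
move: (\int[P]_w (sqnorm (Y w))) => y y0 h1 h2.
have := mulr_ge0 (mulr_ge0 h0 y0) (_ : 0 <= t - h); rewrite subr_ge0 => /(_ ht).
nra.
Qed.

End EnergyStep.

(** * A discrete Gronwall inequality in probability *)

Section Gronwall.
Context {R : realType} {N : nat} {d : measure_display} {T : measurableType d}.
Variables (P : probability T R) (F : R -> set (set T)) (H : R -> T -> 'M[R[i]]_N).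
Hypothesis hwrt : hermitian_brownian_motion_wrt P F H.
Variables (r : nat -> R) (m : nat) (tau : R) (a : bool) (b : nat -> nat).
Hypotheses (r0 : 0 <= r 0%N) (rmono : forall l, r l <= r l.+1).
Hypotheses (rstrict : forall l, (l < m)%N -> r l < r l.+1) (rm : r m <= tau).
Hypothesis bl : forall l, (b l <= l)%N.
Implicit Types (X Phi : nat -> T -> 'M[R[i]]_N).

Let dl l := r l.+1 - r l.
Let M l w := step_mx (dl l) (H (r l.+1) w - H (r l) w).

(* With [a] set, the feedback term may be evaluated at an earlier time [b l]. *)
Definition driven_by Phi X := (forall w, X 0%N w = 0) /\
  forall l w, X l.+1 w =
    X l w + M l w *m ((if a then X (b l) w else 0) + Phi l w).

Let r_le i j : (i <= j)%N -> r i <= r j.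
Proof. exact: ((nondecreasing_seqP r).1 rmono). Qed.

Let r_ge0 l : 0 <= r l.
Proof. by rewrite (le_trans r0)// r_le. Qed.

Let dl_ge0 l : 0 <= dl l.
Proof. by rewrite subr_ge0. Qed.

Lemma driven_by_exists Phi : exists X, driven_by Phi X.
Proof.
(* The feedback may read any earlier value [X (b l)], so the recursion builds the whole history:
   [hist l w] agrees with the solution at all indices up to [l]. *)
pose fix hist (l : nat) (w : T) {struct l} : nat -> 'M[R[i]]_N := if l is l'.+1 then
  fun i => if (i <= l')%N then hist l' w i
    else hist l' w l' + M l' w *m ((if a then hist l' w (b l') else 0) + Phi l' w)
  else fun=> 0.
have histE l i w : (i <= l)%N -> hist l w i = hist i w i.
  elim: l => [|l ih]; first by rewrite leqn0 => /eqP ->.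
  rewrite leq_eqVlt => /predU1P[->//|]; rewrite ltnS => il /=.
  by rewrite il ih.
exists (fun l w => hist l w l); split=> // l w /=.
by rewrite ltnn histE.
Qed.

(** Causality, path by path: [X n] only sees the forcing at indices below [n]. It identifies a
    system with its stopped version on the event where nothing was stopped. *)
Lemma driven_by_agree Phi Phi' X X' w n : driven_by Phi X -> driven_by Phi' X' ->
  (forall l, (l < n)%N -> Phi l w = Phi' l w) -> X n w = X' n w.
Proof.
move=> [X0 XS] [X'0 X'S]; elim/ltn_ind: n => -[_ _|n ih h]; first by rewrite X0 X'0.
have hn k : (k <= n)%N -> X k w = X' k w.
  by move=> kn; apply: ih => // l lk; apply: h; apply: leq_trans lk _; exact: leq_trans kn _.
by rewrite XS X'S !hn// h.
Qed.

Lemma driven_by_known Phi X : driven_by Phi X ->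
  (forall l, mx_known F (r l) (Phi l)) -> forall l, mx_known F (r l) (X l).
Proof.
move=> [X0 XS] kPhi; elim/ltn_ind => -[_|l ih].
  by rewrite (funext X0); exact: mx_mfun_cst.
rewrite (funext (XS l)).
have kH := hbm_known hwrt.
have up n (Y : T -> 'M[R[i]]_N) : (n <= l.+1)%N -> mx_known F (r n) Y -> mx_known F (r l.+1) Y.
  by move=> nl; apply: (mx_known_le hwrt) => //; exact: r_le.
apply: mx_mfunD; first by apply: (up l) => //; exact: ih.
apply: mx_mfunM.
  apply: mx_mfunB; last exact: mx_mfun_cst.
  apply: mx_mfuniZ; apply: mx_mfunB; first exact: kH.
  by apply: (up l) => //; exact: kH.
apply: mx_mfunD; last exact: (up l).
case: a; last exact: mx_mfun_cst.
by apply: (up (b l)); [exact: (leqW (bl l))|apply: ih; rewrite ltnS].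
Qed.

Definition growth_cst : R := @noise_cst R N + (1 + tau).

Let growth_ge0 : 0 <= growth_cst.
Proof.
have : 0 <= tau := le_trans (r_ge0 m) rm.
by have := @noise_cst_ge0 R N; rewrite /growth_cst; lra.
Qed.

(** Strong induction on [energy_step]. The claimed bound, named [G], is nondecreasing, so it also
    controls the delayed value [X (b l)]. Splitting feedback from forcing costs the factor 2 in
    front of [growth_cst], and [1 + x <= exp x] absorbs one step into the exponential. *)
Lemma driven_by_energy Phi X : driven_by Phi X ->
  (forall l, mx_known F (r l) (Phi l)) -> (forall l, mx_sqint P (Phi l)) ->
  forall l, (l <= m)%N -> mx_sqint P (X l) /\
  \int[P]_w (sqnorm (X l w)) <=
    expR ((1 + 2 * growth_cst) * (r l - r 0%N)) *
    (2 * growth_cst * \sum_(0 <= i < l) dl i * \int[P]_w (sqnorm (Phi i w))).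
Proof.
move=> dX kPhi sPhi; have kX := driven_by_known dX kPhi; have [X0 XS] := dX.
pose G l := expR ((1 + 2 * growth_cst) * (r l - r 0%N)) *
    (2 * growth_cst * \sum_(0 <= i < l) dl i * \int[P]_w (sqnorm (Phi i w))).
have phi0 i : 0 <= \int[P]_w (sqnorm (Phi i w)).
  by apply: Rintegral_ge0 => w _; exact: sqnorm_ge0.
have c0 : 0 <= 1 + 2 * growth_cst by have := growth_ge0; lra.
have S0 l : 0 <= 2 * growth_cst * \sum_(0 <= i < l) dl i * \int[P]_w (sqnorm (Phi i w)).
  by rewrite !mulr_ge0// sumr_ge0// => i _; rewrite mulr_ge0.
have Gmono l : G l <= G l.+1.
  rewrite /G ler_pM ?expR_ge0//.
    by rewrite ler_expR ler_wpM2l// lerD2r.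
  by rewrite ler_wpM2l ?mulr_ge0// big_nat_recr//= lerDl mulr_ge0.
elim/ltn_ind => -[_ _|l ih lm].
  split; first by move=> k; rewrite (funext X0); exact: sqint_cst.
  rewrite big_geq// !mulr0 (eq_Rintegral P (g := cst 0)); last first.
    by move=> w _; rewrite X0 sqnorm0.
  by rewrite Rintegral_cst// mul0r.
have [sXl hXl] := ih l (leqnn _) (ltnW lm).
have blm : (b l <= m)%N by exact: (leq_trans (bl l) (ltnW lm)).
have [sXb hXb] := ih (b l) (bl l) blm.
have {}hXb : \int[P]_w (sqnorm (X (b l) w)) <= G l.
  by apply: le_trans hXb _; apply: ((nondecreasing_seqP G).1 Gmono).
pose Y w := (if a then X (b l) w else 0) + Phi l w.
have kY : mx_known F (r l) Y.
  apply: mx_mfunD; last exact: kPhi.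
  case: a; last exact: mx_mfun_cst.
  by apply: (mx_known_le hwrt (r_ge0 (b l)) (r_le (bl l))); exact: kX.
have sY : mx_sqint P Y.
  apply: mx_sqintD; last exact: sPhi.
  case: a; first exact: sXb.
  by move=> k; exact: (@sqint_cst _ _ _ P (mx_coord k 0)).
have := energy_step hwrt (r_ge0 l) (rmono l) (kX l) sXl kY sY.
have sXS : mx_sqint P (X l.+1).
  rewrite (funext (XS l)); exact: (mx_sqint_step hwrt (r_ge0 l) (rmono l) sXl kY sY).
split => //.
rewrite (eq_Rintegral P (g := fun w => sqnorm (X l w + step_mx (dl l)
    (H (r l.+1) w - H (r l) w) *m Y w))); last by move=> w _; rewrite XS.
apply: (le_trans (energy_step hwrt (r_ge0 l) (rmono l) (kX l) sXl kY sY)).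
rewrite -/(dl l) -/(G l.+1).
have hY : \int[P]_w (sqnorm (Y w)) <= 2 * G l + 2 * \int[P]_w (sqnorm (Phi l w)).
  apply: (@le_trans _ _ (\int[P]_w (2 * sqnorm (if a then X (b l) w else 0) + 2 * sqnorm (Phi l w)))).
    apply: le_Rintegral => //.
    - exact: mx_sqint_rintegrable.
    - apply: rintegrableD; last exact: (rintegrableZ 2 (mx_sqint_rintegrable (sPhi l))).
      case: a; first exact: (rintegrableZ 2 (mx_sqint_rintegrable sXb)).
      exact: rintegrable_cst.
    - by move=> w _; exact: sqnorm_add_le.
  rewrite RintegralD//; last 2 first.
  - case: a; first exact: (rintegrableZ 2 (mx_sqint_rintegrable sXb)).
    exact: rintegrable_cst.
  - exact: (rintegrableZ 2 (mx_sqint_rintegrable (sPhi l))).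
  rewrite [X in _ + X]RintegralZl//; last exact: mx_sqint_rintegrable.
  rewrite lerD2r; case: a.
    rewrite RintegralZl//; last exact: mx_sqint_rintegrable.
    by rewrite ler_wpM2l.
  by rewrite Rintegral_cst// sqnorm0 !mulr0 mul0r mulr_ge0// mulr_ge0 ?expR_ge0.
have G0 : 0 <= G l by rewrite mulr_ge0 ?expR_ge0.
have rt : r l.+1 <= tau by rewrite (le_trans _ rm)// r_le.
set phi := \int[P]_w (sqnorm (Phi l w)) in hY *.
have phi00 : 0 <= phi by exact: phi0.
apply: (@le_trans _ _ ((1 + (1 + 2 * growth_cst) * dl l) * G l + 2 * growth_cst * (dl l * phi))).
  have e1 : (1 + dl l) * \int[P]_w (sqnorm (X l w)) <= (1 + dl l) * G l.
    by rewrite ler_wpM2l// addr_ge0.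
  have e2 : dl l * (@noise_cst R N + (1 + r l.+1)) * \int[P]_w (sqnorm (Y w)) <=
      dl l * growth_cst * (2 * G l + 2 * phi).
    apply: ler_pM => //.
    - rewrite mulr_ge0// addr_ge0 ?noise_cst_ge0// addr_ge0//.
    - by apply: Rintegral_ge0 => w _; exact: sqnorm_ge0.
    - by rewrite ler_wpM2l// /growth_cst lerD2l lerD2l.
  by move: e1 e2; lra.
have -> : G l.+1 = expR ((1 + 2 * growth_cst) * dl l) * G l +
    expR ((1 + 2 * growth_cst) * (r l.+1 - r 0%N)) * (2 * growth_cst * (dl l * phi)).
  rewrite /G big_nat_recr//= -/phi.
  have -> : expR ((1 + 2 * growth_cst) * (r l.+1 - r 0%N)) =
      expR ((1 + 2 * growth_cst) * dl l) * expR ((1 + 2 * growth_cst) * (r l - r 0%N)).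
    by rewrite -expRD; congr expR; rewrite /dl; ring.
  by ring.
apply: lerD; first by rewrite ler_wpM2r// expR_ge1Dx.
rewrite ler_peMl// ?mulr_ge0//.
by rewrite -[leLHS]expR0 ler_expR mulr_ge0// subr_ge0 r_le.
Qed.

Definition gronwall_cst : R :=
  expR ((1 + 2 * growth_cst) * tau) * (2 * growth_cst).

(* Stopping [Phi] when its weighted square sum exceeds [eta] brings the energy
   estimate to bear on a system which agrees with the given one outside the event
   on the right. *)
Lemma gronwall_in_probability Phi X (eps eta : R) : driven_by Phi X ->
  (forall l, mx_known F (r l) (Phi l)) -> 0 < eps -> 0 < eta ->
  (P [set w | (eps <= sqnorm (X m w))%R] <=
   P [set w | (eta < \sum_(0 <= l < m) dl l * sqnorm (Phi l w))%R] +
   (gronwall_cst * eta / eps)%:E)%E.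
Proof.
move=> dX kPhi eps0 eta0; have kX := driven_by_known dX kPhi.
pose A n w := \sum_(0 <= l < n) dl l * sqnorm (Phi l w).
have AS n w : A n.+1 w = A n w + dl n * sqnorm (Phi n w) by rewrite /A big_nat_recr.
have A0 n w : 0 <= A n w.
  by apply: sumr_ge0 => l _; rewrite mulr_ge0// sqnorm_ge0.
have kA n s : (n <= s.+1)%N -> known F (r s) (A n).
  elim: n => [_|n ih ns].
    by rewrite /A; under eq_fun do rewrite big_geq//; exact: known_cst.
  rewrite (funext (AS n)); apply: measurable_funD; first exact: (ih (ltnW ns)).
  apply: measurable_funM; first exact: known_cst.
  apply: mx_mfun_sqnorm; apply: (mx_known_le hwrt (r_ge0 n)); last exact: kPhi.
  exact: r_le.
(* The test involves [A l.+1], which contains the term at [l]: it is already known at time [r l], so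
   [chi] is adapted and the stopped sum never overshoots [eta]. The condition [l < m] keeps to the
   cells of positive length. *)
pose chi l w : R := if (l < m)%N && (A l.+1 w <= eta) then 1 else 0.
pose Phi' l w := (chi l w)%:C%C *: Phi l w.
have kchi l : known F (r l) (chi l).
  rewrite /chi; case: (l < m)%N => /=; last exact: known_cst.
  apply: measurable_fun_ifT; [|exact: known_cst|exact: known_cst].
  apply: measurable_fun_ler; last exact: known_cst.
  exact: kA.
have kPhi' l : mx_known F (r l) (Phi' l) by apply: mx_mfunZ; [exact: kchi|exact: kPhi].
have sq' l w : sqnorm (Phi' l w) = chi l w * sqnorm (Phi l w).
  by rewrite /Phi' sqnormZ /chi; case: ifP; rewrite ?expr1n// expr0n.
have sPhi' l : mx_sqint P (Phi' l).
  (* While [chi] is 1 the single term [dl l * sqnorm (Phi l w)] is at most [eta], so the stopped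
     forcing is bounded even if [Phi] has no moments. *)
  apply: (@mx_sqint_bounded _ _ _ _ _ _ _ (eta / dl l)).
    exact: (mx_known_mfun hwrt (r_ge0 l) (kPhi' l)).
  move=> w; rewrite sq' /chi; case: ifP => [/andP[lm hA]|_]; last first.
    by rewrite mul0r mulr_ge0 ?invr_ge0// ltW.
  rewrite mul1r ler_pdivlMr ?subr_gt0 ?rstrict// mulrC (le_trans _ hA)//.
  by rewrite AS lerDr.
have sumle n w : \sum_(0 <= l < n) dl l * sqnorm (Phi' l w) <= Num.min (A n w) eta.
  elim: n => [|n ih]; first by rewrite big_geq// le_min A0 ltW.
  rewrite big_nat_recr//= sq'; move: ih; rewrite !le_min => /andP[ih1 ih2].
  have h1 : A n w <= A n.+1 w by rewrite AS lerDl mulr_ge0// sqnorm_ge0.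
  rewrite /chi; case: ifP => [/andP[_ hA]|_].
    have : \sum_(0 <= l < n) dl l * sqnorm (Phi' l w) + dl n * (1 * sqnorm (Phi n w)) <= A n.+1 w.
      by rewrite AS mul1r lerD2r.
    by move=> h; rewrite h (le_trans h).
  by rewrite mul0r mulr0 addr0 ih2 (le_trans ih1).
have [X' dX'] := driven_by_exists Phi'.
have [sX' eX'] := driven_by_energy dX' kPhi' sPhi' (leqnn m).
have kX' := driven_by_known dX' kPhi'.
have Ele : \sum_(0 <= i < m) dl i * \int[P]_w (sqnorm (Phi' i w)) <= eta.
  have i1 l : rintegrable P (fun w => dl l * sqnorm (Phi' l w)).
    exact: (rintegrableZ (dl l) (mx_sqint_rintegrable (sPhi' l))).
  rewrite (eq_bigr (fun i => \int[P]_w (dl i * sqnorm (Phi' i w)))); last first.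
    by move=> l _; rewrite RintegralZl//; exact: mx_sqint_rintegrable.
  rewrite -Rintegral_sum//.
  have -> : eta = \int[P]_w (cst eta w).
    transitivity (eta * fine (P setT)); last exact/esym/Rintegral_cst.
    by rewrite probability_setT mulr1.
  apply: le_Rintegral => //.
  - exact: (rintegrable_sum _ i1).
  - exact: (rintegrable_cst P eta).
  - by move=> w _ /=; have := sumle m w; rewrite le_min => /andP[].
have c0 : 0 <= 1 + 2 * growth_cst by have := growth_ge0; lra.
have {}eX' : \int[P]_w (sqnorm (X' m w)) <= gronwall_cst * eta.
  apply: le_trans eX' _; rewrite /gronwall_cst -[leRHS]mulrA ler_pM ?expR_ge0//.
  - rewrite !mulr_ge0// sumr_ge0// => l _; rewrite mulr_ge0//.
    by apply: Rintegral_ge0 => w _; exact: sqnorm_ge0.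
  - by rewrite ler_expR ler_wpM2l//; have := rm; have := r0; lra.
  - by rewrite ler_wpM2l// mulr_ge0.
have mX : measurable [set w | eps <= sqnorm (X m w)].
  by apply: measurable_level; apply: mx_mfun_sqnorm; exact: (mx_known_mfun hwrt (r_ge0 m) (kX m)).
have mX' : measurable [set w | eps <= sqnorm (X' m w)].
  by apply: measurable_level; apply: mx_mfun_sqnorm; exact: (mx_known_mfun hwrt (r_ge0 m) (kX' m)).
have mA : measurable [set w | eta < A m w].
  by apply: measurable_strict_level; exact: (known_mfun hwrt (r_ge0 m) (kA m m (leqnSn m))).
(* If the sum stays below [eta] then nothing was stopped and [X m] equals [X' m]; Markov's
   inequality and the energy bound take care of [X' m]. *)
apply: (@le_trans _ _ (P ([set w | (eta < A m w)%R] `|` [set w | (eps <= sqnorm (X' m w))%R]))).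
  apply: le_measure; rewrite ?inE//; first exact: measurableU.
  move=> w /= hw; case: (ltP eta (A m w)) => hA; [by left|right].
  rewrite -(driven_by_agree dX dX' (w := w) (n := m))// => l lm.
  have hA' : A l.+1 w <= eta.
    apply: le_trans _ hA; apply: ((nondecreasing_seqP (A ^~ w)).1 _ _ _ lm) => n.
    by rewrite AS lerDl mulr_ge0// sqnorm_ge0.
  by rewrite /Phi' /chi lm hA' /= scale1r.
apply: le_trans (measureU2 P mA mX') _; apply: leeD => //.
apply: le_trans (markov_rintegrable (mx_sqint_rintegrable sX') (fun w => sqnorm_ge0 _) eps0) _.
by rewrite lee_fin mulrC ler_wpM2r// invr_ge0 ltW.
Qed.

End Gronwall.

(** * Simple processes and partitions *)

Section UniformContinuity.
Context {R : realType}.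

(** Heine's theorem, from compactness of [[0, t]] in its near-covering form, applied to the filter
    of moduli that decrease to 0. *)
Lemma within_uniform_continuous (f : R -> R) (t e : R) :
  {within `[0, +oo[, continuous f} -> 0 < e ->
  exists2 del : R, 0 < del & forall x y, 0 <= x <= t -> 0 <= y <= t ->
    `|x - y| < del -> `|f x - f y| < e.
Proof.
move=> /subspace_continuousP cf e0.
pose Q (del x : R) := 0 <= x -> forall y, 0 <= y -> `|x - y| < del -> `|f x - f y| < e.
have /compact_near_coveringP cpt := @segment_compact R 0 t.
have /(_ _ (0 : R)^'+ Q) := cpt _.
have h x : `[0, t]%classic x -> \forall x' \near x & i \near (0 : R)^'+, Q i x'.
  rewrite /= in_itv /= => /andP[x0 _].
  have := cf x; rewrite /= in_itv /= x0 => /(_ isT) /cvgrPdist_lt /(_ (e / 2)).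
  rewrite divr_gt0// => /(_ isT); rewrite near_withinE => /nbhs_ballP[r /= r0 hr].
  exists (ball x (r / 2), [set i : R | 0 < i < r / 2]) => /=.
    split; first by apply: nbhsx_ballx; rewrite divr_gt0.
    near=> i; apply/andP; split; first by near: i; exact: nbhs_right_gt.
    by near: i; apply: nbhs_right_lt; rewrite divr_gt0.
  move=> [x' i] /= [xx' /andP[i0 ir]] x'0 y y0 x'y.
  rewrite /ball /= in xx'.
  have h1 : `|f x - f x'| < e / 2.
    apply: hr; last by rewrite /= in_itv /= x'0.
    by rewrite /ball /= (lt_trans xx')// ltr_pdivrMr// ltr_pMr// ltr1n.
  have h2 : `|f x - f y| < e / 2.
    apply: hr; last by rewrite /= in_itv /= y0.
    rewrite /ball /=; have := ler_distD x' x y.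
    by move: xx' x'y ir; lra.
  have := ler_distD (f x) (f x') (f y); rewrite (distrC (f x') (f x)).
  by move: h1 h2; lra.
move=> /(_ _ h) [del /= del0 hdel].
exists (del / 2); first by rewrite divr_gt0.
move=> x y x0t /andP[y0 _] xy; have /andP[x0 _] := x0t.
have /(_ x) : `[0, t]%classic `<=` Q (del / 2).
  apply: hdel; last by rewrite /= divr_gt0.
  rewrite /ball /= sub0r normrN gtr0_norm ?divr_gt0//.
  by rewrite ltr_pdivrMr// ltr_pMr// ltr1n.
by rewrite /= in_itv /=; apply.
Unshelve. all: by end_near. Qed.

End UniformContinuity.

(** * Integrals of step functions and Cauchy-Schwarz in time *)

Section StepIntegral.
Context {R : realType}.
Notation mu := (@lebesgue_measure R).

Lemma itv_oc_measure (x y : R) : x <= y -> mu `]x, y] = (y - x)%:E.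
Proof.
move=> xy; rewrite lebesgue_measure_itv /= lte_fin.
by case: ltP => // yx; congr EFin; lra.
Qed.

Lemma sum_cells_le_integral (r : nat -> R) (m : nat) (c : nat -> R) (f : R -> \bar R) :
  (forall l, (l < m)%N -> r l <= r l.+1) ->
  measurable_fun setT f -> (forall s, 0 <= f s)%E -> (forall i, 0 <= c i) ->
  (forall i s, (i < m)%N -> r i < s <= r i.+1 -> ((c i)%:E <= f s)%E) ->
  ((\sum_(0 <= i < m) (r i.+1 - r i) * c i)%:E <= \int[mu]_(s in `]r 0%N, r m]) f s)%E.
Proof.
move=> rmono mf f0 c0; elim: m rmono => [_ _|m ih rmono cf].
  by rewrite big_geq// integral_ge0.
have r0m : r 0%N <= r m.
  elim: m rmono {ih cf} => // m ih h.
  by apply: le_trans (ih _) (h m _) => // l lm; apply: h; exact: leqW.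
have rmS : r m <= r m.+1 by exact: rmono.
rewrite big_nat_recr//= EFinD.
have -> : `]r 0%N, r m.+1]%classic = `]r 0%N, r m] `|` `]r m, r m.+1].
  by rewrite -itv_bndbnd_setU.
rewrite ge0_integral_setU//=; last 2 first.
- exact: measurable_funS mf.
- apply/disj_setPS => s [] /=; rewrite !in_itv /= => /andP[_ h1] /andP[h2 _].
  by move: (lt_le_trans h2 h1); rewrite ltxx.
apply: leeD.
  apply: ih => [l lm|i s im]; first by apply: rmono; exact: leqW.
  by apply: cf; exact: leqW.
rewrite mulrC EFinM -(itv_oc_measure rmS) -integral_cst//.
apply: ge0_le_integral => //.
- by move=> s _; rewrite lee_fin.
- exact: measurable_funS mf.
- by move=> s; rewrite /= in_itv /= => h; exact: cf.
Qed.

Lemma Rintegral_step (t x y c : R) : 0 <= x -> x <= y -> y <= t ->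
  mu.-integrable `[0, t] (EFin \o (fun u => if x < u <= y then c else 0)) /\
  \int[mu]_(u in `[0, t]) (if x < u <= y then c else 0) = (y - x) * c.
Proof.
move=> x0 xy yt.
have e u : (if x < u <= y then c else 0) = c * \1_`]x, y] u.
  rewrite indicE; case: ifPn => h; first by rewrite mem_set ?mulr1//= in_itv.
  by rewrite memNset ?mulr0//= in_itv /=; exact/negP.
have i1 : mu.-integrable `[0, t] (EFin \o \1_`]x, y]).
  by apply: (integrableS measurableT) => //; exact: integrable_indic_itv.
split.
  rewrite (_ : EFin \o _ = fun u => (c%:E * (\1_`]x, y] u)%:E)%E).
    exact: integrableZl.
  by apply/funext => u /=; rewrite e EFinM.
under eq_Rintegral do rewrite e.
rewrite RintegralZl// mulrC; congr (_ * _).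
have sub : `]x, y] `<=` `[0, t].
  by move=> u; rewrite /= !in_itv /= => /andP[/ltW h1 h2]; rewrite (le_trans x0)// (le_trans h2).
rewrite /Rintegral integral_indic// (setIidl sub).
exact: (congr1 fine (itv_oc_measure xy)).
Qed.

Lemma sqr_Rintegral_le (f : R -> R) (t : R) : 0 < t ->
  measurable_fun `[0, t] f ->
  (\int[mu]_(s in `[0%R, t]) (f s ^+ 2)%:E < +oo)%E ->
  mu.-integrable `[0, t] (EFin \o f) /\
  (\int[mu]_(s in `[0, t]) f s) ^+ 2 <= t * \int[mu]_(s in `[0, t]) (f s ^+ 2).
Proof.
move=> t0 mf hf.
have mut : mu `[0, t] = t%:E.
  by rewrite lebesgue_measure_itv /= lte_fin t0 -EFinB subr0.
have icst (c : R) : mu.-integrable `[0, t] (EFin \o cst c).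
  apply/integrableP; split; first exact/measurable_EFinP/measurable_cst.
  rewrite (eq_integral (cst `|c|%:E))// integral_cst//.
  suff -> : (`|c|%:E * mu `[0%R, t] = (`|c| * t)%:E)%E by rewrite ltry.
  by rewrite EFinM; congr (_ * _)%E; exact: mut.
have if2 : mu.-integrable `[0, t] (EFin \o (fun s => f s ^+ 2)).
  apply/integrableP; split; first exact/measurable_EFinP/measurable_funX.
  apply: le_lt_trans hf; rewrite le_eqVlt; apply/orP; left; apply/eqP.
  by apply: eq_integral => s _ /=; rewrite ger0_norm// sqr_ge0.
have if1 : mu.-integrable `[0, t] (EFin \o f).
  apply: le_integrable (integrableD _ if2 (icst 1)) => //.
    exact/measurable_EFinP.
  move=> s _ /=; rewrite lee_fin [leRHS]ger0_norm ?addr_ge0 ?sqr_ge0//.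
  rewrite -(real_normK (num_real (f s))).
  by have := sqr_ge0 (`|f s| - 1); have := normr_ge0 (f s); nra.
split=> //; set I := \int[mu]_(s in _) f s; set Q := \int[mu]_(s in _) _.
(* Cauchy-Schwarz as nonnegativity of a variance: [c] is the mean of [f], and the integral of
   [(f - c)^2] equals [Q - I^2 / t]. *)
pose c := I / t.
have : 0 <= \int[mu]_(s in `[0, t]) ((f s ^+ 2 + (- (2 * c)) * f s) + c ^+ 2).
  by apply: Rintegral_ge0 => s _; have := sqr_ge0 (f s - c); nra.
have iZ : mu.-integrable `[0, t] (EFin \o (fun s => (- (2 * c)) * f s)).
  exact: (integrableZl _ (- (2 * c)) if1).
rewrite RintegralD//; [|exact: (integrableD _ if2 iZ)|exact: icst].
rewrite RintegralD// RintegralZl// Rintegral_cst// (congr1 fine mut : fine (mu `[0, t]) = t) -/I -/Q.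
suff -> : Q + - (2 * c) * I + c ^+ 2 * t = (t * Q - I ^+ 2) / t.
  by rewrite pmulr_lge0 ?invr_gt0// subr_ge0.
by rewrite /c; field; rewrite gt_eqF.
Qed.

End StepIntegral.

(** * Joint measurability in time and randomness *)

Section JointMeasurability.
Context {R : realType} {d : measure_display} {T : measurableType d}.
Notation mu := (@lebesgue_measure R).

Lemma measurable_fun_nat_index d' (T' : measurableType d') (k : T' -> nat)
    (g : nat -> T' -> R) :
  (forall n, measurable [set z | k z = n]) -> (forall n, measurable_fun setT (g n)) ->
  measurable_fun setT (fun z => g (k z) z).
Proof.
move=> mk mg _ B mB; rewrite setTI.
rewrite (_ : _ @^-1` B = \bigcup_n ([set z | k z = n] `&` g n @^-1` B)); last first.
  apply/seteqP; split=> [z /= hz|z [n _ [/= <-]]//]; first by exists (k z).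
apply: bigcup_measurable => n _; apply: measurableI => //.
by rewrite -[_ @^-1` _]setTI; exact: mg.
Qed.

Lemma measurable_truncn d' (T' : measurableType d') (h : T' -> R) n :
  measurable_fun setT h -> measurable [set z | Num.truncn (h z) = n].
Proof.
move=> mh.
have ml m : measurable [set z | (Num.truncn (h z) <= m)%N].
  rewrite (_ : [set z | _] = h @^-1` `]-oo, m.+1%:R[).
    by rewrite -[_ @^-1` _]setTI; exact: mh.
  by apply/seteqP; split=> z /=; rewrite in_itv /= truncn_le_nat.
case: n => [|n].
  rewrite (_ : [set z | _] = [set z | (Num.truncn (h z) <= 0)%N])//.
  by apply/seteqP; split=> z /=; rewrite leqn0 => /eqP.
rewrite (_ : [set z | _] = [set z | (Num.truncn (h z) <= n.+1)%N] `\`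
    [set z | (Num.truncn (h z) <= n)%N]); first exact: measurableD.
apply/seteqP; split=> z /=; first by move=> ->; rewrite leqnn ltnn.
move=> [h1 /negP]; rewrite -ltnNge => h2.
by apply/eqP; rewrite eqn_leq h1.
Qed.

(* [Num.max 0] because paths are only continuous on [0, +oo[. *)
Lemma joint_mfun (X : R -> T -> R) :
  (forall s, 0 <= s -> measurable_fun setT (X s)) ->
  (forall w, {within `[0, +oo[, continuous (X ^~ w)}) ->
  measurable_fun setT (fun z : T * R => X (Num.max 0 z.2) z.1).
Proof.
move=> mX cX.
(* The process is sampled at the last multiple of [1 / (n + 1)] before [s]; the sampled process is
   measurable on countably many slabs, and path continuity gives the pointwise limit. *)
pose a (n : nat) (s : R) : nat := Num.truncn (n.+1%:R * Num.max 0 s).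
apply: (@measurable_fun_cvg _ _ _ setT
  (fun n (z : T * R) => X ((a n z.2)%:R / n.+1%:R) z.1)) => [n|[w s] _] /=.
  apply: (@measurable_fun_nat_index _ _ (fun z => a n z.2)
    (fun j z => X (j%:R / n.+1%:R) z.1)) => j.
    apply: measurable_truncn; apply: measurable_funM => //.
    by apply: measurable_maxr => //; exact: measurable_snd.
  by apply: (measurableT_comp (mX _ _)); [rewrite divr_ge0|exact: measurable_fst].
set s' := Num.max 0 s; have s'0 : 0 <= s' by rewrite le_max lexx.
have an n : `|s' - (a n s)%:R / n.+1%:R| < n.+1%:R^-1.
  have /truncn_itv /andP[h1 h2] : 0 <= n.+1%:R * s' by rewrite mulr_ge0.
  rewrite ger0_norm ?subr_ge0 ?ler_pdivrMr//; last by rewrite mulrC.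
  rewrite ltrBlDl -[X in _ + X]mul1r -mulrDl ltr_pdivlMr// natr1 mulrC.
  exact: h2.
have /subspace_continuousP /(_ s') := cX w.
rewrite /= in_itv /= s'0 => /(_ isT) /cvgrPdist_lt cs.
apply/cvgrPdist_lt => e e0; have := cs e e0.
rewrite near_withinE => /nbhs_ballP[r /= r0 hr].
near=> n; apply: hr; last by rewrite /= in_itv /= andbT divr_ge0.
rewrite /ball /=; apply: lt_trans (an n) _.
rewrite invf_plt ?posrE//; apply: (@lt_trans _ _ n%:R); last by rewrite ltr_nat.
by near: n; exact: nbhs_infty_gtr.
Unshelve. all: by end_near. Qed.

Lemma mfun_time_integral (g : T * R -> R) t : measurable_fun setT g ->
  (forall z, 0 <= g z) ->
  measurable_fun setT (fun w => \int[mu]_(s in `[0%R, t]) (g (w, s))%:E)%E.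
Proof.
move=> mg g0.
pose f (z : T * R) := ((if 0 <= z.2 <= t then g z else 0)%:E).
have mf : measurable_fun setT f.
  apply/measurable_EFinP; apply: measurable_fun_ifT => //.
  by apply: measurable_and; apply: measurable_fun_ler => //; exact: measurable_snd.
have f0 z : (0 <= f z)%E by rewrite /f lee_fin; case: ifP.
have := @measurable_fun_fubini_tonelli_F _ _ _ _ _ mu f mf f0.
congr measurable_fun; apply/funext => w.
rewrite [RHS]integral_mkcond /fubini_F; apply: eq_integral => s _.
rewrite /f /= patchE; case: ifPn => h.
  by rewrite mem_set//= in_itv.
by rewrite memNset//= in_itv /=; exact/negP.
Qed.

End JointMeasurability.

Section SimpleProcesses.
Context {R : realType} {N : nat} {d : measure_display} {T : measurableType d}.
Notation mu := (@lebesgue_measure R).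
Notation sproc := (@simple_process R N d T).
Implicit Types (X : R -> T -> 'M[R[i]]_N) (phi psi : sproc).

Definition sq_error X phi (t : R) (w : T) : \bar R :=
  (\int[mu]_(s in `[0%R, t]) (sqnorm (X s w - sp_eval phi s w))%:E)%E.

Definition mx_path_mfun X := forall s, 0 <= s -> mx_mfun (X s).

Definition sp_mfun phi := forall j, (j < sp_size phi)%N -> mx_mfun (sp_value phi j).

Lemma sp_eval_joint_mfun phi : sp_mfun phi ->
  mx_mfun (fun z : T * R => sp_eval phi z.2 z.1).
Proof.
move=> mphi k; rewrite /sp_eval.
under eq_fun do rewrite big_nat mx_coord_sum -big_nat big_mkord.
apply: measurable_sum => j.
rewrite (_ : (fun _ => _) = fun z : T * R =>
    if sp_time phi j < z.2 <= sp_time phi j.+1 then mx_coord k (sp_value phi j z.1) else 0).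
  apply: measurable_fun_ifT; last exact: measurable_cst.
    apply: measurable_and; first by apply: measurable_fun_ltr => //; exact: measurable_snd.
    by apply: measurable_fun_ler => //; exact: measurable_snd.
  by apply: (measurableT_comp (mphi j (ltn_ord j) k)); exact: measurable_fst.
by apply/funext => z; case: ifP => // _; rewrite mx_coord0.
Qed.

Lemma diff_joint_mfun X phi : mx_path_mfun X -> mx_continuous_paths X -> sp_mfun phi ->
  mx_mfun (fun z : T * R => X (Num.max 0 z.2) z.1 - sp_eval phi z.2 z.1).
Proof.
move=> mX cX mphi; apply: mx_mfunB; last exact: sp_eval_joint_mfun.
move=> k; apply: (@joint_mfun _ _ _ (fun s w => mx_coord k (X s w))).
  by move=> s s0; exact: mX.
by move=> w; exact: cX.
Qed.

Lemma sq_errorE X phi t w : sq_error X phi t w =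
  (\int[mu]_(s in `[0%R, t]) (sqnorm (X (Num.max 0 s) w - sp_eval phi s w))%:E)%E.
Proof.
apply: eq_integral => s; rewrite inE /= in_itv /= => /andP[s0 _].
by rewrite (max_idPr s0).
Qed.

Lemma measurable_sq_error X phi t : mx_path_mfun X -> mx_continuous_paths X ->
  sp_mfun phi -> measurable_fun setT (sq_error X phi t).
Proof.
move=> mX cX mphi; rewrite (funext (sq_errorE X phi t)).
apply: (@mfun_time_integral _ _ _
  (fun z => sqnorm (X (Num.max 0 z.2) z.1 - sp_eval phi z.2 z.1))).
  by apply: mx_mfun_sqnorm; exact: diff_joint_mfun.
by move=> z; exact: sqnorm_ge0.
Qed.

Lemma path_diff_mfun X phi w : mx_path_mfun X -> mx_continuous_paths X -> sp_mfun phi ->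
  mx_mfun (fun s : R => X (Num.max 0 s) w - sp_eval phi s w).
Proof.
move=> mX cX mphi k.
have mp : measurable_fun setT (fun s : R => (w, s)) by exact: measurable_fun_pair.
exact: (measurableT_comp (diff_joint_mfun mX cX mphi k) mp).
Qed.

End SimpleProcesses.

(** * Simple processes on a common partition *)

Section Partitions.
Context {R : realType} {N : nat} {d : measure_display} {T : measurableType d}.
Notation mu := (@lebesgue_measure R).
Notation sproc := (@simple_process R N d T).
Implicit Types (X : R -> T -> 'M[R[i]]_N) (phi psi : sproc).

Section FixedPartition.
Variables (r : nat -> R) (m : nat).
Hypothesis rstrict : forall l, (l < m)%N -> r l < r l.+1.

Lemma partition_lt p q : (q <= m)%N -> (p < q)%N -> r p < r q.
Proof.
elim: q => // q ih qm; rewrite ltnS leq_eqVlt => /predU1P[->|pq]; first exact: rstrict.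
by apply: (lt_trans (ih (ltnW qm) pq)); exact: rstrict.
Qed.

Lemma partition_ltE p q : (p <= m)%N -> (q <= m)%N -> (r p < r q) = (p < q)%N.
Proof.
move=> pm qm; case: (ltngtP p q) => [pq|qp|->]; last by rewrite ltxx.
  exact: partition_lt.
by apply/negbTE; rewrite -leNgt ltW//; exact: partition_lt.
Qed.

Lemma partition_leE p q : (p <= m)%N -> (q <= m)%N -> (r p <= r q) = (p <= q)%N.
Proof. by move=> pm qm; rewrite leNgt partition_ltE// -leqNgt. Qed.

Definition on_partition phi := forall j, (j <= sp_size phi)%N ->
  exists2 p, (p <= m)%N & sp_time phi j = r p.

(** No breakpoint of [phi] lies strictly inside a cell. The value is read at the right end because
    the intervals of a simple process are open on the left and closed on the right. *)
Lemma sp_eval_cell phi i s w : on_partition phi -> (i < m)%N -> r i < s <= r i.+1 ->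
  sp_eval phi s w = sp_eval phi (r i.+1) w.
Proof.
move=> onp im /andP[is1 is2]; rewrite /sp_eval !big_nat; apply: eq_bigr => j /andP[_ jphi].
have [p pm ->] := onp j (ltnW jphi); have [q qm ->] := onp j.+1 jphi.
have ism : (i.+1 <= m)%N by []. have iim : (i <= m)%N := ltnW im.
have -> : (r p < s) = (r p < r i.+1).
  rewrite partition_ltE// ltnS; case: (leqP p i) => h.
    by rewrite (le_lt_trans _ is1)// partition_leE.
  by apply/negbTE; rewrite -leNgt (le_trans is2)// partition_leE.
have -> // : (s <= r q) = (r i.+1 <= r q).
rewrite partition_leE//; case: (ltnP i q) => h.
  by rewrite (le_trans is2)// partition_leE.
by apply/negbTE; rewrite -ltNge (le_lt_trans _ is1)// partition_leE.
Qed.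

(** Refinement does not change a stochastic sum: after exchanging the sums, the cells inside one
    interval of [phi] telescope. The integrator [G] is arbitrary, so that noise and drift are
    treated together. *)
Lemma sp_sum_partition phi (G : R -> 'M[R[i]]_N) w : on_partition phi ->
  (forall j, (j < sp_size phi)%N -> sp_time phi j <= sp_time phi j.+1) ->
  \sum_(0 <= i < m) (G (r i.+1) - G (r i)) *m sp_eval phi (r i.+1) w =
  \sum_(0 <= j < sp_size phi)
    (G (sp_time phi j.+1) - G (sp_time phi j)) *m sp_value phi j w.
Proof.
move=> onp tmono; rewrite /sp_eval.
under eq_bigr do rewrite mulmx_sumr.
rewrite exchange_big /= !big_nat; apply: eq_bigr => j /andP[_ jphi].
have [p pm tp] := onp j (ltnW jphi); have [q qm tq] := onp j.+1 jphi.
have pq : (p <= q)%N by rewrite -partition_leE// -tp -tq tmono.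
rewrite tp tq -(telescope_sumr (fun i => G (r i)) pq).
pose Z i := (G (r i.+1) - G (r i)) *m
  (if r p < r i.+1 <= r q then sp_value phi j w else 0).
have Z1 : \sum_(0 <= i < p) Z i = 0.
  rewrite big_nat big1// => i /andP[_ ip]; rewrite /Z partition_ltE//.
    by rewrite ltnS leqNgt ip /= mulmx0.
  exact: leq_trans ip pm.
have Z3 : \sum_(q <= i < m) Z i = 0.
  rewrite big_nat big1// => i /andP[qi im]; rewrite /Z [r i.+1 <= r q]partition_leE//.
  by rewrite ltnNge qi andbF mulmx0.
rewrite -/(\sum_(0 <= i < m) Z i) (big_cat_nat (n := p))//= Z1 add0r.
rewrite (big_cat_nat (n := q))//= Z3 addr0.
rewrite mulmx_suml !big_nat; apply: eq_bigr => i /andP[pi iq].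
have im : (i.+1 <= m)%N by exact: leq_trans iq qm.
by rewrite /Z partition_ltE// partition_leE// ltnS pi iq.
Qed.

(** Two simple processes that both approach [X] approach each other. This is what makes the
    unspecified processes of the Ito integral comparable with an explicit grid; the sum on the left
    is the one that the Gronwall estimate takes as input. *)
Lemma cells_le_sq_error X phi psi w : r 0%N = 0 ->
  mx_path_mfun X -> mx_continuous_paths X -> sp_mfun phi -> sp_mfun psi ->
  on_partition phi -> on_partition psi ->
  ((\sum_(0 <= i < m) (r i.+1 - r i) *
      sqnorm (sp_eval phi (r i.+1) w - sp_eval psi (r i.+1) w))%:E <=
   2%:E * sq_error X phi (r m) w + 2%:E * sq_error X psi (r m) w)%E.
Proof.
move=> r0 mX cX mphi mpsi ophi opsi.
pose A s := X (Num.max 0 s) w - sp_eval phi s w.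
pose B s := X (Num.max 0 s) w - sp_eval psi s w.
have mA := mx_mfun_sqnorm (path_diff_mfun w mX cX mphi).
have mB := mx_mfun_sqnorm (path_diff_mfun w mX cX mpsi).
have mA2 : measurable_fun setT (fun s => 2 * sqnorm (A s)) by exact: measurable_funM.
have mB2 : measurable_fun setT (fun s => 2 * sqnorm (B s)) by exact: measurable_funM.
pose f s := ((2 * sqnorm (A s) + 2 * sqnorm (B s))%:E : \bar R).
have mf : measurable_fun setT f.
  by apply/measurable_EFinP; apply: measurable_funD; exact: measurable_funM.
have f0 s : (0 <= f s)%E by rewrite lee_fin addr_ge0// mulr_ge0// sqnorm_ge0.
apply: (@le_trans _ _ (\int[mu]_(s in `]r 0%N, r m]) f s)%E).
  apply: sum_cells_le_integral => //.
  - by move=> l lm; exact/ltW/rstrict.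
  - by move=> i; exact: sqnorm_ge0.
  - move=> i s im hs; rewrite /f lee_fin.
    rewrite -(sp_eval_cell w ophi im hs) -(sp_eval_cell w opsi im hs).
    rewrite (_ : _ - _ = B s - A s); last by rewrite /A /B opprB [RHS]addrC addrA subrK.
    by rewrite [leRHS]addrC; exact: sqnorm_sub_le.
apply: (@le_trans _ _ (\int[mu]_(s in `[0%R, r m]) f s)%E).
  apply: ge0_subset_integral => //; first exact: measurable_funS mf.
  by rewrite r0; apply: subset_itv_oc_cc.
rewrite !sq_errorE /f; under eq_integral do rewrite EFinD !EFinM.
rewrite ge0_integralD//=; last 4 first.
- by move=> s _; rewrite -EFinM lee_fin mulr_ge0// sqnorm_ge0.
- by apply/measurable_EFinP; apply: measurable_funS mA2.
- by move=> s _; rewrite -EFinM lee_fin mulr_ge0// sqnorm_ge0.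
- by apply/measurable_EFinP; apply: measurable_funS mB2.
rewrite !ge0_integralZl//.
- by apply/measurable_EFinP; apply: measurable_funS mB.
- by move=> s _; rewrite lee_fin sqnorm_ge0.
- by apply/measurable_EFinP; apply: measurable_funS mA.
- by move=> s _; rewrite lee_fin sqnorm_ge0.
Qed.

End FixedPartition.

Lemma merge_partition (s : R) (L : seq R) : 0 < s ->
  (forall x, x \in L -> 0 <= x <= s) ->
  exists (r : nat -> R) (m : nat),
    [/\ r 0%N = 0, r m = s, forall l, r l <= r l.+1,
        forall l, (l < m)%N -> r l < r l.+1 &
        forall x, x \in L -> exists2 p, (p <= m)%N & x = r p].
Proof.
move=> s0 hL; pose S := sort <=%R (undup [:: 0, s & L]).
have S_mem x : (x \in S) = (x \in [:: 0, s & L]) by rewrite mem_sort mem_undup.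
have S_lt : sorted <%R S by rewrite sort_lt_sorted undup_uniq.
have S_itv x : x \in S -> 0 <= x <= s.
  by rewrite S_mem !inE => /or3P[/eqP ->|/eqP ->|/hL//]; rewrite ?lexx ltW.
have S_ltn := lt_sorted_ltn_nth s S_lt.
have sz : (0 < size S)%N.
  rewrite lt0n; apply/eqP => /size0nil S0.
  by have : 0 \in S; [rewrite S_mem inE eqxx|rewrite S0].
(* With default value [s] the sequence stays at [s] after index [m]: it is nondecreasing on all of
   [nat], but strictly increasing only up to [m]. *)
pose r l := nth s S l; pose m := (size S).-1.
have mS : m.+1 = size S by rewrite /m prednK.
have r_lt i j : (j <= m)%N -> (i < j)%N -> r i < r j.
  move=> jm ij; rewrite /r S_ltn// inE -mS ltnS//.
  exact: leq_trans (ltnW ij) jm.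
have r_idx x : x \in S -> exists2 p, (p <= m)%N & x = r p.
  by move=> xS; exists (index x S); rewrite ?/r ?nth_index// -ltnS mS index_mem.
have r_S p : (p <= m)%N -> r p \in S by move=> pm; rewrite mem_nth// -mS.
exists r, m; split.
- have [p pm p0] := r_idx 0 (eqbRL (S_mem 0) (mem_head _ _)).
  case: p pm p0 => // p pm p0; have := r_lt 0%N p.+1 pm isT.
  by rewrite -p0 ltNge; have /andP[-> _] := S_itv _ (r_S 0%N isT).
- have sS : s \in S by rewrite S_mem !inE eqxx orbT.
  have [p pm ps] := r_idx s sS.
  move: pm; rewrite leq_eqVlt => /predU1P[<-//|pm].
  have := r_lt p m (leqnn m) pm; rewrite -ps ltNge.
  by have /andP[_ ->] := S_itv _ (r_S m (leqnn m)).
- move=> l; case: (ltnP l m) => lm; first exact/ltW/r_lt.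
  have -> : r l.+1 = s by rewrite /r nth_default// -mS ltnS.
  move: lm; rewrite leq_eqVlt => /predU1P[<-|lm].
    by have /andP[] := S_itv _ (r_S m (leqnn m)).
  by rewrite /r nth_default// -mS.
- by move=> l lm; exact: r_lt.
- by move=> x xL; apply: r_idx; rewrite S_mem !inE xL !orbT.
Qed.

End Partitions.

(** * Tools for convergence in probability *)

Section Probability.
Context {R : realType} {d : measure_display} {T : measurableType d}.
Variable P : probability T R.

Lemma measurable_elevel (f : T -> \bar R) (c : \bar R) :
  measurable_fun setT f -> measurable [set w | (c <= f w)%E].
Proof. by move=> mf; rewrite -[X in measurable X]setTI; exact: emeasurable_fun_c_infty. Qed.

Lemma cvg0_small (u : nat -> \bar R) (e : R) :
  u @ \oo --> (0 : \bar R) -> 0 < e -> exists n0, forall n, (n0 <= n)%N -> (u n <= e%:E)%E.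
Proof.
move=> /fine_cvgP[ufin /cvgr0Pnorm_lt /(_ e)] + e0; move=> /(_ e0) h.
have [n0 _ hn0] : \forall n \near \oo, (u n <= e%:E)%E.
  near=> n.
  have fn : u n \is a fin_num by near: n.
  rewrite -(fineK fn) lee_fin; apply: le_trans (ler_norm _) _; apply: ltW.
  by near: n.
by exists n0 => n nn0; exact: hn0.
Unshelve. all: by end_near. Qed.

(** The indicators of [A n] tend to 0 pointwise and are dominated by 1. *)
Lemma probability_eventually_out (A : nat -> set T) (e : R) :
  (forall n, measurable (A n)) ->
  (forall w, exists n0, forall n, (n0 <= n)%N -> ~ A n w) -> 0 < e ->
  exists n0, forall n, (n0 <= n)%N -> (P (A n) <= e%:E)%E.
Proof.
move=> mA hA e0; apply: cvg0_small => //.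
have := @dominated_cvg _ _ _ P setT measurableT (fun n w => (\1_(A n) w)%:E)
  (cst 0%E) (EFin \o cst 1).
rewrite integral0 => h.
apply: cvg_trans (h _ _ _ _ _).
- apply: near_eq_cvg; near=> n; by rewrite integral_indic// setIT.
- by move=> n; exact/measurable_EFinP/measurable_indic.
- move=> w _; apply: cvg_near_cst; have [n0 hn0] := hA w.
  near=> n; rewrite indicE memNset//; apply: hn0.
  by near: n; exact: nbhs_infty_ge.
- by [].
- exact: finite_measure_integrable_cst.
- by move=> n w _ /=; rewrite lee_fin indicE; case: (_ \in _); rewrite ?normr1 ?normr0.
Unshelve. all: by end_near. Qed.

Lemma probability_le_ae (A B C : set T) : measurable A -> measurable B -> measurable C ->
  {ae P, forall w, A w -> B w \/ C w} -> (P A <= P B + P C)%E.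
Proof.
move=> mA mB mC [Z [mZ PZ hZ]].
apply: (@le_trans _ _ (P (Z `|` (B `|` C)))).
  apply: le_measure; rewrite ?inE//; first by do 2 apply: measurableU => //.
  move=> w Aw; case: (pselect (Z w)) => Zw; [by left|right].
  by apply: contrapT => h; apply: Zw; apply: hZ => /= /(_ Aw).
apply: le_trans (measureU2 P mZ (measurableU _ _ mB mC)) _.
apply: (@le_trans _ _ (0 + (P B + P C))%E); last by rewrite add0e.
apply: leeD; last exact: measureU2.
suff : (P Z <= 0)%E by [].
by rewrite [P Z]PZ.
Qed.

End Probability.

(** * Grid approximation of a continuous process *)

Section Grid.
Context {R : realType} {N : nat} {d : measure_display} {T : measurableType d}.
Variable P : probability T R.
Notation mu := (@lebesgue_measure R).
Implicit Types X : R -> T -> 'M[R[i]]_N.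

(** Each cell carries the value at its left end, which keeps the process adapted. *)
Definition grid_process X (h : R) (n : nat) : @simple_process R N d T :=
  SimpleProcess n (fun j => j%:R * h) (fun j w => X (j%:R * h) w).

Lemma sp_eval_grid X h n j s w : 0 < h -> (j < n)%N -> j%:R * h < s <= j.+1%:R * h ->
  sp_eval (grid_process X h n) s w = X (j%:R * h) w.
Proof.
move=> h0 jn js; rewrite /sp_eval /= big_mkord (bigD1 (Ordinal jn))//= js.
rewrite big1 ?addr0// => i /eqP ij; case: ifP => // /andP[i1 i2].
have /andP[j1 j2] := js; exfalso; apply: ij; apply/val_inj => /=.
have := lt_le_trans i1 j2; rewrite ltr_pM2r// ltr_nat ltnS => ij.
have := lt_le_trans j1 i2; rewrite ltr_pM2r// ltr_nat ltnS => ji.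
by apply/eqP; rewrite eqn_leq ij.
Qed.

Lemma grid_cell (h s : R) (n : nat) : 0 < s -> s <= n%:R * h ->
  exists2 j, (j < n)%N & j%:R * h < s <= j.+1%:R * h.
Proof.
move=> s0; elim: n => [|n ih sn]; first by rewrite mul0r leNgt s0.
have [sn'|sn'] := leP s (n%:R * h); last by exists n => //; rewrite sn'.
by have [j jn hj] := ih sn'; exists j => //; exact: ltnW.
Qed.

Lemma mx_path_uniform X w (t e : R) : mx_continuous_paths X -> 0 < e ->
  exists2 del : R, 0 < del & forall x y, 0 <= x <= t -> 0 <= y <= t ->
    `|x - y| < del -> sqnorm (X x w - X y w) <= e.
Proof.
move=> cX e0.
pose K := ('I_N * 'I_N * bool)%type.
(* One more than the number of real coordinates, so that [c] is positive even for [N = 0]. *)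
pose c : R := #|{: K}|.+1%:R.
have ec : 0 < e / c by rewrite divr_gt0.
have c1 : 1 <= c by rewrite ler1n.
have [del del0 hdel] : exists2 del : R, 0 < del & forall k : K, k \in enum {: K} ->
    forall x y, 0 <= x <= t -> 0 <= y <= t -> `|x - y| < del ->
    mx_coord k (X x w - X y w) ^+ 2 <= e / c.
  elim: (enum _) => [|k L [del del0 ih]]; first by exists 1.
  (* A real number bounded by both 1 and [e / c] has its square bounded by [e / c]. *)
  pose a := Num.min 1 (e / c).
  have a0 : 0 < a by rewrite lt_min ltr01.
  have [del' del'0 h'] := within_uniform_continuous t (cX w k) a0.
  exists (Num.min del del'); first by rewrite lt_min del0.
  move=> k'; rewrite inE => /predU1P[->|k'L] x y x0 y0; rewrite lt_min => /andP[xy xy'].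
    have := h' x y x0 y0 xy'; rewrite lt_min -mx_coordB => /andP[u1 u2].
    rewrite -(real_normK (num_real (mx_coord k _))).
    apply: le_trans (ltW u2); rewrite expr2 -[leRHS]mul1r.
    by rewrite ler_wpM2r// ltW.
  exact: ih.
exists del => // x y x0 y0 xy; rewrite sqnormE.
apply: (@le_trans _ _ (\sum_(k : K) e / c)).
  by apply: ler_sum => k _; apply: hdel => //; rewrite mem_enum.
rewrite sumr_const -mulr_natr -mulrA ger_pMr// mulrC ler_pdivrMr ?(lt_le_trans ltr01)// mul1r.
by rewrite ler_nat.
Qed.

Lemma sp_mfun_grid X h n : mx_path_mfun X -> 0 <= h -> sp_mfun (grid_process X h n).
Proof. by move=> mX h0 j _; apply: mX; rewrite mulr_ge0. Qed.

Lemma grid_sq_error X (s eta e : R) : mx_path_mfun X -> mx_continuous_paths X ->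
  0 < s -> 0 < eta -> 0 < e -> exists n0, forall n, (n0 <= n)%N ->
  (P [set w | (eta%:E <= sq_error X (grid_process X (s / n.+1%:R) n.+1) s w)%E] <= e%:E)%E.
Proof.
move=> mX cX s0 eta0 e0.
have hn0 n : 0 < s / n.+1%:R by rewrite divr_gt0.
pose A n := [set w | (eta%:E <= sq_error X (grid_process X (s / n.+1%:R) n.+1) s w)%E].
apply: (@probability_eventually_out _ _ _ P A) => //.
  move=> n; apply: measurable_elevel; apply: measurable_sq_error => //.
  by apply: sp_mfun_grid => //; exact: ltW.
move=> w.
(* A pointwise bound [eta'] on [[0, s]] gives an integral of at most [eta / 2], strictly below
   [eta]. *)
pose eta' := eta / (2 * s); have eta'0 : 0 < eta' by rewrite divr_gt0// mulr_gt0.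
have [del del0 hdel] := mx_path_uniform w s cX eta'0.
exists (Num.truncn (s / del)) => n nn0; rewrite /A /=; apply/negP; rewrite -ltNge.
have hdeln : s / n.+1%:R < del.
  rewrite ltr_pdivrMr// mulrC -ltr_pdivrMr//.
  by apply: lt_le_trans (truncnS_gt _) _; rewrite ler_nat.
set g := grid_process _ _ _.
have mg : sp_mfun g by apply: sp_mfun_grid => //; exact: ltW.
have mD := mx_mfun_sqnorm (path_diff_mfun w mX cX mg).
(* The point 0 is removed from the domain: the cells are open on the left, so the grid process
   vanishes there and is not close to [X 0]. *)
rewrite sq_errorE -integral_itv_obnd_cbnd; last first.
  by apply/measurable_EFinP; apply: measurable_funS mD.
apply: (@le_lt_trans _ _ (\int[mu]_(u in `]0%R, s]) (cst eta'%:E u))%E).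
  apply: ge0_le_integral => //.
  - by move=> u _; rewrite lee_fin sqnorm_ge0.
  - by apply/measurable_EFinP; apply: measurable_funS mD.
  - move=> u; rewrite /= in_itv /= => /andP[u0 us].
    have us' : u <= n.+1%:R * (s / n.+1%:R) by rewrite mulrC divfK.
    have [j jn hj] := grid_cell u0 us'.
    have /andP[j1 j2] := hj.
    rewrite (sp_eval_grid _ _ (hn0 n) jn hj) (max_idPr (ltW u0)) lee_fin.
    apply: hdel.
    + by rewrite ltW.
    + by rewrite mulr_ge0 ?(ltW (hn0 n))//= (le_trans (ltW j1)).
    + rewrite ger0_norm ?subr_ge0 ?ltW//; apply: le_lt_trans hdeln.
      by rewrite lerBlDl -[X in _ + X]mul1r -mulrDl natr1.
rewrite integral_cst//.
suff -> : (eta'%:E * mu `]0%R, s] = (eta / 2)%:E)%E.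
  by rewrite lte_fin ltr_pdivrMr// ltr_pMr// ltr1n.
have := itv_oc_measure (ltW s0); rewrite subr0 => e1.
transitivity (eta'%:E * s%:E)%E; first by congr (_ * _)%E; exact: e1.
by rewrite -EFinM; congr EFin; rewrite /eta'; field; rewrite gt_eqF.
Qed.

End Grid.

(** * The Euler scheme *)

Section TimeIntegrals.
Context {R : realType} {N : nat} {d : measure_display} {T : measurableType d}.
Notation mu := (@lebesgue_measure R).
Notation sproc := (@simple_process R N d T).
Implicit Types (X : R -> T -> 'M[R[i]]_N) (phi : sproc).

Lemma mx_coord_time_integral (t : R) (x : R -> 'M[R[i]]_N) k :
  mx_coord k (mx_time_integral t x) = \int[mu]_(s in `[0, t]) mx_coord k (x s).
Proof. by case: k => [[i j] []]; rewrite /mx_coord mxE. Qed.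

Record subdivides (s : R) phi : Prop := Subdivides {
  sub_start : sp_time phi 0 = 0;
  sub_end : sp_time phi (sp_size phi) = s;
  sub_mono : forall j, (j < sp_size phi)%N -> sp_time phi j <= sp_time phi j.+1 }.

Lemma subdivides_le s phi i j : subdivides s phi -> (i <= j)%N -> (j <= sp_size phi)%N ->
  sp_time phi i <= sp_time phi j.
Proof.
move=> [_ _ mono]; elim: j => [|j ih]; first by rewrite leqn0 => /eqP ->.
rewrite leq_eqVlt => /predU1P[->//|ij] js.
by apply: le_trans (ih ij (ltnW js)) _; exact: mono.
Qed.

Lemma subdivides_itv s phi j : subdivides s phi -> (j <= sp_size phi)%N ->
  0 <= sp_time phi j <= s.
Proof.
move=> sub js; rewrite -{1}(sub_start sub) -(sub_end sub).
by rewrite !(subdivides_le sub).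
Qed.

Lemma mx_time_integral_sp s phi w : subdivides s phi ->
  (forall k, mu.-integrable `[0, s] (EFin \o (fun u => mx_coord k (sp_eval phi u w)))) /\
  mx_time_integral s (sp_eval phi ^~ w) =
  \sum_(0 <= j < sp_size phi)
    (sp_time phi j.+1 - sp_time phi j)%:C%C *: sp_value phi j w.
Proof.
move=> sub; pose n := sp_size phi.
pose f j k u := if sp_time phi j < u <= sp_time phi j.+1 then mx_coord k (sp_value phi j w) else 0.
have fE k u : mx_coord k (sp_eval phi u w) = \sum_(0 <= j < n) f j k u.
  rewrite /sp_eval mx_coord_sum; apply: eq_bigr => j _.
  by rewrite /f; case: ifP => // _; rewrite mx_coord0.
have step j k : (j < n)%N -> mu.-integrable `[0, s] (EFin \o f j k) /\
    \int[mu]_(u in `[0, s]) f j k u =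
      (sp_time phi j.+1 - sp_time phi j) * mx_coord k (sp_value phi j w).
  move=> jn; have /andP[a0 _] := subdivides_itv sub (ltnW jn).
  have /andP[_ b1] := subdivides_itv sub jn.
  exact: (Rintegral_step _ a0 (sub_mono sub jn) b1).
have main m k : (m <= n)%N ->
    mu.-integrable `[0, s] (EFin \o (fun u => \sum_(0 <= j < m) f j k u)) /\
    \int[mu]_(u in `[0, s]) (\sum_(0 <= j < m) f j k u) =
      \sum_(0 <= j < m) (sp_time phi j.+1 - sp_time phi j) * mx_coord k (sp_value phi j w).
  elim: m => [_|m ih mn].
    rewrite big_geq//; split.
      rewrite (_ : EFin \o _ = cst 0%E); first exact: integrable0.
      by apply/funext => u /=; rewrite big_geq.
    rewrite (eq_Rintegral mu (g := cst 0)); last by move=> u _; rewrite big_geq.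
    by rewrite Rintegral_cst// mul0r.
  have [im em] := ih (ltnW mn); have [i1 e1] := step m k mn.
  split.
    rewrite (_ : EFin \o _ = (EFin \o (fun u => (\sum_(0 <= j < m) f j k u)%R)) \+ (EFin \o f m k))%E.
      exact: integrableD.
    by apply/funext => u /=; rewrite big_nat_recr//= EFinD.
  rewrite (eq_Rintegral mu (g := fun u => \sum_(0 <= j < m) f j k u + f m k u)); last first.
    by move=> u _; rewrite big_nat_recr.
  by rewrite RintegralD// em e1 big_nat_recr.
split=> [k|].
  by have [im _] := main n k (leqnn n); rewrite (funext (fE k)).
apply: mx_coord_ext => k; rewrite mx_coord_time_integral mx_coord_sum.
rewrite (eq_Rintegral mu (g := fun u => \sum_(0 <= j < n) f j k u)); last by move=> u _.
have [_ ->] := main n k (leqnn n).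
by apply: eq_bigr => j _; rewrite mx_coordZ.
Qed.

(** Cauchy-Schwarz in time, applied to each real coordinate; the cardinal counts these
    coordinates. *)
Lemma time_integral_diff X phi (s : R) w (q : R) : 0 < s -> subdivides s phi ->
  mx_path_mfun X -> mx_continuous_paths X -> sp_mfun phi ->
  (sq_error X phi s w <= q%:E)%E ->
  sqnorm (mx_time_integral s (X ^~ w) - mx_time_integral s (sp_eval phi ^~ w)) <=
  #|{: 'I_N * 'I_N * bool}|%:R * (s * q).
Proof.
move=> s0 sub mX cX mphi hq.
have [iphi _] := mx_time_integral_sp w sub.
rewrite sqnormE (_ : _%:R * _ = \sum_(k : 'I_N * 'I_N * bool) s * q); last first.
  by rewrite sumr_const mulr_natl.
apply: ler_sum => k _; rewrite mx_coordB !mx_coord_time_integral.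
pose f u := mx_coord k (X (Num.max 0 u) w - sp_eval phi u w).
have mf : measurable_fun setT f by exact: (path_diff_mfun w mX cX mphi k).
have mfD : measurable_fun `[0, s] f by exact: measurable_funS mf.
have hf : (\int[mu]_(u in `[0%R, s]) (f u ^+ 2)%:E <= q%:E)%E.
  apply: le_trans hq; rewrite sq_errorE; apply: ge0_le_integral => //.
  - by move=> u _; rewrite lee_fin sqr_ge0.
  - by apply/measurable_EFinP; exact: measurable_funX.
  - apply/measurable_EFinP.
    by apply: measurable_funS (mx_mfun_sqnorm (path_diff_mfun w mX cX mphi)).
  - by move=> u _; rewrite lee_fin; exact: mx_coord_sqr_le.
have [if1 le1] := sqr_Rintegral_le s0 mfD (le_lt_trans hf (ltry _)).
have -> : \int[mu]_(u in `[0, s]) mx_coord k (X u w) =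
    \int[mu]_(u in `[0, s]) (f u + mx_coord k (sp_eval phi u w)).
  apply: eq_Rintegral => u; rewrite inE /= in_itv /= => /andP[u0 _].
  by rewrite /f (max_idPr u0) mx_coordB subrK.
rewrite RintegralD// addrK; apply: le_trans le1 _; rewrite ler_pM2l// -lee_fin.
rewrite /Rintegral fineK//; apply/fin_numPlt; apply/andP; split.
  by rewrite (lt_le_trans (ltNyr 0))// integral_ge0// => u _; rewrite lee_fin sqr_ge0.
exact: le_lt_trans hf (ltry _).
Qed.

End TimeIntegrals.

(** * Riemann sums of the solution against the integral equation *)

Section EulerDefect.
Context {R : realType} {N : nat} {d : measure_display} {T : measurableType d}.
Variables (P : probability T R) (F : R -> set (set T)) (H U : R -> T -> 'M[R[i]]_N).
Hypothesis hwrt : hermitian_brownian_motion_wrt P F H.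
Hypothesis U_known : forall s, 0 <= s -> mx_known F s (U s).
Hypothesis U_cont : mx_continuous_paths U.
Notation sproc := (@simple_process R N d T).

Let U_mfun : mx_path_mfun U.
Proof. by move=> s s0; exact: (mx_known_mfun hwrt s0 (U_known s0)). Qed.

(* The equation reads dU = (dG) U. *)
Let G (w : T) (s : R) : 'M[R[i]]_N := 'i%C *: H s w - scalar_mx (s / 2)%:C%C.

Lemma step_mx_diff w s t : G w t - G w s = step_mx (t - s) (H t w - H s w).
Proof.
have e : scalar_mx ((t - s) / 2)%:C%C =
    scalar_mx (t / 2)%:C%C - scalar_mx (s / 2)%:C%C :> 'M[R[i]]_N.
  by rewrite mulrBl rmorphB /= raddfB.
rewrite /G /step_mx e scalerBr !opprB addrACA [RHS]addrACA.
by congr (_ + _); exact: addrC.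
Qed.

(** The residual of the integral equation at time [n h] when both integrals are replaced by
    left-point sums of [U] itself, as opposed to sums of the scheme. *)
Definition euler_defect (h : R) (n : nat) (w : T) : 'M[R[i]]_N :=
  U (n%:R * h) w - 1%:M - \sum_(0 <= j < n)
    step_mx h (H (j.+1%:R * h) w - H (j%:R * h) w) *m U (j%:R * h) w.

Definition sp_known (phi : sproc) := forall j, (j < sp_size phi)%N ->
  mx_known F (sp_time phi j) (sp_value phi j).

Lemma sp_known_mfun s phi : subdivides s phi -> sp_known phi -> sp_mfun phi.
Proof.
move=> sub kphi j js; apply: (mx_known_mfun hwrt _ (kphi j js)).
by have /andP[] := subdivides_itv sub (ltnW js).
Qed.

(** Predictability: a piece active at [r l.+1] starts strictly before it, hence, starting at a point
    of the partition, no later than [r l]. *)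
Lemma sp_eval_known r m s phi l :
  (forall l, (l < m)%N -> r l < r l.+1) -> on_partition r m phi -> subdivides s phi ->
  sp_known phi -> (l < m)%N -> mx_known F (r l) (fun w => sp_eval phi (r l.+1) w).
Proof.
move=> rstrict onp sub kphi lm; apply: (@mx_mfun_sum_nat _ _ (g_sigma_algebraType (F (r l))) _ _ _ (fun j w =>
  if sp_time phi j < r l.+1 <= sp_time phi j.+1 then sp_value phi j w else 0)) => j jphi.
case hc : (_ < _ <= _); last exact: mx_mfun_cst.
case/andP: hc => h _.
have [p pm tp] := onp j (ltnW jphi).
have /andP[t0 _] := subdivides_itv sub (ltnW jphi).
apply: (mx_known_le hwrt t0 _ (kphi j jphi)).
have lm' : (l <= m)%N := ltnW lm.
by move: h; rewrite tp (partition_ltE rstrict)// ltnS => pl; rewrite (partition_leE rstrict).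
Qed.

Lemma subdivides_grid h n : 0 <= h -> subdivides (n%:R * h) (grid_process U h n).
Proof.
by move=> h0; split => /=; rewrite ?mul0r// => j _; rewrite ler_wpM2r// ler_nat.
Qed.

Lemma sp_known_grid h n : 0 <= h -> sp_known (grid_process U h n).
Proof. by move=> h0 j _ /=; apply: U_known; rewrite mulr_ge0. Qed.

Lemma sp_integral_step s phi w : subdivides s phi ->
  \sum_(0 <= j < sp_size phi)
    (G w (sp_time phi j.+1) - G w (sp_time phi j)) *m sp_value phi j w =
  'i%C *: sp_integral H phi w - (2^-1)%:C%C *: mx_time_integral s (sp_eval phi ^~ w).
Proof.
move=> sub; have [_ ->] := mx_time_integral_sp w sub.
rewrite /sp_integral !scaler_sumr -sumrB; apply: eq_bigr => j _.
rewrite step_mx_diff step_mxE scalerA -rmorphM; congr (_ - _%:C%C *: _).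
by rewrite mulrC.
Qed.

(* On a partition refining those of [phi] and of the grid, the stochastic sum of
   [phi] minus that of the grid is driven by the difference of the two processes,
   which is small because both approach [U]. *)
Lemma euler_defect_bound s h n phi (J : T -> 'M[R[i]]_N) (eps eta : R) :
  0 < h -> (0 < n)%N -> n%:R * h = s -> subdivides s phi -> sp_known phi ->
  random_mx J ->
  {ae P, forall w, U s w =
     1%:M + 'i%C *: J w - 2^-1 *: mx_time_integral s (U ^~ w)} ->
  0 < eps -> 0 < eta ->
  (P [set w | (eps <= sqnorm (euler_defect h n w))%R] <=
   ((P [set w | ((eta / 4)%:E <= sq_error U phi s w)%E] +
     P [set w | ((eta / 4)%:E <= sq_error U (grid_process U h n) s w)%E]) +
     (@gronwall_cst R N s * eta / (eps / 6))%:E) +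
   (P [set w | ((eps / 12)%:E <= (sqnorm (sp_integral H phi w - J w))%:E)%E] +
    P [set w | ((eps / (3 * (#|{: 'I_N * 'I_N * bool}|.+1%:R * s)))%:E <= sq_error U phi s w)%E]))%E.
Proof.
move=> h0 n0 nhs sub kphi /random_mxP mJ sde eps0 eta0.
have s0 : 0 < s by rewrite -nhs mulr_gt0// ltr0n.
pose g := grid_process U h n.
have subg : subdivides s g by rewrite -nhs; exact/subdivides_grid/ltW.
have kg : sp_known g by apply: sp_known_grid; exact: ltW.
have mphi := sp_known_mfun sub kphi; have mg := sp_known_mfun subg kg.
pose L := [seq sp_time phi j | j <- iota 0 (sp_size phi).+1] ++
          [seq sp_time g j | j <- iota 0 (sp_size g).+1].
have hL x : x \in L -> 0 <= x <= s.
  rewrite mem_cat => /orP[] /mapP[j]; rewrite mem_iota add0n ltnS => /= js ->.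
    exact: (subdivides_itv sub).
  exact: (subdivides_itv subg).
have [r [m [r0 rm rmono rstrict rL]]] := merge_partition s0 hL.
have ophi : on_partition r m phi.
  move=> j js; apply: rL; rewrite mem_cat; apply/orP; left.
  by apply/mapP; exists j => //; rewrite mem_iota add0n ltnS.
have og : on_partition r m g.
  move=> j js; apply: rL; rewrite mem_cat; apply/orP; right.
  by apply/mapP; exists j => //; rewrite mem_iota add0n ltnS.
pose Phi l w := if (l < m)%N then sp_eval phi (r l.+1) w - sp_eval g (r l.+1) w else 0.
have kPhi l : mx_known F (r l) (Phi l).
  rewrite /Phi; case lm : (l < m)%N; last exact: mx_mfun_cst.
  apply: mx_mfunB; first exact: (sp_eval_known rstrict ophi sub).
  exact: (sp_eval_known rstrict og subg).
(* With the feedback switched off, [X] is just the stochastic sum of the difference [Phi]. *)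
have [X dX] := driven_by_exists H r false (fun l => leqnn l) Phi.
have r00 : 0 <= r 0%N by rewrite r0.
have rms : r m <= s by rewrite rm.
have XE w : X m w = \sum_(0 <= j < sp_size phi)
      (G w (sp_time phi j.+1) - G w (sp_time phi j)) *m sp_value phi j w -
    \sum_(0 <= j < n)
      step_mx h (H (j.+1%:R * h) w - H (j%:R * h) w) *m U (j%:R * h) w.
  have XS l : X l w = \sum_(0 <= i < l) (G w (r i.+1) - G w (r i)) *m Phi i w.
    have [X0 XS] := dX; elim: l => [|l ih]; first by rewrite X0 big_geq.
    by rewrite XS big_nat_recr//= -ih add0r step_mx_diff.
  have -> : \sum_(0 <= j < n) step_mx h (H (j.+1%:R * h) w - H (j%:R * h) w) *m U (j%:R * h) w =
      \sum_(0 <= i < m) (G w (r i.+1) - G w (r i)) *m sp_eval g (r i.+1) w.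
    rewrite (sp_sum_partition rstrict _ _ og (sub_mono subg)) /=.
    apply: eq_bigr => j _; rewrite step_mx_diff; congr (step_mx _ _ *m _).
    by rewrite -natr1 mulrDl mul1r addrC addKr.
  rewrite -(sp_sum_partition rstrict _ _ ophi (sub_mono sub)) XS -sumrB !big_nat.
  by apply: eq_bigr => i /andP[_ im]; rewrite /Phi im mulmxBr.
have half : 2^-1 = (2^-1)%:C%C :> R[i] by rewrite rmorphV ?unitfE//= rmorph_nat.
pose K1 : R := #|{: 'I_N * 'I_N * bool}|.+1%:R.
pose B := [set w | eps / 6 <= sqnorm (X m w)].
pose C1 := [set w | ((eps / 12)%:E <= (sqnorm (sp_integral H phi w - J w))%:E)%E].
pose C2 := [set w | ((eps / (3 * (K1 * s)))%:E <= sq_error U phi s w)%E].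
have kX := driven_by_known hwrt r00 rmono (fun l => leqnn l) dX kPhi.
have rm0 : 0 <= r m by rewrite rm ltW.
have mXm := mx_known_mfun hwrt rm0 (kX m).
have H_mfun u : 0 <= u -> mx_mfun (H u).
  by move=> u0; exact: (mx_known_mfun hwrt u0 (hbm_known hwrt u0)).
have mint : mx_mfun (sp_integral H phi).
  apply: mx_mfun_sum_nat => j jphi.
  have /andP[a0 _] := subdivides_itv sub (ltnW jphi).
  have /andP[b0 _] := subdivides_itv sub jphi.
  apply: mx_mfunM; last exact: mphi.
  by apply: mx_mfunB; exact: H_mfun.
have merr c psi' : sp_mfun psi' -> measurable [set w | (c <= sq_error U psi' s w)%E].
  by move=> mpsi; apply: measurable_elevel; exact: measurable_sq_error.
have mA : measurable [set w | eps <= sqnorm (euler_defect h n w)].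
  apply: measurable_level; apply: mx_mfun_sqnorm; apply: mx_mfunB.
    apply: mx_mfunB; last exact: mx_mfun_cst.
    by rewrite nhs; apply: U_mfun; exact: ltW.
  apply: mx_mfun_sum => j; have j0 k : 0 <= k%:R * h by rewrite mulr_ge0// ltW.
  apply: mx_mfunM; last exact: U_mfun.
  apply: mx_mfunB; last exact: mx_mfun_cst.
  by apply: mx_mfuniZ; apply: mx_mfunB; exact: H_mfun.
have mB : measurable B by apply: measurable_level; exact: mx_mfun_sqnorm.
have mC1 : measurable C1.
  apply: measurable_elevel; apply/measurable_EFinP; apply: mx_mfun_sqnorm.
  exact: mx_mfunB.
have mC2 : measurable C2 by exact: merr.
have main : {ae P, forall w, [set w | eps <= sqnorm (euler_defect h n w)] w ->
    B w \/ (C1 `|` C2) w}.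
  case: sde => Z [mZ PZ hZ]; exists Z; split=> // w hw; apply: hZ => /= e.
  apply: hw => /= hD; apply: contrapT => /not_orP[hB /not_orP[hC1 hC2]].
  move/negP: hB; rewrite -ltNge => hB.
  move/negP: hC1; rewrite -ltNge lte_fin => hC1.
  move/negP: hC2; rewrite -ltNge => hC2.
  have := time_integral_diff s0 sub U_mfun U_cont mphi (ltW hC2).
  set V := mx_time_integral s (U ^~ w) - _ => hV.
  (* The squared norm of the defect is at most [2 |X|^2 + 4 |I - J|^2 + |V|^2], where [I] is the
     integral of [phi]. The thresholds [eps / 6], [eps / 12] and [eps / 3] make each of the three
     terms at most [eps / 3]. *)
  have DE : euler_defect h n w = X m w -
      ('i%C *: (sp_integral H phi w - J w) + (2^-1)%:C%C *: V).
    rewrite /euler_defect nhs e XE (sp_integral_step w sub) /V half.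
    move: (sp_integral H phi w) (J w) (mx_time_integral s _) (mx_time_integral s _) => I' J' A1 A2.
    move: (\sum_(0 <= j < n) _) => S.
    by apply/matrixP => x y; rewrite !mxE; ring.
  have {}hV : sqnorm V <= eps / 3.
    apply: le_trans hV _.
    have -> : eps / 3 = K1 * (s * (eps / (3 * (K1 * s)))).
      by field; rewrite !gt_eqF.
    rewrite ler_wpM2r ?ler_nat// mulr_ge0 ?ltW// divr_gt0// mulr_gt0// mulr_gt0//.
  move: hD; rewrite DE.
  have := sqnorm_sub_le (X m w) ('i%C *: (sp_integral H phi w - J w) + (2^-1)%:C%C *: V).
  have := sqnorm_add_le ('i%C *: (sp_integral H phi w - J w)) ((2^-1)%:C%C *: V).
  rewrite sqnormiZ sqnormZ; lra.
apply: le_trans (probability_le_ae mA mB (measurableU _ _ mC1 mC2) main) _.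
apply: leeD; last exact: measureU2.
have eps60 : 0 < eps / 6 by rewrite divr_gt0.
apply: le_trans (gronwall_in_probability hwrt r00 rmono rstrict rms (fun l => leqnn l) dX kPhi eps60 eta0) _.
apply: leeD => //.
(* Outside both events [cells_le_sq_error] bounds the weighted sum by
   [2 eta / 4 + 2 eta / 4 = eta]. *)
apply: (@le_trans _ _ (P ([set w | ((eta / 4)%:E <= sq_error U phi s w)%E] `|`
    [set w | ((eta / 4)%:E <= sq_error U g s w)%E]))); last first.
  by apply: measureU2; exact: merr.
apply: le_measure; rewrite ?inE.
- have mPhi l : mx_mfun (Phi l).
    have rl0 : 0 <= r l by rewrite -r0; apply: ((nondecreasing_seqP r).1 rmono).
    exact: (mx_known_mfun hwrt rl0 (kPhi l)).
  apply: measurable_strict_level; apply: measurable_sum => l.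
  by apply: measurable_funM => //; exact: mx_mfun_sqnorm.
- by apply: measurableU; exact: merr.
- move=> w /= hw; apply: contrapT => /not_orP[/negP + /negP].
  rewrite -!ltNge => h1 h2.
  have := cells_le_sq_error rstrict w r0 U_mfun U_cont mphi mg ophi og.
  rewrite rm (_ : \sum_(0 <= i < m) _ = \sum_(0 <= l < m) (r l.+1 - r l) * sqnorm (Phi l w)); last first.
    by rewrite !big_nat; apply: eq_bigr => l /andP[_ lm]; rewrite /Phi lm.
  move: h1 h2 hw.
  have : (0 <= sq_error U phi s w)%E by apply: integral_ge0 => u _; rewrite lee_fin sqnorm_ge0.
  have : (0 <= sq_error U g s w)%E by apply: integral_ge0 => u _; rewrite lee_fin sqnorm_ge0.
  case: (sq_error U phi s w) => [x||]//; case: (sq_error U g s w) => [y||]//.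
  rewrite -!EFinM -EFinD !lte_fin !lee_fin; lra.
Qed.

End EulerDefect.

(** * Convergence of the Euler scheme in probability *)

Section EulerConvergence.
Context {R : realType} {N : nat} {d : measure_display} {T : measurableType d}.
Variables (P : probability T R) (F : R -> set (set T)) (H U : R -> T -> 'M[R[i]]_N).
Hypothesis hwrt : hermitian_brownian_motion_wrt P F H.
Hypothesis U_known : forall s, 0 <= s -> mx_known F s (U s).
Hypothesis U_cont : mx_continuous_paths U.
Hypothesis U_start : forall w, U 0 w = 1%:M.
Hypothesis U_sde : unitary_sde P F H U.

Let U_mfun : mx_path_mfun U.
Proof. by move=> s s0; exact: (mx_known_mfun hwrt s0 (U_known s0)). Qed.

Lemma gronwall_cst_small (s eps e : R) : 0 <= s -> 0 < eps -> 0 < e ->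
  exists2 eta : R, 0 < eta & @gronwall_cst R N s * eta / eps <= e.
Proof.
move=> s0 eps0 e0; pose c := `|@gronwall_cst R N s| + 1.
have c0 : 0 < c by rewrite ltr_wpDl.
exists (e * eps / c); first by rewrite divr_gt0// mulr_gt0.
rewrite ler_pdivrMr// mulrCA; apply: ler_piMr; first by rewrite ltW// mulr_gt0.
rewrite ler_pdivrMr// mul1r.
by rewrite /c (le_trans (ler_norm _))// lerDl.
Qed.

(** The defect does not depend on the approximating processes [phi k]: they enter only the bound, so
    [n0] is dictated by the grid alone and [k] may be taken as large as needed afterwards. The five
    terms of the bound get [e / 5] each. *)
Lemma euler_defect_cvg (s eps e : R) : 0 < s -> 0 < eps -> 0 < e ->
  exists n0, forall n, (n0 <= n)%N ->
  (P [set w | (eps <= sqnorm (euler_defect H U (s / n.+1%:R) n.+1 w))%R] <= e%:E)%E.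
Proof.
move=> s0 eps0 e0; have [J [mJ [phi [aphi cphi cJ]] sde]] := U_sde (ltW s0).
have e50 : 0 < e / 5 by rewrite divr_gt0.
have eps60 : 0 < eps / 6 by rewrite divr_gt0.
have eps12 : 0 < eps / 12 by rewrite divr_gt0.
have [eta eta0 heta] := gronwall_cst_small (ltW s0) eps60 e50.
have eta40 : 0 < eta / 4 by rewrite divr_gt0.
have [n0 hn0] := grid_sq_error P U_mfun U_cont s0 eta40 e50.
exists n0 => n nn0.
set c3 := eps / (3 * (#|{: 'I_N * 'I_N * bool}|.+1%:R * s)).
have c30 : 0 < c3 by rewrite divr_gt0// !mulr_gt0.
have [k1 hk1] := cvg0_small (cphi _ eta40) e50.
have [k2 hk2] := cvg0_small (cJ _ eps12) e50.
have [k3 hk3] := cvg0_small (cphi _ c30) e50.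
pose k := maxn k1 (maxn k2 k3).
have sub : subdivides s (phi k) by split; [case: (aphi k)..].
have kphi : sp_known F (phi k).
  move=> j js; have /andP[t0 _] := subdivides_itv sub (ltnW js).
  by apply/(mx_knownP hwrt _ t0); exact: (adm_adapted (aphi k)).
have h0 : 0 < s / n.+1%:R by rewrite divr_gt0.
have nh : n.+1%:R * (s / n.+1%:R) = s by rewrite mulrC divfK.
apply: le_trans (euler_defect_bound hwrt U_known U_cont h0 (ltn0Sn n) nh sub kphi mJ sde eps0 eta0) _.
rewrite (_ : e = ((e / 5 + e / 5) + e / 5) + (e / 5 + e / 5)); last by field.
rewrite !EFinD; apply: leeD; first apply: leeD; first apply: leeD.
- by apply: hk1; rewrite leq_max leqnn.
- exact: hn0.
- by rewrite lee_fin.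
- apply: leeD; first by apply: hk2; rewrite !leq_max leqnn orbT.
  by apply: hk3; rewrite !leq_max leqnn !orbT.
Qed.

Let H_mfun : mx_path_mfun H.
Proof. by move=> u u0; exact: (mx_known_mfun hwrt u0 (hbm_known hwrt u0)). Qed.

Lemma euler_defect_mfun k j : 0 <= k -> mx_mfun (euler_defect H U k j).
Proof.
move=> k0; have jk0 i : 0 <= i%:R * k by rewrite mulr_ge0.
apply: mx_mfunB.
  by apply: mx_mfunB; [exact: U_mfun|exact: mx_mfun_cst].
apply: mx_mfun_sum => i; apply: mx_mfunM; last exact: U_mfun.
apply: mx_mfunB; last exact: mx_mfun_cst.
by apply: mx_mfuniZ; apply: mx_mfunB; exact: H_mfun.
Qed.

Definition euler (x : R -> 'M[R[i]]_N) (h : R) : nat -> 'M[R[i]]_N :=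
  fix E n := if n is n'.+1 then
    E n' + step_mx h (x (n'.+1%:R * h) - x (n'%:R * h)) *m E n' else 1%:M.

Arguments euler : simpl never.

Lemma eulerS x h n : euler x h n.+1 =
  euler x h n + step_mx h (x (n.+1%:R * h) - x (n%:R * h)) *m euler x h n.
Proof. by []. Qed.

Lemma euler_mfun (X : R -> T -> 'M[R[i]]_N) h n : 0 <= h -> mx_path_mfun X ->
  mx_mfun (fun w => euler (X ^~ w) h n).
Proof.
move=> h0 mX; elim: n => [|n ih]; first exact: mx_mfun_cst.
have j0 k : 0 <= k%:R * h by rewrite mulr_ge0.
apply: mx_mfunD => //=; apply: mx_mfunM => //.
apply: mx_mfunB; last exact: mx_mfun_cst.
by apply: mx_mfuniZ; apply: mx_mfunB; exact: mX.
Qed.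

Section ErrorBound.
Variables (t h : R) (n q : nat).
Hypotheses (h0 : 0 < h) (n0 : (0 < n)%N) (q0 : (0 < q)%N) (nht : n%:R * h = t).
Let k := h / q%:R.
Let r l := l%:R * k.
Let bl l := ((l %/ q) * q)%N.
Let M l w := step_mx k (H (r l.+1) w - H (r l) w).

Let qk : q%:R * k = h.
Proof. by rewrite /k mulrC divfK// pnatr_eq0 -lt0n. Qed.

Let k0 : 0 < k.
Proof. by rewrite divr_gt0// ltr0n. Qed.

Let rq j : r (j * q) = j%:R * h.
Proof. by rewrite /r natrM -mulrA qk. Qed.

Let rm : r (n * q) = t. Proof. by rewrite rq. Qed.

Let t0 : 0 < t. Proof. by rewrite -nht mulr_gt0// ltr0n. Qed.

Let r_ge0 l : 0 <= r l. Proof. by rewrite mulr_ge0// ltW. Qed.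

Let dr l : r l.+1 - r l = k.
Proof. by rewrite /r -natr1 mulrDl mul1r addrC addKr. Qed.

Let rstrict l : r l < r l.+1. Proof. by rewrite -subr_gt0 dr. Qed.

(* The Euler scheme of step [h], interpolated on the grid of step [k]. *)
Let Y w : nat -> 'M[R[i]]_N :=
  fun l => euler (H ^~ w) h (l %/ q) +
    step_mx ((l %% q)%:R * k) (H (r l) w - H (r (bl l)) w) *m euler (H ^~ w) h (l %/ q).

Let Yq w j : Y w (j * q) = euler (H ^~ w) h j.
Proof. by rewrite /Y mulnK// modnMl /bl mulnK// mul0r subrr step_mx0 mul0mx addr0. Qed.

Let Y0 w : Y w 0 = 1%:M. Proof. exact: (Yq w 0). Qed.

(** Inside a coarse cell the increments since its first point add up by [step_mxD]. At the end of
    the cell the accumulated increment is the full coarse one, and the formula becomes one step of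
    the scheme. *)
Let YS w l : Y w l.+1 = Y w l + M l w *m Y w (bl l).
Proof.
rewrite /bl Yq.
have e : Y w l + M l w *m euler (H ^~ w) h (l %/ q) = euler (H ^~ w) h (l %/ q) +
    step_mx ((l %% q).+1%:R * k) (H (r l.+1) w - H (r (bl l)) w) *m euler (H ^~ w) h (l %/ q).
  rewrite /Y -addrA -mulmxDl /M -step_mxD; congr (_ + step_mx _ _ *m _).
    by rewrite -natr1 mulrDl mul1r.
  by rewrite addrC addrA subrK.
rewrite e.
have [hq|hq] := ltnP (l %% q).+1 q.
  have lE : l.+1 = (l %/ q * q + (l %% q).+1)%N by rewrite addnS -divn_eq.
  have d1 : (l.+1 %/ q = l %/ q)%N by rewrite lE divnMDl// (divn_small hq) addn0.
  have m1 : (l.+1 %% q = (l %% q).+1)%N by rewrite lE modnMDl (modn_small hq).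
  by rewrite /Y /bl d1 m1.
have hq' : (l %% q).+1 = q by apply/eqP; rewrite eqn_leq hq ltn_mod q0.
have lE : l.+1 = ((l %/ q).+1 * q)%N.
  by rewrite mulSn addnC -{3}hq' addnS -divn_eq.
by rewrite {1}lE Yq eulerS hq' qk lE !rq.
Qed.

Let Z w l := 1%:M + \sum_(0 <= j < l) M j w *m U (r j) w.

Let defectE w l : euler_defect H U k l w = U (r l) w - Z w l.
Proof. by rewrite /euler_defect /Z opprD addrA. Qed.

Let Phi l w := U (r l) w - U (r (bl l)) w + euler_defect H U k (bl l) w.

Let X l w := Z w l - Y w l.

Let blE l : (bl l <= l)%N. Proof. exact: leq_trunc_div. Qed.

(** Delayed feedback plus forcing telescopes to [U (r l) - Y (bl l)], the difference of the
    integrands of [Z] and [Y]. *)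
Let dX : driven_by H r true bl Phi X.
Proof.
split=> [w|l w]; first by rewrite /X /Z big_geq// Y0 addr0 subrr.
rewrite /X YS dr -/(M l w) /Phi defectE.
have -> : Z w l.+1 = Z w l + M l w *m U (r l) w by rewrite /Z big_nat_recr//= addrA.
move: (Z w l) (Z w (bl l)) (Y w l) (Y w (bl l)) (U _ w) (U _ w) => z z' y y' u' u.
have -> : z' - y' + (u - u' + (u' - z')) = u - y'.
  by apply/matrixP => a b; rewrite !mxE; ring.
by rewrite mulmxBr opprD addrACA.
Qed.

(* Up to the defect at time [t], the error [U - E] is driven on the fine grid, with
   feedback delayed to the last coarse point, by the oscillation of [U] over a
   coarse cell and by the defects at coarse points. *)
Lemma euler_error_bound (eps eta : R) : 0 < eps -> 0 < eta ->
  (P [set w | (eps <= sqnorm (U t w - euler (H ^~ w) h n))%R] <=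
   P [set w | (eps / 4 <= sqnorm (euler_defect H U k (n * q) w))%R] +
   (((P [set w | ((eta / 16)%:E <= sq_error U (grid_process U k (n * q)) t w)%E] +
      P [set w | ((eta / 16)%:E <= sq_error U (grid_process U h n) t w)%E]) +
     \sum_(j < n) P [set w | (eta / (4 * t) <= sqnorm (euler_defect H U k (j * q) w))%R]) +
    (@gronwall_cst R N t * eta / (eps / 4))%:E))%E.
Proof.
move=> eps0 eta0.
have mD j : mx_mfun (euler_defect H U k j).
  by apply: euler_defect_mfun => //; exact: ltW.
have mEu : mx_mfun (fun w => euler (H ^~ w) h n) by apply: euler_mfun => //; exact: ltW.
have split w : U t w - euler (H ^~ w) h n = euler_defect H U k (n * q) w + X (n * q) w.
  by rewrite defectE rm /X Yq addrA subrK.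
have mX : mx_mfun (X (n * q)).
  rewrite (_ : X (n * q) = fun w => (U t w - euler (H ^~ w) h n) - euler_defect H U k (n * q) w).
    by apply: mx_mfunB => //; apply: mx_mfunB => //; apply: U_mfun; exact: ltW.
  by apply/funext => w; rewrite split addrC addKr.
have mA : measurable [set w | eps <= sqnorm (U t w - euler (H ^~ w) h n)].
  apply: measurable_level; apply: mx_mfun_sqnorm; apply: mx_mfunB => //.
  by apply: U_mfun; exact: ltW.
have mC : measurable [set w | eps / 4 <= sqnorm (X (n * q) w)].
  by apply: measurable_level; exact: mx_mfun_sqnorm.
have mB c j : measurable [set w | c <= sqnorm (euler_defect H U k j w)].
  by apply: measurable_level; exact: mx_mfun_sqnorm.
(* The error is the defect at time [t] plus [X (n * q)], and the squared norm of a sum is at most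
   twice the sum of the squared norms. *)
apply: (@le_trans _ _ (P [set w | (eps / 4 <= sqnorm (euler_defect H U k (n * q) w))%R] +
    P [set w | (eps / 4 <= sqnorm (X (n * q) w))%R])%E).
  apply: probability_le_ae => //; apply: aeW => w /=; rewrite split => hw.
  apply: contrapT => /not_orP[/negP + /negP]; rewrite -!ltNge => h1 h2.
  have := sqnorm_add_le (euler_defect H U k (n * q) w) (X (n * q) w); lra.
apply: leeD => //.
have kPhi l : mx_known F (r l) (Phi l).
  have kU j : (j <= l)%N -> mx_known F (r l) (U (r j)).
    move=> jl; apply: (mx_known_le hwrt (r_ge0 j)); last exact: U_known.
    by rewrite ler_wpM2r ?ler_nat// ltW.
  have kH j : (j <= l)%N -> mx_known F (r l) (H (r j)).
    move=> jl; apply: (mx_known_le hwrt (r_ge0 j)).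
      by rewrite ler_wpM2r ?ler_nat// ltW.
    exact: (hbm_known hwrt (r_ge0 j)).
  apply: mx_mfunD; first by apply: mx_mfunB; exact: kU.
  apply: mx_mfunB.
    by apply: mx_mfunB; [exact: kU|exact: mx_mfun_cst].
  apply: (@mx_mfun_sum_nat _ _ (g_sigma_algebraType (F (r l))) _ _ _ (fun j w =>
     step_mx k (H (r j.+1) w - H (r j) w) *m U (r j) w)) => j jl.
  have jl' : (j < l)%N := leq_trans jl (blE l).
  apply: mx_mfunM; last by apply: kU; exact: ltnW.
  apply: mx_mfunB; last exact: mx_mfun_cst.
  by apply: mx_mfuniZ; apply: mx_mfunB; apply: kH => //; exact: ltnW.
have rmt : r (n * q) <= t by rewrite rm.
have eps40 : 0 < eps / 4 by rewrite divr_gt0.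
have rmono l : r l <= r l.+1 by exact/ltW.
have := gronwall_in_probability hwrt (r_ge0 0) rmono (fun l _ => rstrict l) rmt
  blE dX kPhi eps40 eta0.
move/le_trans; apply; apply: leeD => //.
pose S1 := [set w | ((eta / 16)%:E <= sq_error U (grid_process U k (n * q)) t w)%E].
pose S2 := [set w | ((eta / 16)%:E <= sq_error U (grid_process U h n) t w)%E].
pose S3 := \big[setU/set0]_(j < n)
  [set w | eta / (4 * t) <= sqnorm (euler_defect H U k (j * q) w)].
have mg1 : sp_mfun (grid_process U k (n * q)) by apply: sp_mfun_grid => //; exact: ltW.
have mg2 : sp_mfun (grid_process U h n) by apply: sp_mfun_grid => //; exact: ltW.
have mS1 : measurable S1 by apply: measurable_elevel; exact: measurable_sq_error.
have mS2 : measurable S2 by apply: measurable_elevel; exact: measurable_sq_error.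
have mS3 : measurable S3 by exact: bigsetU_measurable.
apply: (@le_trans _ _ (P ((S1 `|` S2) `|` S3))); last first.
  apply: le_trans (measureU2 P (measurableU _ _ mS1 mS2) mS3) _.
  apply: leeD; first exact: measureU2.
  apply: (@content_subadditive _ _ _ P S3 (fun j => [set w | eta / (4 * t) <= sqnorm (euler_defect H U k (j * q) w)]) n) => //.
apply: le_measure; rewrite ?inE.
- apply: measurable_strict_level; apply: measurable_sum => l.
  apply: measurable_funM => //; apply: mx_mfun_sqnorm.
  exact: (mx_known_mfun hwrt (r_ge0 l) (kPhi l)).
- by apply: measurableU => //; exact: measurableU.
move=> w /= hw; apply: contrapT => /not_orP[/not_orP[/negP h1 /negP h2] h3].
move: h1 h2; rewrite -!ltNge => h1 h2.
have {}h3 j : (j < n)%N -> sqnorm (euler_defect H U k (j * q) w) <= eta / (4 * t).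
  move=> jn; rewrite leNgt; apply/negP => hj; apply: h3.
  rewrite /S3 -(bigcup_mkord n (fun j => [set w | eta / (4 * t) <= sqnorm (euler_defect H U k (j * q) w)])).
  by exists j => //=; exact: ltW.
have rstrictm l : (l < n * q)%N -> r l < r l.+1 by [].
have og1 : on_partition r (n * q) (grid_process U k (n * q)) by move=> j /= jm; exists j.
have og2 : on_partition r (n * q) (grid_process U h n).
  by move=> j /= jm; exists (j * q)%N; rewrite ?rq// leq_pmul2r.
have r00 : r 0 = 0 by rewrite /r mul0r.
have := cells_le_sq_error rstrictm w r00 U_mfun U_cont mg1 mg2 og1 og2.
rewrite rm.
have blq i : (i < n * q)%N -> (i %/ q < n)%N by rewrite ltn_divLR.
(* On a fine cell the two grid processes take the values of [U] at the last fine and at the last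
   coarse point, so their difference is the oscillation of [U] to be controlled. *)
rewrite (eq_big_nat _ _ (F2 := fun i => k * sqnorm (U (r i) w - U (r (bl i)) w))); last first.
  move=> i /andP[_ im]; rewrite dr; congr (_ * sqnorm (_ - _)).
    by rewrite (sp_eval_grid _ _ k0 im)//; apply/andP; split=> //; exact: rstrict.
  have hi : (i %/ q)%:R * h < r i.+1 <= (i %/ q).+1%:R * h.
    rewrite -!rq ltr_pM2r// ler_pM2r// ltr_nat ler_nat ltnS leq_trunc_div /=.
    by rewrite ltn_ceil.
  by rewrite (sp_eval_grid _ _ h0 (blq i im) hi) rq.
(* The budget: the oscillation sum is below [2 eta / 16 + 2 eta / 16 = eta / 4] and counts twice;
   the defects, at most [eta / (4 t)] and counted twice over a total length [t], give the other
   [eta / 2]. *)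
have h4 : \sum_(0 <= l < n * q) (r l.+1 - r l) * sqnorm (Phi l w) <=
    2 * (\sum_(0 <= i < n * q) k * sqnorm (U (r i) w - U (r (bl i)) w)) + eta / 2.
  rewrite (_ : eta / 2 = \sum_(0 <= i < n * q) k * (2 * (eta / (4 * t)))); last first.
    rewrite sumr_const_nat subn0 -[RHS]mulr_natl mulrA.
    have -> : (n * q)%:R * k = t by exact: rm.
    by field; rewrite gt_eqF.
  rewrite mulr_sumr -big_split; apply: ler_sum_nat => i /andP[_ im].
  rewrite dr /= mulrCA -mulrDr ler_wpM2l ?(ltW k0)//.
  apply: le_trans (sqnorm_add_le _ _) _.
  by rewrite lerD2l ler_wpM2l// h3// blq.
have : (0 <= sq_error U (grid_process U k (n * q)) t w)%E.
  by apply: integral_ge0 => u _; rewrite lee_fin sqnorm_ge0.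
have : (0 <= sq_error U (grid_process U h n) t w)%E.
  by apply: integral_ge0 => u _; rewrite lee_fin sqnorm_ge0.
move: h1 h2 (lt_le_trans hw h4).
case: (sq_error U (grid_process U k (n * q)) t w) => [x||]//.
case: (sq_error U (grid_process U h n) t w) => [y||]//.
rewrite -!EFinM -EFinD !lte_fin !lee_fin; lra.
Qed.

End ErrorBound.
(** The order of choices matters: [n] is fixed first, large enough for the oscillation of [U] over
    coarse cells; then [q] is taken large for the finitely many coarse points. The left side does
    not involve [q]. *)
Lemma euler_cvg_in_probability (t eps e : R) : 0 <= t -> 0 < eps -> 0 < e ->
  exists n0, forall n, (n0 <= n)%N ->
  (P [set w | (eps <= sqnorm (U t w - euler (H ^~ w) (t / n.+1%:R) n.+1))%R] <= e%:E)%E.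
Proof.
rewrite le_eqVlt => /predU1P[<- eps0 e0|t0 eps0 e0].
  have eE n w : euler (H ^~ w) 0 n = 1%:M.
    elim: n => // n ih; rewrite eulerS ih !mulr0 subrr -[RHS]addr0; congr (_ + _).
    by rewrite step_mx0 mul0mx.
  exists 0%N => n _; rewrite (_ : [set w | _] = set0) ?measure0 ?lee_fin ?ltW//.
  by apply/seteqP; split=> w //=; rewrite mul0r eE U_start subrr sqnorm0 leNgt eps0.
have e40 : 0 < e / 4 by rewrite divr_gt0.
have e80 : 0 < e / 8 by rewrite divr_gt0.
have eps40 : 0 < eps / 4 by rewrite divr_gt0.
have [eta eta0 heta] := gronwall_cst_small (ltW t0) eps40 e40.
have eta16 : 0 < eta / 16 by rewrite divr_gt0.
have del0 : 0 < eta / (4 * t) by rewrite divr_gt0// mulr_gt0.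
have [n0 hn0] := grid_sq_error P U_mfun U_cont t0 eta16 e80.
exists n0 => n nn0.
set h := t / n.+1%:R; have h0 : 0 < h by rewrite divr_gt0.
have nh : n.+1%:R * h = t by rewrite mulrC divfK.
have en0 : 0 < e / (4 * n.+1%:R) by rewrite divr_gt0// mulr_gt0.
have [p hp] : exists p, forall q j, (p <= q)%N -> (j <= n.+1)%N ->
    (P [set w | (eta / (4 * t) <= sqnorm (euler_defect H U (h / q.+1%:R) (j * q.+1) w))%R] <=
     (e / (4 * n.+1%:R))%:E)%E.
  have : forall j, exists p, forall q, (p <= q)%N ->
    (P [set w | (eta / (4 * t) <= sqnorm (euler_defect H U (h / q.+1%:R) (j * q.+1) w))%R] <=
     (e / (4 * n.+1%:R))%:E)%E.
    move=> [|j].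
      exists 0%N => q _; rewrite (_ : [set w | _] = set0) ?measure0 ?lee_fin ?ltW//.
      apply/seteqP; split=> w //=; rewrite /euler_defect mul0n mul0r U_start big_geq//.
      by rewrite !subr0 subrr sqnorm0 leNgt del0.
    have jh0 : 0 < j.+1%:R * h by rewrite mulr_gt0.
    (* The point [j.+1 * h] is reached in [j.+1 * q.+1] fine steps, so [euler_defect_cvg] is used at
       that time with this number of steps; its index is one less. *)
    have [p hp] := euler_defect_cvg jh0 del0 en0.
    exists p => q pq; have := hp (j.+1 * q.+1).-1.
    have e1 : j.+1%:R * h / (j.+1 * q.+1)%:R = h / q.+1%:R.
      by rewrite natrM invfM mulrACA divff ?pnatr_eq0// mul1r.
    rewrite prednK ?muln_gt0// e1; apply.
    by rewrite mulSn addSn /= (leq_trans pq)// leq_addr.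
  move=> /choice[p hp]; exists (\max_(j < n.+2) p j) => q j qp jn; apply: hp.
  apply: leq_trans qp; exact: (@leq_bigmax _ (fun j : 'I_n.+2 => p j) (Ordinal (jn : (j < n.+2)%N))).
have [p1 hp1] := grid_sq_error P U_mfun U_cont t0 eta16 e80.
have [p2 hp2] := euler_defect_cvg t0 eps40 e40.
pose q := maxn p (maxn p1 p2).
have qp : (p <= q)%N by rewrite leq_max leqnn.
have nq : (n.+1 * q.+1).-1.+1 = (n.+1 * q.+1)%N by rewrite prednK// muln_gt0.
have qn : (q <= (n.+1 * q.+1).-1)%N by rewrite mulSn addSn /= leq_addr.
have hq : h / q.+1%:R = t / (n.+1 * q.+1)%:R by rewrite /h natrM invfM mulrA.
apply: le_trans (euler_error_bound h0 (ltn0Sn n) (ltn0Sn q) nh eps0 eta0) _.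
rewrite [X in (_ <= X%:E)%E](_ : e = e / 4 + (((e / 8 + e / 8) + e / 4) + e / 4)); last by field.
rewrite !EFinD; apply: leeD.
  by rewrite hq -nq; apply: hp2; apply: leq_trans qn; rewrite !leq_max leqnn !orbT.
apply: leeD; last by rewrite lee_fin.
apply: leeD; first apply: leeD.
- by rewrite hq -nq; apply: hp1; apply: leq_trans qn; rewrite !leq_max leqnn orbT.
- exact: hn0.
- apply: (@le_trans _ _ (\sum_(j < n.+1) (e / (4 * n.+1%:R))%:E)%E).
    by apply: lee_sum => j _; apply: hp => //; exact: ltnW.
  rewrite sumEFin lee_fin sumr_const card_ord -[leLHS]mulr_natr.
  by rewrite le_eqVlt; apply/orP; left; apply/eqP; field.
Qed.

End EulerConvergence.

(** * Passage to the limit and joint laws *)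

Section LawLimit.
Context {R : realType} {d : measure_display} {T : measurableType d}.
Variable P : probability T R.

(** The box is enlarged by [eps] when passing from [X] to [X'] and again from [Y'] to [Y]; the
    enlarged box of [Y] is brought back to [a] by continuity of [P] from above. Each of the three
    passages costs [e / 3]. *)
Lemma box_prob_le_of_approx m (X Y : 'I_m -> T -> R) (a : 'I_m -> R) :
  (forall i, measurable_fun setT (X i)) -> (forall i, measurable_fun setT (Y i)) ->
  (forall eps e : R, 0 < eps -> 0 < e -> exists X' Y' : 'I_m -> T -> R,
    [/\ forall i, measurable_fun setT (X' i), forall i, measurable_fun setT (Y' i),
        forall b : 'I_m -> R, P [set w | forall i, X' i w <= b i] =
                              P [set w | forall i, Y' i w <= b i],
        forall i, (P [set w | (eps <= `|X i w - X' i w|)%R] <= e%:E)%E &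
        forall i, (P [set w | (eps <= `|Y i w - Y' i w|)%R] <= e%:E)%E]) ->
  (P [set w | forall i, (X i w <= a i)%R] <= P [set w | forall i, (Y i w <= a i)%R])%E.
Proof.
move=> mX mY approx; apply/lee_addgt0Pr => e e0.
have mdist (f g : T -> R) c : measurable_fun setT f -> measurable_fun setT g ->
    measurable [set w | c <= `|f w - g w|].
  move=> mf mg; apply: measurable_level; apply: measurableT_comp => //.
  exact: measurable_funB.
have e30 : 0 < e / 3 by rewrite divr_gt0.
pose box (Z : 'I_m -> T -> R) b := [set w | forall i, Z i w <= b i].
have mbox Z b : (forall i, measurable_fun setT (Z i)) -> measurable (box Z b).
  exact: measurable_lower_box.
(* The shell added by an enlargement of [2 / k.+1]: no outcome belongs to it for all large [k]. The
   choice [eps = 1 / k.+1] makes two enlargements fit. *)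
pose A k := box Y (fun i => a i + 2 / k.+1%:R) `\` box Y a.
have mA k : measurable (A k) by apply: measurableD; exact: mbox.
have [k hk] : exists k, (P (A k) <= (e / 3)%:E)%E.
  have [|k hk] := @probability_eventually_out _ _ _ P A _ mA _ e30; last by exists k; exact: hk.
  move=> w; case: (pselect (box Y a w)) => [hw|/existsNP[i /negP]].
    by exists 0%N => n _ [_].
  rewrite -ltNge => hi; exists (Num.truncn (2 / (Y i w - a i))) => n hn [/(_ i) + _].
  apply/negP; rewrite -ltNge -ltrBrDl ltr_pdivrMr// mulrC -ltr_pdivrMr ?subr_gt0//.
  by apply: lt_le_trans (truncnS_gt _) _; rewrite ler_nat.
pose eps : R := k.+1%:R^-1; have eps0 : 0 < eps by rewrite invr_gt0.
have em0 : 0 < e / 3 / m.+1%:R by rewrite divr_gt0.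
have [X' [Y' [mX' mY' XY' hX hY]]] := approx _ _ eps0 em0.
have union (Z Z' : 'I_m -> T -> R) : (forall i, measurable_fun setT (Z i)) ->
    (forall i, measurable_fun setT (Z' i)) ->
    (forall i, (P [set w | (eps <= `|Z i w - Z' i w|)%R] <= (e / 3 / m.+1%:R)%:E)%E) ->
    forall b b', (forall i, b i + eps <= b' i) -> (P (box Z b) <= P (box Z' b') + (e / 3)%:E)%E.
  move=> mZ mZ' hZ b b' hb.
  pose C i := [set w | eps <= `|Z i w - Z' i w|].
  have mC i : measurable (C i) by exact: mdist.
  have mU : measurable (\bigcup_i C i) by apply: fin_bigcup_measurable => //; exact: finite_finset.
  apply: (@le_trans _ _ (P (box Z' b') + P (\bigcup_i C i))%E).
    apply: probability_le_ae => //; try exact: mbox.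
    apply: aeW => w /= hw; apply: contrapT => /not_orP[h1 h2].
    apply: h1 => i; have : ~ C i w by move=> h; apply: h2; exists i.
    move=> /negP; rewrite -ltNge ltr_norml => /andP[h3 _].
    have := hw i; have := hb i; lra.
  apply: leeD => //.
  (* A family indexed by [nat] is made from [C] for the use of subadditivity; the division by [m.+1]
     instead of [m] covers [m = 0]. *)
  pose D (j : nat) := if insub j is Some i then C i else set0.
  have DE (i : 'I_m) : D (val i) = C i by rewrite /D valK.
  apply: le_trans (@content_subadditive _ _ _ P (\bigcup_i C i) D m _ _ _) _ => //.
  - by move=> j /= jm; rewrite (DE (Ordinal jm)).
  - by rewrite -bigcup_mkord => w [i _ hi]; exists (val i) => /=; rewrite ?DE.
  - apply: (@le_trans _ _ (\sum_(i < m) (e / 3 / m.+1%:R)%:E)%E).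
      by apply: lee_sum => i _; rewrite DE; exact: hZ.
    rewrite sumEFin lee_fin sumr_const card_ord -[leLHS]mulr_natr mulrAC ler_pdivrMr//.
    by rewrite ler_wpM2l ?ler_nat// ltW.
have sym i : (P [set w | (eps <= `|Y' i w - Y i w|)%R] <= (e / 3 / m.+1%:R)%:E)%E.
  rewrite (_ : [set w | _] = [set w | eps <= `|Y i w - Y' i w|]); first exact: hY.
  by apply/seteqP; split=> w; rewrite /= distrC.
have h1 := union X X' mX mX' hX a (fun i => a i + eps) (fun i => lexx _).
have h2 : (P (box Y' (fun i => (a i + eps)%R)) <= P (box Y (fun i => (a i + 2 / k.+1%:R)%R)) + (e / 3)%:E)%E.
  by apply: (union Y' Y mY' mY sym) => i; rewrite (_ : 2 / _ = eps + eps) ?addrA// /eps mulr_natl mulr2n.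
have h3 : (P (box Y (fun i => (a i + 2 / k.+1%:R)%R)) <= P (box Y a) + (e / 3)%:E)%E.
  apply: (@le_trans _ _ (P (box Y a) + P (A k))%E); last by rewrite leeD2l.
  apply: probability_le_ae => //; try exact: mbox.
  by apply: aeW => w hw; case: (pselect (box Y a w)); [left|right].
apply: le_trans h1 _; rewrite XY'.
apply: le_trans (leeD h2 (lexx _)) _.
apply: le_trans (leeD (leeD h3 (lexx _)) (lexx _)) _.
rewrite -!addeA -!EFinD leeD2l// lee_fin; lra.
Qed.

Lemma box_prob_eq_of_approx m (X Y : 'I_m -> T -> R) (a : 'I_m -> R) :
  (forall i, measurable_fun setT (X i)) -> (forall i, measurable_fun setT (Y i)) ->
  (forall eps e : R, 0 < eps -> 0 < e -> exists X' Y' : 'I_m -> T -> R,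
    [/\ forall i, measurable_fun setT (X' i), forall i, measurable_fun setT (Y' i),
        forall b : 'I_m -> R, P [set w | forall i, X' i w <= b i] =
                              P [set w | forall i, Y' i w <= b i],
        forall i, (P [set w | (eps <= `|X i w - X' i w|)%R] <= e%:E)%E &
        forall i, (P [set w | (eps <= `|Y i w - Y' i w|)%R] <= e%:E)%E]) ->
  P [set w | forall i, (X i w <= a i)%R] = P [set w | forall i, (Y i w <= a i)%R].
Proof.
move=> mX mY approx; apply/eqP; rewrite eq_le; apply/andP; split.
  exact: box_prob_le_of_approx.
apply: box_prob_le_of_approx => // eps e eps0 e0.
have [X' [Y' [mX' mY' e' hX hY]]] := approx eps e eps0 e0.
by exists Y', X'; split.
Qed.

End LawLimit.

(** * Joint law of a process and an independent vector *)

Section JointLaw.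
Context {R : realType} {N : nat} {d : measure_display} {T : measurableType d}.
Variable P : probability T R.
Implicit Types X Y : R -> T -> 'M[R[i]]_N.

Lemma sigma_generated_sigma_algebra {E I : Type} (D : set I) (f : I -> E -> R) :
  sigma_algebra setT (sigma_generated D f).
Proof. exact: smallest_sigma_algebra. Qed.

Lemma sigma_generated_mfun {E : pointedType} {I : Type} (D : set I) (f : I -> E -> R) k :
  D k -> measurable_fun setT (f k : g_sigma_algebraType (sigma_generated D f) -> R).
Proof.
move=> Dk _ B mB; rewrite setTI.
rewrite (measurable_g_measurableTypeE (sigma_generated_sigma_algebra D f)).
exact: sigma_generated_preimage.
Qed.

Lemma sigma_generated_measurable {E : pointedType} {I : Type} (D : set I) (f : I -> E -> R)
    (B : set (g_sigma_algebraType (sigma_generated D f))) :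
  measurable B -> sigma_generated D f B.
Proof. by rewrite (measurable_g_measurableTypeE (sigma_generated_sigma_algebra D f)). Qed.

Lemma path_eval_mfun m n t : 0 <= t ->
  mx_mfun ((fun x => x t) :
    g_sigma_algebraType (@path_cylinder R m n) -> 'M[R[i]]_(m, n)).
Proof.
by move=> t0 k; exact: (@sigma_generated_mfun _ _ [set k : R * ('I_m * 'I_n * bool) | 0 <= k.1]
  (fun k x => mx_coord k.2 (x k.1)) (t, k)).
Qed.

Lemma path_preimage d' (T' : measurableType d') m n (g : T' -> R -> 'M[R[i]]_(m, n)) :
  (forall t, 0 <= t -> mx_mfun (g ^~ t)) ->
  forall B, path_cylinder B -> measurable (g @^-1` B).
Proof.
move=> mg B; apply: preimage_sigma_generated => -[t k] /= t0.
exact: mg.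
Qed.

Definition joint_coords : set (R * ('I_N * 'I_N * bool) + 'I_N * 'I_1 * bool) :=
  [set k | if k is inl k' then 0 <= k'.1 else True].

Definition joint_coord (k : R * ('I_N * 'I_N * bool) + 'I_N * 'I_1 * bool)
    (x : (R -> 'M[R[i]]_N) * 'cV[R[i]]_N) : R :=
  match k with inl k' => mx_coord k'.2 (x.1 k'.1) | inr c => mx_coord c x.2 end.

(** A box of the pair is the intersection of a condition on the path and one on the vector, so
    independence factors its probability and the marginal laws determine the joint law. The product
    process is a measurable function of the pair. *)
Lemma same_law_mul X Y (phi chi : T -> 'cV[R[i]]_N) :
  mx_path_mfun X -> mx_path_mfun Y -> mx_mfun phi -> mx_mfun chi ->
  process_indep_mx P X phi -> process_indep_mx P Y chi ->
  same_process_law P X Y -> same_distribution P phi chi ->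
  same_process_law P (fun t w => X t w *m phi w) (fun t w => Y t w *m chi w).
Proof.
move=> mX mY mphi mchi iX iY XY phichi.
have joint : forall B, sigma_generated joint_coords joint_coord B ->
    P ((fun w => (X ^~ w, phi w)) @^-1` B) = P ((fun w => (Y ^~ w, chi w)) @^-1` B).
  apply: law_determined_by_boxes => [[[t k]|k] //= t0|[[t k]|k] //= t0|n k a hk].
  - exact: mX.
  - exact: mphi.
  - exact: mY.
  - exact: mchi.
  (* Constraints of the other kind are replaced by [true], which keeps the same index set on both
     sides. *)
  pose B1 := [set x : R -> 'M[R[i]]_N | forall i,
    if k i is inl k' then mx_coord k'.2 (x k'.1) <= a i else true].
  pose B2 := [set v : 'cV[R[i]]_N | forall i,
    if k i is inr c then mx_coord c v <= a i else true].
  have trueT E : [set x : E | true] = setT by apply/seteqP; split.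
  have hB1 : path_cylinder B1.
    apply: sigma_generated_measurable; apply: measurable_forall => i.
    have := hk i; case: (k i) => [[t c] /= t0|c _].
      by apply: measurable_lower_level; exact: (path_eval_mfun t0).
    exact: (eq_ind_r measurable measurableT (trueT _)).
  have hB2 : mx_borel B2.
    apply: sigma_generated_measurable; apply: measurable_forall => i.
    case: (k i) => [_|c].
      exact: (eq_ind_r measurable measurableT (trueT _)).
    by apply: measurable_lower_level; exact: (@sigma_generated_mfun _ _ setT mx_coord).
  have split (Z : R -> T -> 'M[R[i]]_N) (xi : T -> 'cV[R[i]]_N) :
      [set w | forall i, joint_coord (k i) (Z ^~ w, xi w) <= a i] =
      [set w | B1 (Z ^~ w)] `&` xi @^-1` B2.
    apply/seteqP; split=> w /=.
      by move=> h; split=> i; have := h i; case: (k i).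
    by move=> [h1 h2] i; have := h1 i; have := h2 i; rewrite /B1 /B2 /=; case: (k i).
  by rewrite !split iX// iY// (XY _ hB1) (phichi _ hB2).
move=> B hB.
apply: (joint [set x | B (fun t => x.1 t *m x.2)]).
apply: sigma_generated_measurable.
apply: (@path_preimage _ (g_sigma_algebraType (sigma_generated joint_coords joint_coord)) _ _
  (fun x t => x.1 t *m x.2)) hB => t t0.
apply: mx_mfunM => k.
  exact: (@sigma_generated_mfun _ _ joint_coords joint_coord (inl (t, k))).
exact: (@sigma_generated_mfun _ _ joint_coords joint_coord (inr k)).
Qed.

End JointLaw.

(** * Invariance of unitary Brownian motion under conjugation *)

Section ConjugationInvariance.
Context {R : realType} {N : nat} {d : measure_display} {T : measurableType d}.
Variables (P : probability T R) (V : 'M[R[i]]_N) (U : R -> T -> 'M[R[i]]_N).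
Hypotheses (V_unitary : V \is unitarymx) (U_bm : unitary_brownian_motion P U).
Local Notation adj A := (A ^t* )%sesqui.

Let VV : V *m adj V = 1%:M. Proof. exact/unitarymxP. Qed.

Let VV' : adj V *m V = 1%:M. Proof. exact: mulmx1C VV. Qed.

Lemma step_mx_conj h (A : 'M[R[i]]_N) :
  step_mx h (V *m A *m adj V) = V *m step_mx h A *m adj V.
Proof.
rewrite /step_mx mulmxBr mulmxBl -scalemxAr -scalemxAl; congr (_ - _).
by rewrite mul_mx_scalar -scalemxAl VV scalemx1.
Qed.

Lemma euler_conj (x : R -> 'M[R[i]]_N) h n :
  euler (fun t => V *m x t *m adj V) h n = V *m euler x h n *m adj V.
Proof.
elim: n => [|n ih]; first by rewrite /euler mulmx1 VV.
rewrite !eulerS ih -mulmxBl -mulmxBr step_mx_conj (mulmxDr _ (euler x h n)) mulmxDl; congr (_ + _).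
by rewrite !mulmxA -[_ *m adj V *m V]mulmxA VV' mulmx1.
Qed.

Lemma unitary_brownian_motion_mfun : mx_path_mfun U.
Proof.
have [F [H [hwrt aU _ _ _]]] := U_bm => s s0.
by apply: (mx_known_mfun hwrt s0); apply/(mx_knownP hwrt _ s0); exact: aU.
Qed.

Lemma unitary_brownian_motion_conj_law :
  same_process_law P (fun t w => V *m U t w *m adj V) U.
Proof.
have mU := unitary_brownian_motion_mfun.
have mconj (X : R -> T -> 'M[R[i]]_N) : mx_path_mfun X ->
    mx_path_mfun (fun t w => V *m X t w *m adj V).
  move=> mX t t0; apply: mx_mfunM; last exact: mx_mfun_cst.
  by apply: mx_mfunM; [exact: mx_mfun_cst|exact: mX].
have [F [H [hwrt aU cU U0 sde]]] := U_bm.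
have [_ hbm _ _] := hwrt.
have mH : mx_path_mfun H by move=> t t0; exact: (hbm_mx_mfun hbm t0).
have kU s : 0 <= s -> mx_known F s (U s).
  by move=> s0; apply/(mx_knownP hwrt _ s0); exact: aU.
pose C := mul_cst N N N * (mul_cst N N N * sqnorm V * sqnorm (adj V)).
have C0 : 0 <= C.
  by rewrite !mulr_ge0 ?mul_cst_ge0 ?sqnorm_ge0.
have conj_le A : sqnorm (V *m A *m adj V) <= C * sqnorm A.
  apply: le_trans (sqnorm_mul_le _ _) _; rewrite /C -!mulrA ler_wpM2l ?mul_cst_ge0//.
  rewrite [leRHS](_ : _ = mul_cst N N N * (sqnorm V * sqnorm A) * sqnorm (adj V)); last by ring.
  by rewrite ler_wpM2r ?sqnorm_ge0// sqnorm_mul_le.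
apply: law_determined_by_boxes => [[t k] /= t0|[t k] /= t0|n k a hk].
- exact: mconj.
- exact: mU.
apply: box_prob_eq_of_approx => [i|i|eps e eps0 e0].
- exact: (mconj _ mU _ (hk i)).
- exact: (mU _ (hk i)).
have C10 : 0 < C + 1 by rewrite ltr_wpDl.
(* The constant [C + 1] is positive and serves both comparisons: a squared coordinate of the
   conjugated error is at most [C] times the squared norm of the error, that of the plain error at
   most once. *)
have eps'0 : 0 < eps ^+ 2 / (C + 1) by rewrite divr_gt0// exprn_gt0.
have /choice[p hp] : forall i, exists p, forall q, (p <= q)%N ->
    (P [set w | (eps ^+ 2 / (C + 1) <= sqnorm (U (k i).1 w -
      euler (H ^~ w) ((k i).1 / q.+1%:R) q.+1))%R] <= e%:E)%E.
  by move=> i; exact: (euler_cvg_in_probability hwrt kU cU U0 sde (hk i) eps'0 e0).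
(* One number of steps for all the times of the box, each time keeping its own step length. *)
pose q := \max_(i < n) p i.
pose E i (x : R -> 'M[R[i]]_N) := euler x ((k i).1 / q.+1%:R) q.+1.
have h0 i : 0 <= (k i).1 / q.+1%:R by rewrite divr_ge0//; exact: hk.
have mE (X : R -> T -> 'M[R[i]]_N) i : mx_path_mfun X -> mx_mfun (fun w => E i (X ^~ w)).
  by move=> mX; exact: euler_mfun.
have mVE i : mx_mfun (fun w => V *m E i (H ^~ w) *m adj V).
  apply: mx_mfunM; last exact: mx_mfun_cst.
  by apply: mx_mfunM; [exact: mx_mfun_cst|exact: mE].
have mD i : mx_mfun (fun w => U (k i).1 w - E i (H ^~ w)).
  by apply: mx_mfunB; [exact: (mU _ (hk i))|exact: mE].
have close i (f : T -> R) : measurable_fun setT f ->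
    (forall w, f w ^+ 2 <= (C + 1) * sqnorm (U (k i).1 w - E i (H ^~ w))) ->
    (P [set w | (eps <= `|f w|)%R] <= e%:E)%E.
  move=> mf hf; apply: le_trans (hp i q (leq_bigmax i)).
  apply: le_measure; rewrite ?inE.
  - by apply: measurable_level; exact: measurableT_comp.
  - by apply: measurable_level; exact: mx_mfun_sqnorm (mD i).
  - move=> w /= hw; rewrite ler_pdivrMr// mulrC; apply: le_trans (hf w).
    by rewrite -[leRHS]real_normK ?num_real// ler_sqr ?nnegrE// ltW.
exists (fun i w => mx_coord (k i).2 (V *m E i (H ^~ w) *m adj V)),
  (fun i w => mx_coord (k i).2 (E i (H ^~ w))); split.
- by move=> i; exact: mVE.
- by move=> i; exact: mE.
(* A box condition on the schemes is a cylinder event for the path of the noise; [euler_conj] turns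
   the conjugated scheme into the scheme of the conjugated noise, to which the equality of laws
   applies. *)
- move=> b; have := @hbm_conj_law _ _ _ _ _ _ hbm _ V_unitary
    [set x | forall i, mx_coord (k i).2 (E i x) <= b i].
  move=> /(_ _)/esym h; under eq_set do under eq_forall do rewrite -euler_conj.
  apply: h; apply: sigma_generated_measurable; apply: measurable_lower_box => i.
  apply: (@euler_mfun _ _ _ (g_sigma_algebraType path_cylinder) (fun t x => x t)) => // t t0.
  exact: path_eval_mfun.
- move=> i; apply: (close i) => [|w].
    apply: measurable_funB; [exact: (mconj _ mU _ (hk i))|exact: mVE].
  rewrite -mx_coordB -mulmxBl -mulmxBr.
  apply: le_trans (mx_coord_sqr_le _ _) _; apply: le_trans (conj_le _) _.
  by rewrite ler_wpM2r ?sqnorm_ge0// lerDl.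
- move=> i; apply: (close i) => [|w].
    apply: measurable_funB; [exact: (mU _ (hk i))|exact: mE].
  rewrite -mx_coordB; apply: le_trans (mx_coord_sqr_le _ _) _.
  by rewrite ler_peMl ?sqnorm_ge0// lerDr.
Qed.

End ConjugationInvariance.

Section Independence.
Context {R : realType} {N : nat} {d : measure_display} {T : measurableType d}.
Variable P : probability T R.

Lemma process_indep_conj (X : R -> T -> 'M[R[i]]_N) (phi : T -> 'cV[R[i]]_N)
    (A B C : 'M[R[i]]_N) :
  process_indep_mx P X phi ->
  process_indep_mx P (fun t w => A *m X t w *m B) (fun w => C *m phi w).
Proof.
move=> ind S D hS hD.
have hS' : path_cylinder [set x : R -> 'M[R[i]]_N | S (fun t => A *m x t *m B)].
  apply: sigma_generated_measurable.
  apply: (@path_preimage _ _ (g_sigma_algebraType (@path_cylinder R N N)) _ _ (fun x t => A *m x t *m B)) hS => t t0.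
  apply: mx_mfunM; last exact: mx_mfun_cst.
  by apply: mx_mfunM; [exact: mx_mfun_cst|exact: path_eval_mfun].
have hD' : mx_borel ([set v | D (C *m v)] : set 'cV[R[i]]_N).
  apply: sigma_generated_measurable.
  have : mx_mfun (fun v : g_sigma_algebraType mx_borel => C *m (v : 'cV[R[i]]_N)).
    apply: mx_mfunM; first exact: mx_mfun_cst.
    by move=> k; exact: (@sigma_generated_mfun _ _ _ setT mx_coord).
  by move=> /random_mxP; apply.
exact: (ind _ _ hS' hD').
Qed.

End Independence.

Theorem proposition3p2 (R : realType) (N : nat)
    (d : measure_display) (T : measurableType d) (P : probability T R)
    (V : 'M[R[i]]_N) (psi : T -> 'cV[R[i]]_N) (U : R -> T -> 'M[R[i]]_N)
    (V_unitary : V \is unitarymx)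
    (psi_random : random_mx psi)
    (psi_unit : forall w : T, sqnorm (psi w) = 1)
    (U_bm : unitary_brownian_motion P U)
    (U_psi_indep : process_indep_mx P U psi) :
  let psi_ : R -> T -> 'cV[R[i]]_N := fun t w => U t w *m psi w in
  same_process_law P (fun t w => V *m psi_ t w)
                     (fun t w => U t w *m (V *m psi w)) /\
  (same_process_law P (fun t w => V *m psi_ t w) psi_ <->
   same_distribution P (fun w => V *m psi w) psi).
Proof.
move=> psi_.
have VV : V *m (V ^t*)%sesqui = 1%:M by exact/unitarymxP.
have VV' : (V ^t*)%sesqui *m V = 1%:M by exact: mulmx1C VV.
have mU := unitary_brownian_motion_mfun U_bm.
have mpsi : mx_mfun psi by exact/random_mxP.
have mVpsi : mx_mfun (fun w => V *m psi w).
  by apply: mx_mfunM => //; exact: mx_mfun_cst.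
have U_Vpsi : process_indep_mx P U (fun w => V *m psi w).
  (* Identity matrices on both sides leave [U] as it is; only the vector is transformed. *)
  have := process_indep_conj 1%:M 1%:M V U_psi_indep.
  by under [X in process_indep_mx _ X]eq_fun do under eq_fun do rewrite mul1mx mulmx1.
have claim1 : same_process_law P (fun t w => V *m psi_ t w)
    (fun t w => U t w *m (V *m psi w)).
  have e : (fun t w => V *m psi_ t w) =
      (fun t w => V *m U t w *m (V ^t*)%sesqui *m (V *m psi w)).
    apply/funext => t; apply/funext => w.
    by rewrite /psi_ !mulmxA -[_ *m (V ^t*)%sesqui *m V]mulmxA VV' mulmx1.
  rewrite e; apply: (same_law_mul _ mU mVpsi mVpsi _ U_Vpsi _ _) => //.
  - move=> t t0; apply: mx_mfunM; last exact: mx_mfun_cst.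
    by apply: mx_mfunM; [exact: mx_mfun_cst|exact: mU].
  - exact: process_indep_conj.
  - exact: unitary_brownian_motion_conj_law.
split=> //; split=> [h B hB|h B hB].
(* Equality of the process laws is read at time 0, where [U] is the identity. *)
- have [F [H [_ _ _ U0 _]]] := U_bm.
  have hB' : path_cylinder [set x : R -> 'cV[R[i]]_N | B (x 0)].
    apply: sigma_generated_measurable.
    have /random_mxP := @path_eval_mfun R N 1 0 (lexx 0).
    exact.
  have := h _ hB'; rewrite /psi_ /=.
  by under eq_set do rewrite U0 mul1mx; under [in RHS]eq_set do rewrite U0 mul1mx.
(* By the first claim the law on the left is that of [U_t (V psi)]; the same [U] is independent of
   [V psi] and of [psi], which are equal in law. *)
- rewrite (claim1 B hB).
  exact: (same_law_mul mU mU mVpsi mpsi U_Vpsi U_psi_indep (fun C hC => erefl) h).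
Qed.
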